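(* Let $\ell_{\max}\ge 1$, let $G_{\mathrm{FDE}}:C^0([-\tau_{\max},0];\mathbb{R}^{n_y})\times\mathbb{R}^{n_p}\to\mathbb{R}^{n_y}$ be mildly differentiable to order $\ell_{\max}$, and let $R_{\mathrm{aff}}:C^0_\pi(\mathbb{R}^{n_y})\times\mathbb{R}^{n_p+1}\to\mathbb{R}^{n_p+1}$ be a continuous affine map. Suppose that the periodic boundary-value problem $$y'(t)=T\,G_{\mathrm{FDE}}(y(t+(\cdot)/T),p)\quad(t\in\mathbb{R}),\qquad 0=R_{\mathrm{aff}}[y,T,p],$$ for $1$-periodic $y$, $T>0$ and $p\in\mathbb{R}^{n_p}$, has a solution $x^*=(y^*,T^*,p^* )$, and that this boundary-value problem, linearized in $(y^*,T^*,p^* )$, has only the trivial solution $(\delta^y,\delta^T,\delta^p)=0$. Fix the degree $m\ge 1$ and a constant $C_{\mathrm{msh}}$, and for each $L$ let $0=t_0<\dots<t_L=1$ be a mesh with $\max_i\{t_i-t_{i-1}\}\le C_{\mathrm{msh}}/L$. Then for all sufficiently large $L$ the discretized boundary-value problem $$0=(y^L)'(t_{i,j})-T^L G_{\mathrm{FDE}}(y^L(t_{i,j}+(\cdot)/T^L),p^L)\quad(1\le i\le L,\ 1\le j\le m),\qquad 0=R_{\mathrm{aff}}[y^L,T^L,p^L],$$ for $T^L>0$, $p^L\in\mathbb{R}^{n_p}$ and $y^L$ a continuous $1$-periodic function that is a polynomial of degree at most $m$ (in each component) on each $[t_{i-1},t_i]$, has a locally unique solution $x_L=(y^L,T^L,p^L)$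 near $x^*$ (i.e. there is a radius $r>0$, independent of $L$, such that for all sufficiently large $L$ there is exactly one solution with $\|x_L-x^*\|_{0,1}\le r$), and it satisfies $$\|x_L-x^*\|_{0,1}:=\max\{\|y^L-y^*\|_{0,1},|T^L-T^*|,|p^L-p^*|\}=O(L^{-\min\{\ell_{\max},m\}})\quad (L\to\infty).$$
   Context: Spaces: $C^\ell_\pi(\mathbb{R}^n)$ is the space of $\ell$ times continuously differentiable $1$-periodic functions $\mathbb{R}\to\mathbb{R}^n$ with norm $\|v\|_\ell=\max_{t\in[0,1],\,j\le\ell}|v^{(j)}(t)|$. For Lipschitz continuous $1$-periodic $v$, $\|v\|_{0,1}=\max\{\|v\|_0,\mathrm{Lip}\,v\}$. For $T>0$, $y(t+(\cdot)/T)$ denotes the function $s\mapsto y(t+s/T)$ on $[-\tau_{\max},0]$. Mild differentiability: write $C^\ell$ for $C^\ell([-\tau_{\max},0];\mathbb{R}^{n})$. A functional $G:C^0\to\mathbb{R}^{n_G}$ is called $\ell_{\max}$ times mildly differentiable (mildly differentiable to order $\ell_{\max}$) if (1) for every $0\le\ell\le\ell_{\max}$ its restriction $G|_{C^\ell}:C^\ell\to\mathbb{R}^{n_G}$ is $\ell$ times continuously (Fréchet) differentiable (in particular $G$ is continuous), and (2) for every $1\le\ell\le\ell_{\max}$ the map $C^\ell\times C^\ell\ni(u,\delta^u)\mapsto D^\ell G(u)(\delta^u)^\ell\in\mathbb{R}^{n_G}$ has a continuous extension to $C^\ell\times C^{\ell-1}$, where $(\delta^u)^\ell$ is the $\ell$-tuple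 $(\delta^u,\dots,\delta^u)$ of arguments of the multilinear map $D^\ell G(u)$. For functionals with additional finite-dimensional arguments $p\in\mathbb{R}^{n_p}$ the definition is applied by treating $p$ as a constant function (i.e. $C^\ell$ is replaced by $C^\ell\times\mathbb{R}^{n_p}$ for every $\ell$). Linearized problem: put $G(y,T,p)=T\,G_{\mathrm{FDE}}(y((\cdot)/T),p)$ for $y\in C^0_\pi(\mathbb{R}^{n_y})$, $T>0$, $p\in\mathbb{R}^{n_p}$, and $y_t(s)=y(t+s)$. The solution satisfies $y^*\in C^2_\pi$, so the derivative $DG(y^*_t,T^*,p^* )$ exists. The linearization in $(y^*,T^*,p^* )$ is: $(\delta^y)'(t)=DG(y^*_t,T^*,p^* )[\delta^y_t,\delta^T,\delta^p]$ for all $t$, and $0=DR_{\mathrm{aff}}[\delta^y,\delta^T,\delta^p]$, where $\delta^y\in C^1_\pi(\mathbb{R}^{n_y})$, $\delta^T\in\mathbb{R}$, $\delta^p\in\mathbb{R}^{n_p}$ and $DR_{\mathrm{aff}}$ is the linear part of $R_{\mathrm{aff}}$. Collocation points: $t_{i,j}=t_{i-1}+(t_i-t_{i-1})t_{\mathrm{c},j}$, where $t_{\mathrm{c},1},\dots,t_{\mathrm{c},m}\in(0,1)$ are the $m$ (distinct) collocation points on $[0,1]$ for a sequence of orthogonal polynomials (e.g. Gauss–Legendre or Chebyshev points), fixed independently of $L$. *)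

(* Defs.v *)
From HB Require Import structures.
From mathcomp Require Import all_boot all_order all_algebra.
From mathcomp Require Import all_classical all_reals all_analysis.

Set Implicit Arguments.
Unset Strict Implicit.
Unset Printing Implicit Defensive.

Import Order.TTheory GRing.Theory Num.Theory.
Import numFieldNormedType.Exports.

Local Open Scope classical_set_scope.
Local Open Scope ring_scope.

(* A normed space is given by a subspace [A] of an ambient vector space [E]   *)
(* and a function [N] that is a seminorm on [A]; it stands for the quotient   *)
(* of [A] by the kernel of [N].  This lets C^l([-tau, 0]; R^n) be represented *)
(* by functions R -> R^n of which only the values on [-tau, 0] count: every   *)
(* map that is continuous for [N] factors through the quotient.               *)
Section SeminormedCalculus.
Context (R : realType) (E : lmodType R) (F : normedModType R).
Variables (A : set E) (N : E -> R).

Definition continuous_on (f : E -> F) : Prop :=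
  forall x, A x -> forall e : R, 0 < e -> exists2 d : R, 0 < d &
    forall y, A y -> N (y - x) < d -> `|f y - f x| < e.

Definition linear_part (f : E -> F) (x : E) : F := f x - f 0.

Definition continuous_affine (f : E -> F) : Prop :=
  (forall (a : R) x y, A x -> A y ->
     linear_part f (a *: x + y) = a *: linear_part f x + linear_part f y) /\
  continuous_on f.

Definition is_frechet_derivative (f : E -> F) (u : E) (L : E -> F) : Prop :=
  [/\ forall (a : R) x y, A x -> A y -> L (a *: x + y) = a *: L x + L y,
      exists C : R, forall x, A x -> `|L x| <= C * N x
    & forall e : R, 0 < e -> exists2 d : R, 0 < d &
        forall h, A h -> N h < d -> `|f (u + h) - f u - L h| <= e * N h].

(* Meaningful on [A] only, where the derivative is unique if it exists. *)
Definition frechet_derivative (f : E -> F) (u : E) : E -> F :=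
  get [set L : E -> F | is_frechet_derivative f u L].

(* A [k]-linear map takes its arguments as a sequence of size [k]. *)
Definition args (k : nat) : set (seq E) :=
  [set v | size v = k /\ forall x, x \in v -> A x].

Definition bounded_multilinear (k : nat) (M : seq E -> F) : Prop :=
  (forall s1 s2 (a : R) x y, args k (s1 ++ x :: s2) -> A y ->
     M (s1 ++ (a *: x + y) :: s2) = a *: M (s1 ++ x :: s2) + M (s1 ++ y :: s2))
  /\ exists C : R, forall v, args k v -> `|M v| <= C * \prod_(x <- v) N x.

(* [iterated_derivative f k D] : [f] is [k] times continuously Frechet        *)
(* differentiable on [A], with D u [:: d_1; ...; d_j] = D^j f(u)(d_1,...,d_j) *)
(* for j <= k.  As D^j f takes values in the space of bounded [j]-linear      *)
(* maps, its derivative and its continuity refer to the operator norm, that   *)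
(* is, to estimates that are uniform over the arguments [v].                  *)
Definition iterated_derivative (f : E -> F) (k : nat)
    (D : E -> seq E -> F) : Prop :=
  [/\ forall u, A u -> D u [::] = f u,
      forall j, (j <= k)%N -> forall u, A u -> bounded_multilinear j (D u),
      forall j, (j < k)%N -> forall u, A u ->
        forall e : R, 0 < e -> exists2 d : R, 0 < d &
          forall h, A h -> N h < d -> forall v, args j v ->
            `|D (u + h) v - D u v - D u (h :: v)|
              <= e * N h * \prod_(x <- v) N x
    & forall j, (j <= k)%N -> forall u, A u ->
        forall e : R, 0 < e -> exists2 d : R, 0 < d &
          forall h, A h -> N h < d -> forall v, args j v ->
            `|D (u + h) v - D u v| <= e * \prod_(x <- v) N x].

End SeminormedCalculus.

Section DelayInterval.
Context (R : realType) (tau : R) (n : nat).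
Implicit Types u : R -> 'rV[R]_n.

(* One-sided at the end points of [-tau, 0]. *)
Definition deriveI u (t : R) : 'rV[R]_n :=
  lim ((fun s => (s - t)^-1 *: (u s - u t)) @ within `[- tau, 0] t^').

Definition derivableI u (t : R) : Prop :=
  cvg ((fun s => (s - t)^-1 *: (u s - u t)) @ within `[- tau, 0] t^').

Definition CI (l : nat) : set (R -> 'rV[R]_n) :=
  [set u | (forall j, (j < l)%N -> forall t, t \in `[- tau, 0] ->
              derivableI (iter j deriveI u) t) /\
           (forall j, (j <= l)%N ->
              {within `[- tau, 0], continuous (iter j deriveI u)})].

Definition CI_norm (l : nat) u : R :=
  sup [set z | exists j t,
    [/\ (j <= l)%N, t \in `[- tau, 0] & z = `|iter j deriveI u t|]].

End DelayInterval.

Section MildDifferentiability.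
Context (R : realType) (tau : R) (n np nG : nat).

Definition hist : Type := ((R -> 'rV[R]_n) * 'rV[R]_np)%type.

Definition hist_C (l : nat) : set hist := [set u | CI tau l u.1].

Definition hist_norm (l : nat) (u : hist) : R :=
  Num.max (CI_norm tau l u.1) `|u.2|.

Definition mildly_differentiable (lmax : nat) (G : hist -> 'rV[R]_nG) : Prop :=
  forall l, (l <= lmax)%N -> exists D : hist -> seq hist -> 'rV[R]_nG,
    iterated_derivative (hist_C l) (hist_norm l) G l D /\
    ((1 <= l)%N -> exists2 X : hist * hist -> 'rV[R]_nG,
       forall u d, hist_C l u -> hist_C l d -> X (u, d) = D u (nseq l d)
     & continuous_on (hist_C l `*` hist_C l.-1)
         (fun z => Num.max (hist_norm l z.1) (hist_norm l.-1 z.2)) X).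

End MildDifferentiability.

Section PeriodicBVP.
Context (R : realType) (ny np : nat).

(* Triples x = (y, T, p). *)
Definition triple : Type := ((R -> 'rV[R]_ny) * R^o * 'rV[R]_np)%type.

Definition tri (y : R -> 'rV[R]_ny) (T : R) (p : 'rV[R]_np) : triple :=
  (y, T, p).
Definition yof (x : triple) : R -> 'rV[R]_ny := x.1.1.
Definition Tof (x : triple) : R := x.1.2.
Definition pof (x : triple) : 'rV[R]_np := x.2.

Definition one_periodic (y : R -> 'rV[R]_ny) : Prop :=
  forall t, y (t + 1) = y t.

Definition Cpi (l : nat) : set (R -> 'rV[R]_ny) :=
  [set y | [/\ one_periodic y,
    forall j, (j < l)%N -> forall t, derivable (derive1n j y) t 1
  & continuous (derive1n l y)]].

Definition Cpi_norm (l : nat) (y : R -> 'rV[R]_ny) : R :=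
  sup [set z | exists j t,
    [/\ (j <= l)%N, t \in `[0, 1] & z = `|derive1n j y t|]].

(* The least Lipschitz constant, for Lipschitz continuous [y]. *)
Definition Lip (y : R -> 'rV[R]_ny) : R :=
  sup [set z | exists t s, t != s /\ z = `|y t - y s| / `|t - s|].

Definition tri_C (l : nat) : set triple := [set x | Cpi l (yof x)].

Definition tri_norm (l : nat) (x : triple) : R :=
  Num.max (Cpi_norm l (yof x)) (Num.max `|Tof x| `|pof x|).

Definition tri_norm01 (x : triple) : R :=
  Num.max (Num.max (Cpi_norm 0 (yof x)) (Lip (yof x)))
          (Num.max `|Tof x| `|pof x|).

Variable GFDE : hist R ny np -> 'rV[R]_ny.
Variable Raff : triple -> 'rV[R]_np.+1.

Definition Grhs (x : triple) : 'rV[R]_ny :=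
  Tof x *: GFDE (fun s => yof x (s / Tof x), pof x).

Definition bvp_solution (x : triple) : Prop :=
  [/\ one_periodic (yof x), 0 < Tof x,
      forall t, derivable (yof x) t 1 /\
        derive1 (yof x) t = Tof x *: GFDE (fun s => yof x (t + s / Tof x), pof x)
    & Raff x = 0].

Definition shift_tri (t : R) (x : triple) : triple :=
  tri (fun s => yof x (t + s)) (Tof x) (pof x).

(* DG is the derivative of the restriction of [Grhs] to C^1_pi x R x R^np. *)
Definition linearized_solution (x d : triple) : Prop :=
  [/\ tri_C 1 d,
      forall t, derive1 (yof d) t =
        frechet_derivative (tri_C 1) (tri_norm 1) Grhs
          (shift_tri t x) (shift_tri t d)
    & linear_part Raff d = 0].

Definition is_mesh (L : nat) (t : nat -> R) : Prop :=
  [/\ t 0 = 0, t L = 1 & forall i, (i < L)%N -> t i < t i.+1].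

Definition piecewise_poly (m L : nat) (t : nat -> R)
    (y : R -> 'rV[R]_ny) : Prop :=
  forall i, (i < L)%N -> forall c, exists2 q : {poly R},
    (size q <= m.+1)%N & forall s, s \in `[t i, t i.+1] -> y s ord0 c = q.[s].

(* [t i] is the left end point: the subintervals are numbered from 0. *)
Definition colloc_point (m : nat) (t : nat -> R) (tc : 'I_m -> R)
    (i : nat) (j : 'I_m) : R :=
  t i + (t i.+1 - t i) * tc j.

Definition discrete_solution (m L : nat) (t : nat -> R) (tc : 'I_m -> R)
    (x : triple) : Prop :=
  [/\ [/\ one_periodic (yof x), continuous (yof x)
        & piecewise_poly m L t (yof x)],
      0 < Tof x,
      forall i j, (i < L)%N -> let s0 := colloc_point t tc i j in
        0 = derive1 (yof x) s0
            - Tof x *: GFDE (fun s => yof x (s0 + s / Tof x), pof x)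
    & 0 = Raff x].

End PeriodicBVP.

Section CollocationPoints.
Context (R : realType).

Definition orthogonal_polynomials (P : nat -> {poly R}) : Prop :=
  exists mu : {finite_measure set (measurableTypeR R) -> \bar R},
    [/\ mu (~` `[0, 1]) = 0%E,
        forall k, size (P k) = k.+1,
        forall j k, j != k ->
          (\int[mu]_(x in `[0%R, 1%R]) ((P j).[x] * (P k).[x])%:E = 0)%E
      & forall k,
          (0 < \int[mu]_(x in `[0%R, 1%R]) ((P k).[x] ^+ 2)%:E)%E].

Definition collocation_nodes (m : nat) (tc : 'I_m -> R) : Prop :=
  [/\ forall j, 0 < tc j < 1, injective tc &
      exists2 P, orthogonal_polynomials P & forall j, root (P m) (tc j)].

End CollocationPoints.

(* Main.v *)
Require Import Defs.
From HB Require Import structures.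
From mathcomp Require Import all_boot all_order all_algebra.
From mathcomp Require Import all_classical all_reals all_analysis.
From mathcomp Require Import ring lra.
Set Implicit Arguments.
Unset Strict Implicit.
Unset Printing Implicit Defensive.
Import Order.TTheory GRing.Theory Num.Theory.
Import numFieldNormedType.Exports.
Local Open Scope classical_set_scope.
Local Open Scope ring_scope.

(* The derivative of [t |-> G(z_t)] along a smooth curve of histories z involves
   only the continuous extensions in the definition of mild differentiability;
   bootstrapping the differential equation gives y* in C^(lmax + 1).  The
   extension of DG to arguments in C^0 also gives the linearization A a meaning
   on Lipschitz functions, with
     |F(x1) - F(x2) - A(x1 - x2)| <= e |x1 - x2|_{0,1}   for x1, x2 near x*,
   although F is not differentiable on C^{0,1}.
   Stability: on a mesh interval the derivative of a polynomial of degree m is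
   the Lagrange interpolant of its values at the m collocation points.  If
   normalized discrete functions had linearized residuals tending to 0, a limit
   along an ultrafilter would solve the linearized problem, hence vanish; then
   the right-hand sides A, the collocation values of the derivatives and
   finally the Lipschitz constants would tend to 0, which is absurd.  So
   |d|_{0,1} <= K |residual of d| on fine meshes.
   The discrete linearized problem is square, hence solvable, and the discrete
   problem is a fixed-point problem for a contraction in the coordinates given by
   the linearized residual.
   Stability applied to x_L and to the piecewise polynomial interpolant of y*
   bounds the error by the interpolation error. *)

(** * Derivatives and increment bounds *)

(** The obstacle is the unknown period: it rescales the argument of y, so a derivative in T costs a
    derivative of y. The difference of two histories is therefore split into a part taken at a
    common period, which is small in C^1, and a multiple of the difference of the periods, whose
    quotient converges in C^0 only. The first part is handled by the operator-norm continuity of DG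
    on C^1, the second by the extension of DG to C^0 arguments. As G is differentiable along smooth
    histories only, arguments are replaced by Steklov means: these gain a derivative, respect sup
    bounds and Lipschitz constants, and converge in C^0, where the extensions are continuous. The
    extensions are given on the diagonal (d, ..., d) only; polarization recovers the mixed values
    required by the chain rule. Piecewise polynomials have only one-sided derivatives at mesh
    points, so the mean value inequality is proved from right-hand bounds. The admissible
    linearization error e is fixed at 1/(2K), K being the stability constant: this yields both the
    contraction factor 1/2 and the absorption argument behind uniqueness and the error bound. *)

Section DerivativeBounds.
Context (R : realType) (F : normedModType R).
Implicit Types f g : R -> F.

(** Differentiability as an inequality that is trivial at [s = t]; it combines directly with
    increment bounds and has the shape of the expansions assumed of [G]. *)
Definition hasD f (t : R) (v : F) : Prop :=
  forall e : R, 0 < e -> exists2 d : R, 0 < d &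
    forall s, `|s - t| < d -> `|f s - f t - (s - t) *: v| <= e * `|s - t|.

Lemma continuousP_eps f : continuous f <->
  (forall t (e : R), 0 < e -> exists2 d : R, 0 < d &
     forall s, `|s - t| < d -> `|f s - f t| < e).
Proof.
split=> [fc t e e0|H t].
  have /cvgrPdist_lt/(_ e e0) := fc t.
  move=> /nbhs_ballP[d /= d0 D]; exists d => // s sd.
  by rewrite distrC; apply: D; rewrite /ball /= distrC.
apply/cvgrPdist_lt => e e0; have [d d0 D] := H t e e0.
apply/nbhs_ballP; exists d => //= s; rewrite /ball /= distrC => sd.
by rewrite distrC; exact: D.
Qed.

Lemma hasD_derivable f t v : hasD f t v -> derivable f t 1 /\ derive1 f t = v.
Proof.
move=> H.
have C : (fun h : R => h^-1 *: (f (h + t) - f t)) @ 0^' --> v.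
  apply/cvgrPdist_le => e e0; have [d d0 D] := H e e0.
  rewrite near_withinE /=; apply/nbhs_ballP; exists d => //= h.
  rewrite /ball /= sub0r normrN => hd h0.
  have := D (h + t); rewrite addrK => /(_ hd) E.
  have -> : v - h^-1 *: (f (h + t) - f t)
      = - (h^-1 *: (f (h + t) - f t - h *: v)).
    by rewrite [in RHS]scalerBr scalerA mulVf// scale1r opprB.
  rewrite normrN normrZ normfV mulrC ler_pdivrMr ?normr_gt0//.
have E : (fun h : R => h^-1 *: (f (h *: 1 + t) - f t)) =
    (fun h : R => h^-1 *: (f (h + t) - f t)).
  by apply/funext => h; rewrite [h *: 1]mulr1.
split; last exact: cvg_lim.
by rewrite /derivable /= E; apply/cvg_ex; exists v.
Qed.

Lemma derivable_hasD f t : derivable f t 1 -> hasD f t (derive1 f t).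
Proof.
move=> H e e0.
have E : (fun h : R => h^-1 *: (f (h *: 1 + t) - f t)) =
    (fun h : R => h^-1 *: (f (h + t) - f t)).
  by apply/funext => h; rewrite [h *: 1]mulr1.
move: H; rewrite /derivable /= E => /cvgrPdist_le /(_ e e0).
rewrite near_withinE /= => /nbhs_ballP[d /= d0 D].
exists d => // s sd; have [->|st] := eqVneq s t.
  by rewrite !subrr scale0r subrr !normr0 mulr0.
have st0 : s - t != 0 by rewrite subr_eq0.
have := D (s - t); rewrite /ball /= sub0r normrN subrK => /(_ sd st0).
rewrite -/(derive1 f t) => B.
have -> : f s - f t - (s - t) *: derive1 f t =
  - ((s - t) *: (derive1 f t - (s - t)^-1 *: (f s - f t))).
  by rewrite scalerBr scalerA divff// scale1r opprB.
by rewrite normrN normrZ mulrC ler_wpM2r.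
Qed.

Lemma hasD_continuous f : (forall t, exists v, hasD f t v) -> continuous f.
Proof.
move=> H; apply/continuousP_eps => t e e0.
have [v /(_ 1 ltr01)[d d0 D]] := H t.
have k0 : 0 < 1 + `|v| by rewrite ltr_wpDr.
exists (Num.min d (e / (1 + `|v|))); first by rewrite lt_min d0 divr_gt0.
move=> s; rewrite lt_min => /andP[s1 s2].
have := D s s1; rewrite mul1r => B.
have -> : f s - f t = (f s - f t - (s - t) *: v) + (s - t) *: v by rewrite subrK.
apply: (le_lt_trans (ler_normD _ _)); rewrite normrZ.
apply: (le_lt_trans (lerD B (lexx _))).
by rewrite -{1}(mulr1 `|s - t|) -mulrDr -ltr_pdivlMr.
Qed.

(* The supremum of the points of [a, b] up to which the bound holds is b. *)
Lemma increment_bound f (a b K : R) : a <= b -> continuous f ->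
  (forall x, a <= x < b -> forall e : R, 0 < e -> exists2 d : R, 0 < d &
     forall y, x <= y < x + d -> `|f y - f x| <= (K + e) * (y - x)) ->
  `|f b - f a| <= K * (b - a).
Proof.
move=> ab fc H; apply/ler_addgt0Pr => e e0.
(* The slack accumulates to at most [e] over the interval; the denominator [b - a + 1] also covers
   [a = b]. *)
pose k := K + e / (b - a + 1).
have ba0 : 0 < b - a + 1 by rewrite ltr_wpDl ?subr_ge0.
suff : `|f b - f a| <= k * (b - a).
  move/le_trans; apply; rewrite /k mulrDl lerD2l -mulrA ler_piMr ?(ltW e0)//.
  by rewrite mulrC ler_pdivrMr// mul1r lerDl.
pose S := [set s | a <= s <= b /\ `|f s - f a| <= k * (s - a)].
have Sa : S a by rewrite /S /= lexx ab !subrr !normr0 mulr0.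
have Sub : has_ubound S by exists b => s [/andP[_ ->]].
have Ssup : has_sup S by split; [exists a|].
have ac : a <= sup S by exact: ub_le_sup.
have cb : sup S <= b by apply: ge_sup; [exists a|move=> s [/andP[_ ->]]].
set c := sup S in ac cb.
have Sc : S c.
  split; first by rewrite ac cb.
  apply/ler_addgt0Pr => h h0.
  have q0 : 0 < h / 2 by rewrite divr_gt0.
  have [d d0 D] := (continuousP_eps f).1 fc c _ q0.
  have kk0 : 0 < `|k| + 1 by rewrite ltr_wpDl.
  have m0 : 0 < Num.min d (h / 2 / (`|k| + 1)) by rewrite lt_min d0 divr_gt0.
  have [s Ss cs] := sup_adherent m0 Ssup; rewrite -/c in cs.
  have sc : s <= c by exact: ub_le_sup.
  have csd : `|s - c| < Num.min d (h / 2 / (`|k| + 1)).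
    by rewrite distrC ger0_norm ?subr_ge0// ltrBlDl -ltrBlDr.
  move: csd; rewrite lt_min => /andP[s1 s2].
  have B1 : `|f s - f c| < h / 2 := D s s1.
  case: Ss => _ B2.
  have -> : f c - f a = - (f s - f c) + (f s - f a) by rewrite opprB addrA subrK.
  apply: (le_trans (ler_normD _ _)); rewrite normrN.
  apply: (le_trans (lerD (ltW B1) B2)).
  have -> : k * (s - a) = k * (c - a) + k * (s - c) by ring.
  rewrite addrC -addrA lerD2l.
  have : k * (s - c) <= h / 2.
    apply: (le_trans (ler_norm _)); rewrite normrM.
    move: s2; rewrite ltr_pdivlMr// mulrDr mulr1 => s2.
    have := normr_ge0 (s - c); lra.
  lra.
have [->|cb'] := eqVneq b c; first by case: Sc.
have {}cb : c < b by rewrite lt_neqAle eq_sym cb' cb.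
have e1 : 0 < e / (b - a + 1) by rewrite divr_gt0.
have [|d d0 D] := H c _ _ e1; first by rewrite ac cb.
(* A point beyond the supremum that still belongs to [S], which excludes [c < b]. *)
pose y := Num.min b (c + d / 2).
have cy : c < y by rewrite /y lt_min cb ltrDl divr_gt0.
have yb : y <= b by rewrite /y ge_min lexx.
have yd : y < c + d.
  rewrite /y gt_min; apply/orP; right; rewrite ltrD2l; lra.
have : S y.
  split; first by rewrite yb (le_trans ac (ltW cy)).
  have -> : f y - f a = (f y - f c) + (f c - f a) by rewrite addrA subrK.
  apply: (le_trans (ler_normD _ _)).
  have := D y; rewrite (ltW cy) yd => /(_ isT) B; case: Sc => _ B2.
  apply: (le_trans (lerD B B2)); rewrite -/k; have -> : k * (y - c) + k * (c - a) = k * (y - a) by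
    ring.
  by [].
move=> /(ub_le_sup Sub); rewrite -/c; lra.
Qed.

Lemma hasD_increment_bound f f' (a b K : R) : a <= b -> continuous f ->
  (forall x, a <= x < b -> hasD f x (f' x) /\ `|f' x| <= K) ->
  `|f b - f a| <= K * (b - a).
Proof.
move=> ab fc H; apply: increment_bound => // x xab e e0.
have [/(_ e e0)[d d0 D] B] := H x xab.
exists d => // y /andP[xy yd].
have := D y; rewrite ger0_norm ?subr_ge0// ltrBlDl => /(_ yd) E.
have -> : f y - f x = (f y - f x - (y - x) *: f' x) + (y - x) *: f' x by rewrite subrK.
apply: (le_trans (ler_normD _ _)); rewrite normrZ ger0_norm ?subr_ge0//.
rewrite [leRHS]mulrDl addrC lerD// mulrC ler_wpM2r// ?subr_ge0//.
Qed.

End DerivativeBounds.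

(** Compactness in the form used throughout: a local radius becomes a global one for any property
    inherited by smaller radii. It yields uniform continuity, boundedness, and the uniformity in
    time of local estimates. *)
Lemma segment_uniform (R : realType) (P : R -> R -> Prop) (a b : R) :
  (forall d d' t, d' <= d -> P d t -> P d' t) ->
  (forall t, a <= t <= b -> exists2 d : R, 0 < d &
     forall s, `|s - t| < d -> P d s) ->
  exists2 d : R, 0 < d & forall t, a <= t <= b -> P d t.
Proof.
move=> mono H.
have /compact_near_coveringP/(_ R (0 : R)^'+ P) := @segment_compact R a b.
have E : forall x, `[a, b]%classic x ->
    \forall x' \near x & i \near 0^'+, P i x'.
  move=> t; rewrite /= in_itv /= => /H[d d0 D].
  exists (ball t d, [set i | i < d]); last first.
    by move=> [s i] /= [ts /ltW id]; apply: mono id _; apply: D; rewrite distrC.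
  by split => /=; [exact: nbhsx_ballx|exact: nbhs_right_lt].
move=> /(_ _ E) {}E.
have : \forall d \near (0 : R)^'+, 0 < d /\ (`[a, b]%classic `<=` P d).
  by near=> d; split; [near: d; exact: nbhs_right_gt|near: d; exact: E].
move=> /filter_ex[d [d0 D]]; exists d => // t tab; exact: D.
Unshelve. all: by end_near. Qed.

Section ContinuousOnSegments.
Context (R : realType) (F : normedModType R).
Implicit Types f : R -> F.

Lemma continuous_uniform f (a b e : R) : continuous f -> 0 < e ->
  exists2 d : R, 0 < d &
    forall t s, a <= t <= b -> `|s - t| < d -> `|f s - f t| < e.
Proof.
move=> /continuousP_eps fc e0.
have := @segment_uniform R (fun d t => forall s, `|s - t| < d -> `|f s - f t| < e) a b.
case.
- by move=> d d' t dd' H s sd; apply: H; apply: lt_le_trans dd'.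
- move=> t _; have [d d0 D] := fc t (e / 2) ltac:(lra).
  exists (d / 2) => [|t' t't s st']; first by rewrite divr_gt0.
  have A : `|f t' - f t| < e / 2 by apply: D; lra.
  have B : `|f s - f t| < e / 2.
    apply: D; have -> : s - t = (s - t') + (t' - t) by rewrite addrA subrK.
    by apply: (le_lt_trans (ler_normD _ _)); lra.
  have -> : f s - f t' = (f s - f t) - (f t' - f t) by rewrite opprB addrA subrK.
  by apply: (le_lt_trans (ler_normB _ _)); lra.
- by move=> d d0 D; exists d => // t s tab; exact: D.
Qed.

Lemma continuous_bounded f (a b : R) : continuous f ->
  exists2 C : R, 0 < C & forall t, a <= t <= b -> `|f t| <= C.
Proof.
move=> /continuousP_eps fc.
(* The bound is encoded as [d^-1], so that a smaller [d] gives a weaker claim. *)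
have := @segment_uniform R (fun d t => 0 < d -> `|f t| <= d^-1) a b.
case.
- move=> d d' t dd' H d'0; have d0 := lt_le_trans d'0 dd'.
  by apply: (le_trans (H d0)); rewrite lef_pV2.
- move=> t _; have [d d0 D] := fc t 1 ltr01.
  have k0 : 0 < `|f t| + 1 by rewrite ltr_wpDl.
  exists (Num.min d (`|f t| + 1)^-1) => [|s].
    by rewrite lt_min d0 invr_gt0.
  rewrite lt_min => /andP[s1 _] m0.
  have B := D s s1.
  apply: (@le_trans _ _ (`|f t| + 1)).
    have -> : f s = f t + (f s - f t) by rewrite addrC subrK.
    by apply: (le_trans (ler_normD _ _)); rewrite lerD2l ltW.
  by rewrite -[leLHS]invrK lef_pV2 ?posrE ?invr_gt0// ge_min lexx orbT.
- by move=> d d0 D; exists d^-1; [rewrite invr_gt0|move=> t tab; exact: D].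
Qed.

Lemma hasD_ext f g t v : f =1 g -> hasD f t v -> hasD g t v.
Proof. by move=> /funext ->. Qed.

Lemma hasD_val f t v w : v = w -> hasD f t v -> hasD f t w.
Proof. by move=> ->. Qed.

Lemma hasDZ f t v (c : R) : hasD f t v -> hasD (fun s => c *: f s) t (c *: v).
Proof.
move=> H e e0.
have k0 : 0 < `|c| + 1 by rewrite ltr_wpDl.
have [d d0 D] := H (e / (`|c| + 1)) (divr_gt0 e0 k0); exists d => // s /D B.
rewrite -scalerBr scalerA mulrC -scalerA -scalerBr normrZ.
have := ler_wpM2l (normr_ge0 c) B.
move/le_trans; apply; rewrite mulrA ler_wpM2r// mulrCA ler_piMr ?(ltW e0)//.
by rewrite ler_pdivrMr// mul1r lerDl.
Qed.

Lemma hasDD f g t v w : hasD f t v -> hasD g t w ->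
  hasD (fun s => f s + g s) t (v + w).
Proof.
move=> H1 H2 e e0.
have e2 : 0 < e / 2 by rewrite divr_gt0.
have [d1 d10 D1] := H1 _ e2; have [d2 d20 D2] := H2 _ e2.
exists (Num.min d1 d2) => [|s]; first by rewrite lt_min d10.
rewrite lt_min => /andP[/D1 B1 /D2 B2].
have -> : f s + g s - (f t + g t) - (s - t) *: (v + w) =
   (f s - f t - (s - t) *: v) + (g s - g t - (s - t) *: w).
  by rewrite scalerDr !opprD !addrA [LHS](ACl (1*3*5*2*4*6)%AC).
by apply: (le_trans (ler_normD _ _)); lra.
Qed.

Lemma hasDB f g t v w : hasD f t v -> hasD g t w ->
  hasD (fun s => f s - g s) t (v - w).
Proof.
move=> H1 H2; have := hasDD H1 (hasDZ (-1) H2).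
rewrite scaleN1r; apply: hasD_ext => s; by rewrite scaleN1r.
Qed.

Lemma hasD_affine f t v (c k : R) : hasD f (c + k * t) v ->
  hasD (fun s => f (c + k * s)) t (k *: v).
Proof.
move=> H e e0.
have k0 : 0 < `|k| + 1 by rewrite ltr_wpDl.
have [d d0 D] := H (e / (`|k| + 1)) (divr_gt0 e0 k0).
exists (d / (`|k| + 1)) => [|s sd]; first by rewrite divr_gt0.
have E : c + k * s - (c + k * t) = k * (s - t) by ring.
have := D (c + k * s); rewrite E normrM.
have -> : `|k| * `|s - t| < d.
  move: sd; rewrite ltr_pdivlMr// mulrDr mulr1 mulrC.
  by have := normr_ge0 (s - t); lra.
move=> /(_ isT); rewrite scalerA [(s - t) * k]mulrC => /le_trans; apply.
rewrite mulrA ler_wpM2r// -mulrA ler_piMr ?(ltW e0)// mulrC ler_pdivrMr// mul1r.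
by rewrite lerDl.
Qed.

Lemma hasD_cst (w : F) t : hasD (fun=> w) t 0.
Proof.
by move=> e e0; exists 1 => // s _; rewrite scaler0 subrr subr0 normr0 mulr_ge0 // ltW.
Qed.

Lemma hasD_id_scale (w : F) t : hasD (fun s => s *: w) t w.
Proof.
move=> e e0; exists 1 => // s _.
by rewrite scalerBl subrr normr0 mulr_ge0 // ltW.
Qed.

Lemma hasD_near f g t v : (exists2 d : R, 0 < d & forall s, `|s - t| < d -> f s = g s) ->
  hasD f t v -> hasD g t v.
Proof.
move=> [d d0 D] H e e0; have [d' d'0 D'] := H e e0.
exists (Num.min d d') => [|s]; first by rewrite lt_min d0.
rewrite lt_min => /andP[s1 s2]; rewrite -!D ?subrr ?normr0//; exact: D'.
Qed.

Lemma hasD_unique f t v w : hasD f t v -> hasD f t w -> v = w.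
Proof. by move=> /hasD_derivable[_ <-] /hasD_derivable[_ <-]. Qed.

End ContinuousOnSegments.

(** * Primitives of vector-valued functions *)

Section RowVectors.
Context (R : realType) (n : nat).

Lemma rV_norm_le (v : 'rV[R]_n) (c : R) : 0 <= c ->
  (forall j, `|v ord0 j| <= c) -> `|v| <= c.
Proof.
by move=> c0 H; rewrite /Num.norm /= mx_normrE; apply: bigmax_le => // -[i j] _; rewrite ord1.
Qed.

Lemma rV_norm_ge (v : 'rV[R]_n) j : `|v ord0 j| <= `|v|.
Proof.
rewrite [leRHS]/Num.norm /= mx_normrE.
exact: (@le_bigmax _ _ _ _ (fun ij : 'I_1 * 'I_n => `|v ij.1 ij.2|) (ord0, j)).
Qed.

Lemma hasD_rV (f : R -> 'rV[R]_n) (t : R) (v : 'rV[R]_n) :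
  (forall j, hasD (fun s => f s ord0 j : R^o) t (v ord0 j)) -> hasD f t v.
Proof.
move=> H e e0.
have /choice[d D] : forall j, exists d : R, 0 < d /\ forall s, `|s - t| < d ->
   `|f s ord0 j - f t ord0 j - (s - t) * v ord0 j| <= e * `|s - t|.
  by move=> j; have [d d0 D] := H j e e0; exists d.
exists (\big[Num.min/1]_j d j).
  by apply/bigmin_gtP; split=> // j _; exact: (D j).1.
move=> s sd; apply: rV_norm_le => [|j]; first by rewrite mulr_ge0 ?(ltW e0).
rewrite !mxE; apply: (D j).2; apply: (lt_le_trans sd); exact: bigmin_le.
Qed.

(** The integral is differentiable beyond its lower limit. The limit -1 leaves room around 0, where
    [primitive_real] joins two such primitives. *)
Lemma primitive_half (g : R -> R) : continuous g ->
  exists P : R -> R, forall t, -1 < t -> hasD (P : R -> R^o) t (g t).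
Proof.
move=> gc; exists (fun x => \int[lebesgue_measure]_(t in `[-1, x]) g t)%R => t t1.
have tt : t < t + 1 by rewrite ltrDl.
have I : lebesgue_measure.-integrable `[-1, t + 1] (EFin \o g).
  apply: continuous_compact_integrable; first exact: segment_compact.
  by apply: continuous_subspaceT => x; exact: gc.
have [H1 H2] := @continuous_FTC1_closed R g (-1) t (t + 1) tt I t1 (gc t).
by rewrite -H2; exact: derivable_hasD.
Qed.

Lemma primitive_real (g : R -> R) : continuous g ->
  exists P : R -> R, forall t, hasD (P : R -> R^o) t (g t).
Proof.
move=> gc.
have [P HP] := primitive_half gc.
have gn : continuous (fun x : R => g (- x)).
  move=> x; apply: (@continuous_comp _ _ _ (fun x => - x) g); last exact: gc.
  exact: opp_continuous.
have [Q HQ] := primitive_half gn.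
have HQ' t : t < 1 -> hasD (fun s => - Q (- s) : R^o) t (g t).
  move=> t1; have := @hasD_affine R R^o Q t (g t) 0 (-1).
  rewrite add0r mulN1r => /(_ ltac:(by have := HQ (- t); rewrite opprK; apply; lra)).
  move=> /(@hasDZ R R^o _ _ _ (-1)).
  rewrite [_ *: _]mulN1r [_ *: _]mulN1r opprK; apply: hasD_ext => s.
  by rewrite add0r mulN1r [_ *: _]mulN1r.
(* The reflected primitive serves on the left and the direct one on the right. Both vanish at 0 and
   have derivative [g] around 0, so the junction is differentiable. *)
exists (fun t => if t < 0 then - Q (- t) + Q 0 else P t - P 0) => t.
have [t0|t0|t0] := ltgtP t 0.
- have := hasDB (HQ' t (lt_trans t0 ltr01)) (hasD_cst (- Q 0 : R^o) t).
  rewrite subr0; apply: hasD_near; exists (- t); first by rewrite oppr_gt0.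
  by move=> s; rewrite ltr_norml opprK => /andP[_ st]; rewrite opprK ifT//; lra.
- have := hasDB (HP t (lt_trans (ltrN10 R) t0)) (hasD_cst (P 0 : R^o) t).
  rewrite subr0; apply: hasD_near; exists t => //.
  move=> s; rewrite ltr_norml => /andP[st _]; rewrite ifF//.
  by apply/negbTE; rewrite -leNgt; lra.
- rewrite t0 => e e0.
  have [d1 d10 D1] := HP 0 (ltrN10 R) e e0.
  have [d2 d20 D2] := HQ' 0 ltr01 e e0.
  exists (Num.min d1 d2) => [|s]; first by rewrite lt_min d10.
  rewrite lt_min => /andP[/D1 B1 /D2 B2]; rewrite ltxx subrr subr0.
  by case: ifP => _ //; move: B2; rewrite oppr0 opprK.
Qed.

Lemma primitive (v : R -> 'rV[R]_n) : continuous v ->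
  exists Y : R -> 'rV[R]_n, forall t, hasD Y t (v t).
Proof.
move=> /continuousP_eps vc.
have /choice[P HP] : forall j, exists P : R -> R,
    forall t, hasD (P : R -> R^o) t (v t ord0 j).
  move=> j; apply: primitive_real; apply/(@continuousP_eps R R^o) => t e e0.
  have [d d0 D] := vc t e e0; exists d => // s /D; apply: le_lt_trans.
  by have := rV_norm_ge (v s - v t) j; rewrite !mxE.
exists (fun t => \row_j P j t) => t; apply: hasD_rV => j.
have -> : (fun s => (\row_j P j s) ord0 j : R^o) = P j by apply/funext => s; rewrite mxE.
exact: HP.
Qed.

End RowVectors.

(** * Smooth functions on the line and Steklov means *)

Section SmoothFunctions.
Context (R : realType) (n : nat).
Implicit Types (u v : R -> 'rV[R]_n) (l j : nat).

(** The functions live on the whole line: a history is a window of such a curve, so that one-sided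
    derivatives at the ends of the delay interval reduce to ordinary ones. *)
Definition smooth l v : Prop :=
  (forall j, (j < l)%N -> forall t, derivable (derive1n j v) t 1) /\
  continuous (derive1n l v).

(** A tower of candidate derivatives settles smoothness and the values of all [derive1n] at once;
    linear combinations, affine substitutions and Steklov means are treated this way. *)
Lemma smooth_intro l v (V : nat -> R -> 'rV[R]_n) : V 0 = v ->
  (forall j, (j < l)%N -> forall t, hasD (V j) t (V j.+1 t)) ->
  continuous (V l) ->
  smooth l v /\ forall j, (j <= l)%N -> derive1n j v = V j.
Proof.
move=> V0 VD Vc.
have E j : (j <= l)%N -> derive1n j v = V j.
  elim: j => [//|j IH jl]; rewrite derive1nS IH ?(ltnW jl)//.
  by apply/funext => t; exact: (hasD_derivable (VD j jl t)).2.
split=> //; split=> [j jl t|]; last by rewrite E.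
by rewrite E ?(ltnW jl)//; exact: (hasD_derivable (VD j jl t)).1.
Qed.

Lemma smooth_hasD l v j t : smooth l v -> (j < l)%N ->
  hasD (derive1n j v) t (derive1n j.+1 v t).
Proof. by move=> [H _] jl; rewrite derive1nS; exact: derivable_hasD (H j jl t). Qed.

Lemma smooth_continuous l v j : smooth l v -> (j <= l)%N -> continuous (derive1n j v).
Proof.
move=> vs; rewrite leq_eqVlt => /predU1P[->|jl]; first exact: vs.2.
by apply: hasD_continuous => t; exists (derive1n j.+1 v t); exact: smooth_hasD vs jl.
Qed.

Lemma smoothW l l' v : (l' <= l)%N -> smooth l v -> smooth l' v.
Proof.
move=> ll vs; split; last exact: smooth_continuous vs ll.
by move=> j jl; apply: vs.1; exact: leq_trans ll.
Qed.

Lemma smoothS l v : smooth l.+1 v <->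
  (forall t, derivable v t 1) /\ smooth l (derive1 v).
Proof.
split=> [vs|[v1 [H C]]].
  split; first exact: vs.1 0 isT.
  split=> [j jl|]; rewrite -derive1Sn; last exact: vs.2.
  by apply: vs.1.
split; last by rewrite derive1Sn.
by case=> [//|j] jl; rewrite derive1Sn; exact: H.
Qed.

Lemma smoothS_hasD l v v' : (forall t, hasD v t (v' t)) -> smooth l v' -> smooth l.+1 v.
Proof.
move=> H vs; apply/smoothS; split=> [t|]; first exact: (hasD_derivable (H t)).1.
suff -> : derive1 v = v' by [].
by apply/funext => t; exact: (hasD_derivable (H t)).2.
Qed.

Lemma smooth_linear l (a : R) u v : smooth l u -> smooth l v ->
  smooth l (a *: u + v) /\
  forall j, (j <= l)%N -> derive1n j (a *: u + v) = a *: derive1n j u + derive1n j v.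
Proof.
move=> us vs; apply: (smooth_intro (V := fun j => a *: derive1n j u + derive1n j v)) => //.
  move=> j jl t; apply: hasDD; last exact: smooth_hasD vs jl.
  by apply: hasDZ; exact: smooth_hasD us jl.
have cu := us.2; have cv := vs.2.
by move=> t; apply: cvgD; [apply: cvgZr; exact: cu|exact: cv].
Qed.

Lemma smooth_affine l (c k : R) v : smooth l v ->
  smooth l (fun s => v (c + k * s)) /\
  forall j, (j <= l)%N -> derive1n j (fun s => v (c + k * s)) =
    fun s => k ^+ j *: derive1n j v (c + k * s).
Proof.
move=> vs.
apply: (smooth_intro (V := fun j s => k ^+ j *: derive1n j v (c + k * s))).
- by apply/funext => s; rewrite expr0 scale1r.
- move=> j jl t; rewrite exprSr -scalerA; apply: hasDZ; apply: hasD_affine.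
  exact: smooth_hasD vs jl.
- move=> t; apply: cvgZr.
  apply: (@continuous_comp _ _ _ (fun s => c + k * s) (derive1n l v)); last exact: vs.2.
  by apply: cvgD; [exact: cvg_cst|apply: cvgM; [exact: cvg_cst|exact: cvg_id]].
Qed.

Lemma smooth_derive1 l v : smooth l.+1 v -> smooth l (derive1 v).
Proof. by move=> /smoothS[]. Qed.

Lemma smooth_cst l (c : 'rV[R]_n) : smooth l (fun=> c).
Proof.
have [] // := @smooth_intro l (fun=> c) (fun j _ => if j is 0 then c else 0).
- by move=> [|j] _ t; exact: hasD_cst.
- by case: l => [|l] t; exact: cvg_cst.
Qed.

Definition prim v : R -> 'rV[R]_n := get [set Y | forall t, hasD Y t (v t)].

Lemma prim_hasD v t : continuous v -> hasD (prim v) t (v t).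
Proof. by move=> /primitive[Y HY]; exact: (@getI _ [set Y | forall t, hasD Y t (v t)] Y HY). Qed.

(** The difference of two primitives has derivative 0, so the increment bound applies with constant
    0. *)
Lemma increment_unique (Y Z v : R -> 'rV[R]_n) a b : (forall t, hasD Y t (v t)) ->
  (forall t, hasD Z t (v t)) -> Y b - Y a = Z b - Z a.
Proof.
wlog ab : a b / a <= b => [W|] HY HZ.
  have [ab|ba] := leP a b; first exact: W.
  by rewrite -[LHS]opprB -[RHS]opprB; congr (- _); apply: W => //; exact: ltW.
have H t : hasD (fun s => Y s - Z s) t 0 by rewrite -(subrr (v t)); exact: hasDB.
have C : continuous (fun s => Y s - Z s) by apply: hasD_continuous => t; exists 0.
have H0 x : a <= x < b -> hasD (fun s => Y s - Z s) x 0 /\ `|0 : 'rV[R]_n| <= 0.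
  by move=> _; rewrite normr0.
have := @hasD_increment_bound R _ (fun s => Y s - Z s) (fun=> 0) a b 0 ab C H0.
rewrite mul0r normr_le0 subr_eq0 => /eqP E; rewrite -[Y b](subrK (Z b)) E [LHS](ACl
  ((1*4)*(3*2))%AC) /=.
by rewrite subrr add0r.
Qed.

(** The Steklov mean, that is, the average of [v] over [[t, t + e]]. It gains one derivative,
    commutes with differentiation, and keeps periodicity, sup bounds and Lipschitz constants. *)
Definition steklov (e : R) v : R -> 'rV[R]_n :=
  fun t => e^-1 *: (prim v (t + e) - prim v t).

Lemma steklov_hasD e v t : continuous v ->
  hasD (steklov e v) t (e^-1 *: (v (t + e) - v t)).
Proof.
move=> vc; apply: hasDZ; apply: hasDB; last exact: prim_hasD.
have := @hasD_affine R _ (prim v) t (v (e + 1 * t)) e 1 (prim_hasD _ vc).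
by rewrite mul1r scale1r addrC; apply: hasD_ext => s; rewrite mul1r addrC.
Qed.

Lemma steklov_continuous e v : continuous v -> continuous (steklov e v).
Proof. by move=> vc; apply: hasD_continuous => t; eexists; exact: steklov_hasD. Qed.

Lemma steklov_primE e v Y t : continuous v -> (forall t, hasD Y t (v t)) ->
  steklov e v t = e^-1 *: (Y (t + e) - Y t).
Proof.
move=> vc HY; congr (_ *: _); apply: increment_unique HY => s; exact: prim_hasD.
Qed.

(** Subtracting [s *: c] from the primitive turns closeness of [v] to [c] into an increment
    bound. *)
Lemma steklov_near e v t (c : 'rV[R]_n) K : continuous v -> 0 < e ->
  (forall s, t <= s < t + e -> `|v s - c| <= K) -> `|steklov e v t - c| <= K.
Proof.
move=> vc e0 H.
have D s : hasD (fun s => prim v s - s *: c) s (v s - c).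
  by apply: hasDB; [exact: prim_hasD|exact: hasD_id_scale].
have C : continuous (fun s => prim v s - s *: c).
  by apply: hasD_continuous => s; eexists; exact: D.
have te : t <= t + e by rewrite lerDl ltW.
have := @hasD_increment_bound R _ _ (fun s => v s - c) t (t + e) K te C.
move=> /(_ (fun x xt => conj (D x) (H x xt))).
rewrite (_ : t + e - t = e) => [B|]; last by ring.
have -> : steklov e v t - c =
   e^-1 *: (prim v (t + e) - (t + e) *: c - (prim v t - t *: c)).
  rewrite /steklov -{1}(scale1r c) -{1}(mulVf (lt0r_neq0 e0)) -scalerA -scalerBr.
  congr (_ *: _); rewrite scalerDl !opprD opprK !addrA [RHS](ACl (1*4*3*(2*5))%AC) /=.
  by rewrite addNr addr0.
by rewrite normrZ ger0_norm ?invr_ge0 ?(ltW e0)// mulrC ler_pdivrMr.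
Qed.

Lemma steklov_linear e a u v : continuous u -> continuous v ->
  steklov e (a *: u + v) = a *: steklov e u + steklov e v.
Proof.
move=> uc vc; apply/funext => t.
have c : continuous (a *: u + v).
  by move=> s; apply: cvgD; [apply: cvgZr; exact: uc|exact: vc].
rewrite (@steklov_primE e _ (fun s => a *: prim u s + prim v s))//.
  rewrite /steklov /= /GRing.add /GRing.scale /= -/(GRing.add _ _).
  rewrite scalerA mulrC -scalerA -scalerDr.
  by congr (_ *: _); rewrite scalerBr opprD addrACA.
by move=> s; apply: hasDD; [apply: hasDZ|]; exact: prim_hasD.
Qed.

(** [v] is a primitive of [v'], so the mean of [v'] is a difference quotient of [v], which is also
    the derivative of the mean of [v]. *)
Lemma steklov_derive e v v' t : continuous v' -> (forall t, hasD v t (v' t)) ->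
  hasD (steklov e v) t (steklov e v' t).
Proof.
move=> v'c H; rewrite (steklov_primE e t v'c H); apply: steklov_hasD.
by apply: hasD_continuous => s; eexists; exact: H.
Qed.

Lemma steklov_smooth e l v : smooth l v -> smooth l.+1 (steklov e v) /\
  forall j, (j <= l)%N -> derive1n j (steklov e v) = steklov e (derive1n j v).
Proof.
move=> vs.
(* At the top order [derive1n l v] need not be differentiable, so the derivative of its mean is
   written as a difference quotient. *)
pose V j := if (j <= l)%N then steklov e (derive1n j v) else
  fun t => e^-1 *: (derive1n l v (t + e) - derive1n l v t).
have [|||A B] := @smooth_intro l.+1 (steklov e v) V.
- by [].
- move=> j; rewrite ltnS leq_eqVlt => /predU1P[->|jl] t; rewrite /V.
    by rewrite leqnn ltnn; apply: steklov_hasD; exact: vs.2.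
  rewrite (ltnW jl) jl; apply: steklov_derive; first exact: smooth_continuous vs jl.
  by move=> s; exact: smooth_hasD vs jl.
- rewrite /V ltnn => t; apply: cvgZr; apply: cvgB; last exact: vs.2.
  apply: (@continuous_comp _ _ _ (fun s => s + e) (derive1n l v)); last exact: vs.2.
  by apply: cvgD; [exact: cvg_id|exact: cvg_cst].
by split=> // j jl; rewrite B ?(leqW jl)// /V jl.
Qed.

Lemma steklov_periodic e v t : continuous v -> (forall s, v (s + 1) = v s) ->
  steklov e v (t + 1) = steklov e v t.
Proof.
move=> vc vp; rewrite (@steklov_primE e v (fun s => prim v (1 + 1 * s)) t)//.
  by rewrite !mul1r /steklov (addrC 1) (addrC 1) addrAC.
move=> s; have := @hasD_affine R _ (prim v) s (v (1 + 1 * s)) 1 1 (prim_hasD _ vc).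
by rewrite mul1r scale1r addrC vp.
Qed.

End SmoothFunctions.

(** * Histories and iterated derivatives *)

Section Histories.
Context (R : realType) (tau : R) (n np : nat).
Hypothesis tau_gt0 : 0 < tau.
Implicit Types (v : R -> 'rV[R]_n) (l j : nat).

(** As [tau] is positive, every point of the interval can be approached from the side of the farther
    end. Properness makes the limit in [deriveI] unique. *)
Lemma within_proper (t : R) : t \in `[- tau, 0] ->
  ProperFilter (within `[- tau, 0] t^').
Proof.
rewrite in_itv /= => /andP[t1 t2].
apply: Build_ProperFilter_ex => A; rewrite /within /dnbhs /within /= => /nbhs_ballP[d /= d0 D].
pose h := Num.min (d / 2) (tau / 2).
have h0 : 0 < h by rewrite lt_min !divr_gt0.
have hd : h < d by rewrite gt_min; apply/orP; left; lra.
have ht : h <= tau / 2 by rewrite ge_min lexx orbT.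
have [tt|tt] := leP (- tau / 2) t.
  exists (t - h); apply: D; rewrite /ball /= ?in_itv /=; last 2 first.
  - by rewrite -subr_eq0 addrAC subrr add0r oppr_eq0 gt_eqF.
  - by apply/andP; split; lra.
  by rewrite opprB addrC subrK gtr0_norm.
exists (t + h); apply: D; rewrite /ball /= ?in_itv /=; last 2 first.
- by rewrite -subr_eq0 addrAC subrr add0r gt_eqF.
- by apply/andP; split; lra.
by rewrite opprD addrA subrr add0r normrN gtr0_norm.
Qed.

(** [deriveI] reads [u] on the delay interval only, so it can be computed from any differentiable
    [v] that agrees with [u] there. *)
Lemma hasD_deriveI u v t (w : 'rV[R]_n) : t \in `[- tau, 0] ->
  {in `[- tau, 0], u =1 v} -> hasD v t w ->
  derivableI tau u t /\ deriveI tau u t = w.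
Proof.
move=> tI uv H.
have C : (fun s => (s - t)^-1 *: (u s - u t)) @ within `[- tau, 0] t^' --> w.
  apply/cvgrPdist_le => e e0; have [d d0 D] := H e e0.
  apply/nbhs_ballP; exists d => //= s.
  rewrite /ball /= distrC => sd st sI.
  have st0 : s - t != 0 by rewrite subr_eq0.
  rewrite !uv//.
  have -> : w - (s - t)^-1 *: (v s - v t)
      = - ((s - t)^-1 *: (v s - v t - (s - t) *: w)).
    by rewrite [in RHS]scalerBr scalerA mulVf// scale1r opprB.
  rewrite normrN normrZ normfV mulrC ler_pdivrMr ?normr_gt0//; exact: D.
have P := within_proper tI.
by split; [apply/cvg_ex; exists w|exact: cvg_lim].
Qed.

Lemma iter_deriveI l v j : smooth l v -> (j <= l)%N ->
  {in `[- tau, 0], iter j (@deriveI R tau n) v =1 derive1n j v}.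
Proof.
move=> vs; elim: j => [//|j IH] jl t tI.
exact: (hasD_deriveI tI (IH (ltnW jl)) (smooth_hasD t vs jl)).2.
Qed.

Lemma smooth_CI l v : smooth l v -> CI tau l v.
Proof.
move=> vs; split => [j jl t tI|j jl].
  have Ej := iter_deriveI vs (ltnW jl).
  exact: (hasD_deriveI tI Ej (smooth_hasD t vs jl)).1.
apply: (@subspace_eq_continuous _ _ _ (derive1n j v)).
  move=> t; rewrite inE /= => tI.
  by symmetry; exact: iter_deriveI vs jl t tI.
apply: (@continuous_subspaceT _ _ `[- tau, 0]%classic (derive1n j v)) => t.
exact: smooth_continuous vs jl t.
Qed.

(** Continuous derivatives are bounded on the compact interval, so the set under the supremum is
    nonempty and bounded, and [sup] can be traded for pointwise inequalities. *)
Lemma CI_normP l v (c : R) : smooth l v ->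
  (CI_norm tau l v <= c <->
   forall j t, (j <= l)%N -> - tau <= t <= 0 -> `|derive1n j v t| <= c).
Proof.
move=> vs; rewrite /CI_norm.
set S := [set z | _].
have I0 : (0 : R) \in `[- tau, 0] by rewrite in_itv /= lexx oppr_le0 ltW.
have S0 : S !=set0 by exists `|v 0|, 0%N, 0; split.
have Sub : has_ubound S.
  have bnd j : exists C : R, forall t, (j <= l)%N -> - tau <= t <= 0 -> `|derive1n j v t| <= C.
    have [jl|jl] := leqP j l; last by exists 0.
    have [C C0 HC] := @continuous_bounded R _ _ (- tau) 0 (smooth_continuous vs jl).
    by exists C => t _; exact: HC.
  have /choice[C HC] := bnd.
  exists (\big[Num.max/0]_(j < l.+1) C j) => z [j [t [jl tI ->]]].
  rewrite (iter_deriveI vs jl)//.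
  apply: (le_trans (HC j t jl _)); first by move: tI; rewrite in_itv.
  exact: (@le_bigmax _ _ _ _ (fun j : 'I_l.+1 => C j) (Ordinal (jl : (j < l.+1)%N))).
split=> [Sc j t jl tI|H].
  have Sz : S `|derive1n j v t| by exists j, t; split; [exact: jl|exact:
    tI|rewrite (iter_deriveI vs jl)].
  exact: le_trans (ub_le_sup Sub Sz) Sc.
apply: ge_sup => // z [j [t [jl tI ->]]].
by rewrite (iter_deriveI vs jl)//; apply: H => //; move: tI; rewrite in_itv.
Qed.

(** A subspace of [hist_C l], to which the assumptions on [G] are restricted: it contains the
    windows of globally smooth curves. *)
Definition smooth_hist l : set (hist R n np) := [set w | smooth l w.1].
Local Notation N := (@hist_norm R tau n np).

Lemma smooth_hist_C l w : smooth_hist l w -> hist_C tau l w.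
Proof. exact: smooth_CI. Qed.

Lemma hist_normP l w (c : R) : smooth_hist l w ->
  (N l w <= c <-> (forall j t, (j <= l)%N -> - tau <= t <= 0 ->
                     `|derive1n j w.1 t| <= c) /\ `|w.2| <= c).
Proof.
move=> ws; rewrite /hist_norm ge_max; split=> [/andP[/(CI_normP _ ws) H1 H2]|[H1 H2]] //.
by rewrite H2 andbT; apply/CI_normP.
Qed.

Lemma hist_norm_ge l w j t : smooth_hist l w -> (j <= l)%N -> - tau <= t <= 0 ->
  `|derive1n j w.1 t| <= N l w.
Proof. by move=> ws jl tI; have [/(_ (lexx _))[H _] _] := hist_normP (N l w) ws; exact: H. Qed.

Lemma hist_norm_ge2 l w : smooth_hist l w -> `|w.2| <= N l w.
Proof. by move=> ws; have [/(_ (lexx _))[]] := hist_normP (N l w) ws. Qed.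

Lemma hist_norm_ge0 l w : smooth_hist l w -> 0 <= N l w.
Proof. by move=> /hist_norm_ge2; apply: le_trans. Qed.

Lemma smooth_hist_linear l (a : R) x y : smooth_hist l x -> smooth_hist l y ->
  smooth_hist l (a *: x + y).
Proof. by move=> xs ys; exact: (smooth_linear a xs ys).1. Qed.

Lemma hist_norm_linear l (a : R) x y : smooth_hist l x -> smooth_hist l y ->
  N l (a *: x + y) <= `|a| * N l x + N l y.
Proof.
move=> xs ys; apply/hist_normP; first exact: smooth_hist_linear.
split=> [j t jl tI|]; last first.
  apply: (le_trans (ler_normD _ _)); rewrite normrZ lerD ?ler_wpM2l//; exact: hist_norm_ge2.
rewrite (smooth_linear a xs ys).2//.
apply: (le_trans (ler_normD _ _)); rewrite normrZ lerD ?ler_wpM2l//; exact: hist_norm_ge.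
Qed.

Lemma smooth_histW l l' w : (l' <= l)%N -> smooth_hist l w -> smooth_hist l' w.
Proof. exact: smoothW. Qed.

Lemma hist_normW l l' w : (l' <= l)%N -> smooth_hist l w -> N l' w <= N l w.
Proof.
move=> ll ws; apply/hist_normP; first exact: smooth_histW ws.
split=> [j t jl tI|]; last exact: hist_norm_ge2.
by apply: hist_norm_ge => //; exact: leq_trans ll.
Qed.

Lemma smooth_hist0 l : smooth_hist l 0.
Proof. exact: (@smooth_cst _ _ l 0). Qed.

End Histories.

(** * Symmetry and chain rule for iterated derivatives *)

Section IteratedDerivatives.
Context (R : realType) (E : lmodType R) (F : normedModType R).
Implicit Types (pre v : seq E).

(** The variation of [g] is multiplied by [s] and so is of second order. Iteration handles powers of
    [s] and the arguments of a multilinear map one by one. *)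
Lemma hasD_scaleM (g : R -> F) w : hasD g 0 w -> hasD (fun s => s *: g s) 0 (g 0).
Proof.
move=> H e e0; have [d d0 HD] := H 1 ltr01.
have k0 : 0 < 1 + `|w| by rewrite ltr_wpDr.
exists (Num.min d (e / (1 + `|w|))) => [|s]; first by rewrite lt_min d0 divr_gt0.
rewrite lt_min subr0 => /andP[s1]; rewrite ltr_pdivlMr// => s2.
have := HD s; rewrite subr0 mul1r => /(_ s1) B.
rewrite scale0r subr0 -scalerBr normrZ mulrC ler_wpM2r//.
rewrite -[X in `|X|](subrK (s *: w)).
apply: (le_trans (ler_normD _ _)); rewrite normrZ; lra.
Qed.

Lemma hasD_shift (g : R -> F) (t c : R) w : hasD g (t - c) w ->
  hasD (fun s => g (s - c)) t w.
Proof.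
have := @hasD_affine R F g t w (- c) 1.
rewrite mul1r scale1r addrC => H /H; apply: hasD_ext => s.
by rewrite mul1r addrC.
Qed.

Lemma hasD_sum (I : Type) (r : seq I) (g : I -> R -> F) (w : I -> F) t :
  (forall i, hasD (g i) t (w i)) ->
  hasD (fun s => \sum_(i <- r) g i s) t (\sum_(i <- r) w i).
Proof.
move=> H; elim: r => [|i r IH].
  by rewrite big_nil; apply: hasD_ext (hasD_cst 0 t) => s; rewrite big_nil.
by rewrite big_cons; apply: hasD_ext (hasDD (H i) IH) => s; rewrite big_cons.
Qed.

(* The weights come from inverting the Vandermonde matrix of 0, 1, ..., r. *)
Lemma derivative_weights (r : nat) : exists lam : nat -> R, forall c : nat -> F,
  hasD (fun s : R => \sum_(i < r.+1) s ^+ i *: c i) 0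
    (\sum_(j < r.+1) lam j *: \sum_(i < r.+1) (j%:R ^+ i) *: c i).
Proof.
pose V : 'M[R]_r.+1 := \matrix_(i, j) (j%:R ^+ i).
have Vu : V \in unitmx.
  have -> : V = Vandermonde r.+1 (\row_j (j%:R : R)).
    by apply/matrixP => i j; rewrite !mxE.
  rewrite unitmxE det_Vandermonde unitfE; apply/prodf_neq0 => i _.
  apply/prodf_neq0 => j ij; rewrite !mxE subr_eq0 eqr_nat.
  by rewrite neq_ltn ij orbT.
(* These weights give [\sum_j x_j * j ^ i = (i == 1)]: they read the linear coefficient of a
   polynomial off its values at 0, ..., r. *)
pose x : 'cV[R]_r.+1 := invmx V *m \col_i ((i == 1%N :> nat)%:R).
have Vx : V *m x = \col_i ((i == 1%N :> nat)%:R) by rewrite mulKVmx.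
exists (fun j => x (inord j) 0) => c.
have -> : \sum_(j < r.+1) x (inord j) 0 *: \sum_(i < r.+1) j%:R ^+ i *: c i =
    \sum_(i < r.+1) (i == 1%N :> nat)%:R *: c i.
  under eq_bigr do rewrite scaler_sumr.
  rewrite exchange_big /=; apply: eq_bigr => i _.
  have /colP/(_ i) := Vx; rewrite !mxE => <-; rewrite scaler_suml.
  by apply: eq_bigr => j _; rewrite !mxE scalerA inord_val mulrC.
apply: hasD_sum => i.
case: (val i) => [|[|m]] /=.
- by rewrite scale0r; apply: hasD_ext (hasD_cst (c 0%N) 0) => s; rewrite expr0 scale1r.
- by rewrite scale1r; apply: hasD_ext (hasD_id_scale (c 1%N) 0) => s; rewrite expr1.
have H : hasD (fun s : R => s *: c m.+2) 0 (c m.+2) := hasD_id_scale _ _.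
elim: m (c _) H => [|m IH] w H.
  by have := hasD_scaleM H; rewrite scale0r; apply: hasD_ext => s; rewrite scalerA.
have := hasD_scaleM (IH w H); rewrite expr0n scale0r.
by apply: hasD_ext => s; rewrite scalerA -exprS.
Qed.

Variables (A : set E) (N : E -> R) (f : E -> F) (k : nat) (D : E -> seq E -> F).
Hypothesis A0 : A 0.
Hypothesis A_lin : forall (a : R) x y, A x -> A y -> A (a *: x + y).
Hypothesis N0 : N 0 = 0.
Hypothesis N_ge0 : forall x, A x -> 0 <= N x.
Hypothesis N_lin : forall (a : R) x y, A x -> A y -> N (a *: x + y) <= `|a| * N x + N y.
Hypothesis fD : iterated_derivative A N f k D.

Let AZ a x : A x -> A (a *: x).
Proof. by move=> Ax; rewrite -[_ *: _]addr0; exact: A_lin. Qed.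

Let ADZ x (s : R) y : A x -> A y -> A (x + s *: y).
Proof. by move=> Ax Ay; rewrite addrC; exact: A_lin. Qed.

Let NZ a x : A x -> N (a *: x) <= `|a| * N x.
Proof. by move=> Ax; have := N_lin a Ax A0; rewrite addr0 N0 addr0. Qed.

Definition allA v : Prop := forall x, x \in v -> A x.

Lemma allA_cons x v : A x -> allA v -> allA (x :: v).
Proof. by move=> Ax Av y; rewrite inE => /predU1P[->|/Av]. Qed.

Lemma allA_cat u v : allA u -> allA v -> allA (u ++ v).
Proof. by move=> Au Av y; rewrite mem_cat => /orP[/Au|/Av]. Qed.

Lemma allA_nseq i x : A x -> allA (nseq i x).
Proof. by move=> Ax y; rewrite mem_nseq => /andP[_ /eqP->]. Qed.

Lemma multilinear_at u pre v (a : R) x y : (size pre + (size v).+1 <= k)%N ->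
  A u -> allA pre -> allA v -> A x -> A y ->
  D u (pre ++ (a *: x + y) :: v) = a *: D u (pre ++ x :: v) + D u (pre ++ y :: v).
Proof.
move=> sz Au Ap Av Ax Ay; case: fD => _ /(_ _ sz u Au)[H _] _ _; apply: H => //.
split; first by rewrite size_cat.
by apply: allA_cat => //; exact: allA_cons.
Qed.

Lemma multilinear_scale u pre v (a : R) x : (size pre + (size v).+1 <= k)%N ->
  A u -> allA pre -> allA v -> A x ->
  D u (pre ++ (a *: x) :: v) = a *: D u (pre ++ x :: v).
Proof.
move=> sz Au Ap Av Ax.
have Z : D u (pre ++ 0 :: v) = 0.
  have := @multilinear_at u pre v (-1) 0 0 sz Au Ap Av A0 A0.
  by rewrite scaler0 addr0 scaleN1r addNr.
by rewrite -{1}[a *: x]addr0 multilinear_at// Z addr0.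
Qed.

Lemma multilinear_add u pre v x y (a : R) : (size pre + (size v).+1 <= k)%N ->
  A u -> allA pre -> allA v -> A x -> A y ->
  D u (pre ++ (x + a *: y) :: v) = D u (pre ++ x :: v) + a *: D u (pre ++ y :: v).
Proof. by move=> sz Au Ap Av Ax Ay; rewrite addrC multilinear_at// addrC. Qed.

Let prodN_ge0 v : allA v -> 0 <= \prod_(x <- v) N x.
Proof. by move=> Av; rewrite big_seq; apply: prodr_ge0 => x /Av; exact: N_ge0. Qed.

Lemma iterated_derivative_expansion u v e : A u -> allA v -> (size v < k)%N -> 0 < e ->
  exists2 d : R, 0 < d & forall h, A h -> N h < d ->
    `|D (u + h) v - D u v - D u (h :: v)| <= e * N h.
Proof.
move=> Au Av sz e0; have p0 := prodN_ge0 Av.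
have P0 : 0 < \prod_(x <- v) N x + 1 by rewrite ltr_wpDl.
have [_ _ H _] := fD.
have [d d0 Hd] := H _ sz u Au _ (divr_gt0 e0 P0).
exists d => // h Ah Nh; apply: (le_trans (Hd h Ah Nh v _)) => //.
rewrite mulrAC ler_wpM2r ?N_ge0// -mulrA ler_piMr ?(ltW e0)// mulrC.
by rewrite ler_pdivrMr// mul1r lerDl.
Qed.

(** Reduces the iterated derivatives to functions of one real variable, for which uniqueness of the
    derivative and increment bounds are available. *)
Lemma hasD_direction u h v : A u -> A h -> allA v -> (size v < k)%N ->
  hasD (fun s => D (u + s *: h) v) 0 (D u (h :: v)).
Proof.
move=> Au Ah Av sz e e0.
have n0 : 0 < N h + 1 by rewrite ltr_wpDl ?N_ge0.
have [d d0 Hd] := iterated_derivative_expansion Au Av sz (divr_gt0 e0 n0).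
exists (d / (N h + 1)) => [|s]; first by rewrite divr_gt0.
rewrite subr0 scale0r addr0 ltr_pdivlMr// => sd.
have B : N (s *: h) <= `|s| * N h by exact: NZ.
rewrite -(multilinear_scale (pre := [::]) s sz Au)//=.
apply: (le_trans (Hd _ (AZ _ Ah) _)).
  by apply: (le_lt_trans B); apply: le_lt_trans sd; rewrite ler_wpM2l// lerDl.
apply: (le_trans (ler_wpM2l _ B)); first by rewrite divr_ge0// ltW.
rewrite mulrCA [leRHS]mulrC ler_wpM2l// -mulrA ler_piMr ?(ltW e0)// mulrC.
by rewrite ler_pdivrMr// mul1r lerDl.
Qed.

Lemma hasD_direction_at u h v (t : R) : A u -> A h -> allA v -> (size v < k)%N ->
  hasD (fun s => D (u + s *: h) v) t (D (u + t *: h) (h :: v)).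
Proof.
move=> Au Ah Av sz.
have H := hasD_direction (ADZ t Au Ah) Ah Av sz.
have := @hasD_shift (fun s => D (u + t *: h + s *: h) v) t t (D (u + t *: h) (h :: v)).
rewrite subrr => /(_ H); apply: hasD_ext => s.
by rewrite -addrA -scalerDl (addrC t) subrK.
Qed.

(** The increment bound along [a] is applied to the increment in direction [b]. The derivative of
    [psi] is the difference of two first-order expansions at [u] of [D _ (a :: v)], hence of size
    [e * s]. *)
Let second_difference u a b v (e : R) : A u -> A a -> A b -> allA v -> ((size v).+1 < k)%N ->
  0 < e -> exists2 d : R, 0 < d & forall s, 0 < s < d ->
   `|(D (u + s *: b + s *: a) v - D (u + s *: a) v) - (D (u + s *: b) v - D u v)
     - (s * s) *: D u [:: b, a & v]| <= e * (s * s).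
Proof.
move=> Au Aa Ab Av sz e0.
have Aav : allA (a :: v) by exact: allA_cons.
(* [s * K] bounds [N (s *: b + t *: a) + N (t *: a)] for [0 <= t <= s]; the summand 1 makes [K]
   positive. *)
pose K := 2 * N a + N b + 1.
have K0 : 0 < K by rewrite /K; have := N_ge0 Aa; have := N_ge0 Ab; lra.
have [d d0 Hd] := iterated_derivative_expansion Au Aav sz (divr_gt0 e0 K0).
exists (d / K) => [|s /andP[s0]]; first by rewrite divr_gt0.
rewrite ltr_pdivlMr// => sd.
have Aub := ADZ s Au Ab.
pose psi t := D (u + s *: b + t *: a) v - D (u + t *: a) v - (t * s) *: D u [:: b, a & v].
pose psi' t := D (u + s *: b + t *: a) (a :: v) - D (u + t *: a) (a :: v) -
  s *: D u [:: b, a & v].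
have Dpsi t : hasD psi t (psi' t).
  apply: hasDB; first by apply: hasDB; apply: hasD_direction_at => //; exact: ltnW.
  apply: hasD_ext (hasD_id_scale (s *: D u [:: b, a & v]) t) => r.
  by rewrite scalerA.
have C : continuous psi by apply: hasD_continuous => t; eexists; exact: Dpsi.
have := @hasD_increment_bound R F psi psi' 0 s (e * s) (ltW s0) C.
rewrite /psi !scale0r mul0r !addr0 scale0r !subr0 -mulrA => H.
rewrite addrAC; apply: H => t /andP[t0 ts]; split; first exact: Dpsi.
have s0' := ltW s0.
have Nta : N (t *: a) <= s * N a.
  by apply: (le_trans (NZ _ Aa)); rewrite ger0_norm// ler_wpM2r ?N_ge0// ltW.
have Nsb : N (s *: b) <= s * N b by apply: (le_trans (NZ _ Ab)); rewrite ger0_norm.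
have Nsum : N (s *: b + t *: a) <= s * N b + s * N a.
  by apply: (le_trans (N_lin _ Ab (AZ t Aa))); rewrite ger0_norm// lerD2l.
have sNa : 0 <= s * N a by rewrite mulr_ge0// N_ge0.
have sNb : 0 <= s * N b by rewrite mulr_ge0// N_ge0.
have sK : s * K = 2 * (s * N a) + s * N b + s by rewrite /K; ring.
have B1 := Hd (s *: b + t *: a) (A_lin s Ab (AZ t Aa)) ltac:(lra).
have B2 := Hd (t *: a) (AZ t Aa) ltac:(lra).
have E1 : D u ((s *: b + t *: a) :: a :: v) = s *: D u [:: b, a & v] + D u [:: t *: a, a & v].
  by rewrite (multilinear_at (pre := [::]))//=; exact: AZ.
rewrite E1 addrA in B1.
set X := D u [:: b, a & v] in B1 *.
have -> : psi' t = (D (u + s *: b + t *: a) (a :: v) - D u (a :: v) - (s *: X + D u [:: t *: a,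
  a & v]))
    - (D (u + t *: a) (a :: v) - D u (a :: v) - D u [:: t *: a, a & v]).
  rewrite /psi' -/X; set p := D (u + _ + _) _; set q := D (u + _) _; set o := D u (a :: v).
  set y := D u _; rewrite !opprD !opprK !addrA [RHS](ACl (1*5*3*(2*6)*(4*7))%AC) /=.
  by rewrite !addNr !addr0.
apply: (le_trans (ler_normB _ _)); apply: (le_trans (lerD B1 B2)).
rewrite -mulrDr; apply: (@le_trans _ _ (e / K * (s * K))); last first.
  by rewrite mulrCA mulrVK ?unitfE ?lt0r_neq0// mulrC.
rewrite ler_wpM2l ?divr_ge0 ?(ltW e0) ?(ltW K0)//; lra.
Qed.

(** The second difference is symmetric in [a] and [b], which settles an empty prefix. A longer
    prefix follows by differentiating the shorter identity along its first element. *)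
Lemma derivative_swap u pre a b v : A u -> allA pre -> A a -> A b -> allA v ->
  (size pre + (size v).+2 <= k)%N ->
  D u (pre ++ [:: a, b & v]) = D u (pre ++ [:: b, a & v]).
Proof.
move=> Au Ap Aa Ab Av; elim: pre u Ap Au => [|x pre IH] u Ap Au sz /=; last first.
  have Ax : A x by apply: Ap; rewrite inE eqxx.
  have {}Ap : allA pre by move=> y yp; apply: Ap; rewrite inE yp orbT.
  have Aab : allA (pre ++ [:: a, b & v]) by do !apply: allA_cat => //; do !apply: allA_cons => //.
  have Aba : allA (pre ++ [:: b, a & v]) by do !apply: allA_cat => //; do !apply: allA_cons => //.
  have s1 : (size (pre ++ [:: a, b & v]) < k)%N by rewrite size_cat.
  have s2 : (size (pre ++ [:: b, a & v]) < k)%N by rewrite size_cat.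
  have H1 := hasD_direction Au Ax Aab s1; have H2 := hasD_direction Au Ax Aba s2.
  apply: hasD_unique H1 _; apply: hasD_ext H2 => s.
  by rewrite IH//; [exact: ADZ|exact: ltnW].
apply/eqP; rewrite -subr_eq0 -normr_le0; apply/ler_addgt0Pl => e e0; rewrite addr0.
have e2 : 0 < e / 2 by rewrite divr_gt0.
have [d1 d10 H1] := second_difference Au Aa Ab Av sz e2.
have [d2 d20 H2] := second_difference Au Ab Aa Av sz e2.
pose s := Num.min d1 d2 / 2.
have m0 : 0 < Num.min d1 d2 by rewrite lt_min d10.
have s0 : 0 < s by rewrite divr_gt0.
have sm : s < Num.min d1 d2 by rewrite /s; lra.
move: (sm); rewrite lt_min => /andP[sd1 sd2].
have {H1} := H1 s; rewrite s0 sd1 => /(_ isT) H1.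
have {H2} := H2 s; rewrite s0 sd2 => /(_ isT) H2.
have ss0 : 0 < s * s by rewrite mulr_gt0.
rewrite -(ler_pM2r ss0) -{1}(gtr0_norm ss0) mulrC -normrZ scalerBr.
set P := _ *: D u [:: a, b & v] in H2 *; set Q := _ *: D u _ in H1 *.
rewrite (addrAC u) in H1.
set p := D (u + s *: a + s *: b) v in H1 H2; set q := D (u + s *: a) v in H1 H2.
set r := D (u + s *: b) v in H1 H2; set o := D u v in H1 H2.
have -> : P - Q = (p - q - (r - o) - Q) - (p - r - (q - o) - P).
  rewrite !opprD !opprK !addrA [RHS](ACl (10*5*(1*6)*(2*8)*(3*7)*(4*9))%AC) /=.
  by rewrite !(subrr, addNr) !addr0.
apply: (le_trans (ler_normB _ _)); apply: (le_trans (lerD H1 H2)).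
by rewrite -mulrDl -splitr.
Qed.

(** Multilinearity expands one argument at a time, moving [w] or [b] to the prefix. Being polynomial
    in [s] makes [derivative_weights] applicable. *)
Lemma derivative_polynomial u pre (i : nat) w b : A u -> allA pre -> A w -> A b ->
  (size pre + i <= k)%N ->
  exists c : nat -> F, forall s : R,
    D u (pre ++ nseq i (w + s *: b)) = \sum_(j < i.+1) s ^+ j *: c j.
Proof.
move=> Au + Aw Ab; elim: i pre => [|i IH] pre Ap sz.
  exists (fun=> D u (pre ++ [::])) => s.
  by rewrite big_ord_recl big_ord0 addr0 expr0 scale1r.
have Apw : allA (rcons pre w) by rewrite -cats1; apply: allA_cat => //; exact: allA_cons.
have Apb : allA (rcons pre b) by rewrite -cats1; apply: allA_cat => //; exact: allA_cons.
have sz' x : (size (rcons pre x) + i <= k)%N by rewrite size_rcons addSnnS.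
have [c1 H1] := IH _ Apw (sz' w); have [c2 H2] := IH _ Apb (sz' b).
exists (fun j => (if (j < i.+1)%N then c1 j else 0) + (if j is j'.+1 then c2 j' else 0)) => s.
rewrite /= multilinear_add//; last 2 first.
- by rewrite size_nseq.
- by apply: allA_nseq; exact: ADZ.
rewrite -!cat_rcons H1 H2.
under [RHS]eq_bigr do rewrite scalerDr.
rewrite big_split; congr (_ + _).
  rewrite [RHS]big_ord_recr /= ltnn scaler0 addr0; apply: eq_bigr => j _.
  by rewrite (ltn_ord j).
rewrite [RHS]big_ord_recl /= scaler0 add0r scaler_sumr; apply: eq_bigr => j _.
by rewrite scalerA -exprS.
Qed.

(** The product rule yields one term for each position of [b]; symmetry moves them all to the front,
    whence the factor [i]. *)
Lemma hasD_diagonal u pre (i : nat) w b : A u -> allA pre -> A w -> A b ->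
  (size pre + i <= k)%N ->
  hasD (fun s => D u (pre ++ nseq i (w + s *: b))) 0
    (i%:R *: D u (pre ++ b :: nseq i.-1 w)).
Proof.
move=> Au + Aw Ab; elim: i pre => [|i IH] pre Ap sz.
  by rewrite scale0r; apply: hasD_ext (hasD_cst (D u (pre ++ [::])) 0).
have Apw : allA (rcons pre w) by rewrite -cats1; apply: allA_cat => //; exact: allA_cons.
have Apb : allA (rcons pre b) by rewrite -cats1; apply: allA_cat => //; exact: allA_cons.
have sz' x : (size (rcons pre x) + i <= k)%N by rewrite size_rcons addSnnS.
have := hasDD (IH _ Apw (sz' w)) (hasD_scaleM (IH _ Apb (sz' b))).
have -> : i%:R *: D u (rcons pre w ++ b :: nseq i.-1 w) = i%:R *: D u (pre ++ b :: nseq i w).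
  case: i sz {IH sz'} => [|i] sz; first by rewrite !scale0r.
  rewrite cat_rcons derivative_swap//=; first exact: allA_nseq.
  by rewrite size_nseq.
rewrite scale0r addr0 cat_rcons -[X in _ + X]scale1r -scalerDl natr1.
apply: hasD_ext => s; rewrite !cat_rcons /= multilinear_add//; first by rewrite size_nseq.
by apply: allA_nseq; exact: ADZ.
Qed.

(** Base point and arguments move together. The expansion in the base point is therefore used in
    operator norm, uniformly over the moving arguments, and the change of the arguments is then
    treated by [hasD_diagonal]. *)
Lemma hasD_segment0 u a w b (r : nat) : A u -> A a -> A w -> A b -> (r < k)%N ->
  hasD (fun s => D (u + s *: a) (nseq r (w + s *: b))) 0
    (D u (a :: nseq r w) + r%:R *: D u (b :: nseq r.-1 w)).
Proof.
move=> Au Aa Aw Ab rk.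
have H2 : hasD (fun s => s *: D u (a :: nseq r (w + s *: b))) 0 (D u (a :: nseq r w)).
  have Aa1 : allA [:: a] by exact: allA_cons.
  have := hasD_scaleM (@hasD_diagonal u [:: a] r w b Au Aa1 Aw Ab rk).
  by rewrite scale0r addr0.
have H3 := @hasD_diagonal u [::] r w b Au (fun x => ltac:(by [])) Aw Ab (ltnW rk).
have := hasDD H2 H3; rewrite /= => {}H2.
(* Bounds the product of the norms of the arguments as long as [|s| <= 1]. *)
pose K := (N w + N b) ^+ r + 1.
have NwNb : 0 <= N w + N b by rewrite addr_ge0 ?N_ge0.
have K0 : 0 < K by rewrite /K ltr_wpDl ?exprn_ge0.
have n0 : 0 < N a + 1 by rewrite ltr_wpDl ?N_ge0.
move=> e e0; have e2 : 0 < e / 2 by rewrite divr_gt0.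
have [d d0 Hd] := H2 _ e2.
have [_ _ H _] := fD.
have [d' d'0 Hd'] := H _ rk u Au _ (divr_gt0 e2 (mulr_gt0 K0 n0)).
exists (Num.min (Num.min d 1) (d' / (N a + 1))) => [|s].
  by rewrite !lt_min d0 ltr01 divr_gt0.
rewrite !lt_min subr0 => /andP[/andP[sd s1]]; rewrite ltr_pdivlMr// => sd'.
have := Hd s; rewrite subr0 !scale0r !addr0 add0r => /(_ sd) B1.
have AW : allA (nseq r (w + s *: b)) by apply: allA_nseq; exact: ADZ.
have NA : N (s *: a) <= `|s| * N a by exact: NZ.
have NB : N (s *: a) < d'.
  by apply: (le_lt_trans NA); apply: le_lt_trans sd'; rewrite ler_wpM2l// lerDl.
have := Hd' _ (AZ s Aa) NB (nseq r (w + s *: b)) (conj (size_nseq _ _) AW).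
have -> : D u ((s *: a) :: nseq r (w + s *: b)) = s *: D u (a :: nseq r (w + s *: b)).
  by rewrite (multilinear_scale (pre := [::]))//= size_nseq.
have PN : \prod_(x <- nseq r (w + s *: b)) N x <= K.
  rewrite big_nseq -/(N _ ^+ r) iter_mulr mulr1 /K.
  have : N (w + s *: b) <= N w + N b.
    rewrite addrC; apply: (le_trans (N_lin _ Ab Aw)); rewrite addrC lerD2l.
    by rewrite ler_piMl ?N_ge0// ltW.
  move=> /(lerXn2r r); rewrite !nnegrE => /(_ (N_ge0 (ADZ _ Aw Ab)) NwNb).
  by move=> h; apply: (le_trans h); rewrite lerDl.
move=> B2.
have {}B2 := le_trans B2 (ler_wpM2l (mulr_ge0 (divr_ge0 (ltW e2) (ltW (mulr_gt0 K0 n0))) (N_ge0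
  (AZ s Aa))) PN).
set X := N (s *: a) in NA B2.
have E1 : e / 2 / (K * (N a + 1)) * X * K = e / 2 * (X / (N a + 1)).
  by field; rewrite !lt0r_neq0.
rewrite E1 in B2.
have {E1} B3 : X / (N a + 1) <= `|s|.
  by rewrite ler_pdivrMr//; apply: (le_trans NA); rewrite ler_wpM2l// lerDl.
have {}B2 := le_trans B2 (ler_wpM2l (ltW e2) B3).
set V := D u _ + _ *: _ in B1 *; set W := nseq r (w + _ *: _) in B1 B2 *.
have -> : D (u + s *: a) W - D u (nseq r w) - s *: V =
  (D (u + s *: a) W - D u W - s *: D u (a :: W)) +
  (s *: D u (a :: W) + D u W - D u (nseq r w) - s *: V).
  rewrite !addrA [RHS](ACl (1*6*7*(2*5)*(3*4))%AC) /=.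
  by rewrite !addNr !addr0.
by apply: (le_trans (ler_normD _ _)); lra.
Qed.

Lemma hasD_segment u a w b (r : nat) (t : R) :
  A u -> A a -> A w -> A b -> (r < k)%N ->
  hasD (fun s => D (u + s *: a) (nseq r (w + s *: b))) t
    (D (u + t *: a) (a :: nseq r (w + t *: b)) +
     r%:R *: D (u + t *: a) (b :: nseq r.-1 (w + t *: b))).
Proof.
move=> Au Aa Aw Ab rk.
have H := hasD_segment0 (ADZ t Au Aa) Aa (ADZ t Aw Ab) Ab rk.
set V := D _ (a :: _) + _ in H *.
have := @hasD_shift (fun s => D (u + t *: a + s *: a) (nseq r (w + t *: b + s *: b))) t t V.
rewrite subrr => /(_ H); apply: hasD_ext => s.
by rewrite -!addrA -!scalerDl (addrC t) subrK.
Qed.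

End IteratedDerivatives.

Section IteratedDerivativesUnique.
Context (R : realType) (E : lmodType R) (F : normedModType R).
Variables (A1 A2 : set E) (N1 N2 : E -> R) (f : E -> F) (k : nat) (D1 D2 : E -> seq E -> F).
Hypothesis A20 : A2 0.
Hypothesis A2_lin : forall (a : R) x y, A2 x -> A2 y -> A2 (a *: x + y).
Hypothesis N20 : N2 0 = 0.
Hypothesis N2_ge0 : forall x, A2 x -> 0 <= N2 x.
Hypothesis N2_lin : forall (a : R) x y, A2 x -> A2 y -> N2 (a *: x + y) <= `|a| * N2 x + N2 y.
Hypothesis A10 : A1 0.
Hypothesis A1_lin : forall (a : R) x y, A1 x -> A1 y -> A1 (a *: x + y).
Hypothesis N10 : N1 0 = 0.
Hypothesis N1_ge0 : forall x, A1 x -> 0 <= N1 x.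
Hypothesis N1_lin : forall (a : R) x y, A1 x -> A1 y -> N1 (a *: x + y) <= `|a| * N1 x + N1 y.
Hypothesis A21 : A2 `<=` A1.
Hypothesis fD1 : iterated_derivative A1 N1 f k D1.
Hypothesis fD2 : iterated_derivative A2 N2 f k D2.

(** Both families arise from the same [f] by directional derivatives, whatever the norms. Thus the
    derivatives taken in C^(r+1) and in C^r agree on C^(r+1). *)
Lemma iterated_derivative_unique u v : A2 u -> allA A2 v -> (size v <= k)%N ->
  D1 u v = D2 u v.
Proof.
elim: v u => [|x v IH] u Au Av sz.
  by case: fD1 => -> //; [case: fD2 => ->|exact: A21].
have Ax : A2 x by apply: Av; rewrite inE eqxx.
have {}Av : allA A2 v by move=> y yv; apply: Av; rewrite inE yv orbT.
have Av1 : allA A1 v by move=> y /Av /A21.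
have H1 := hasD_direction A10 A1_lin N10 N1_ge0 N1_lin fD1 (A21 Au) (A21 Ax) Av1 sz.
have H2 := hasD_direction A20 A2_lin N20 N2_ge0 N2_lin fD2 Au Ax Av sz.
apply: hasD_unique H1 _; apply: hasD_ext H2 => s.
by rewrite IH//; [rewrite addrC; exact: A2_lin|exact: ltnW].
Qed.

End IteratedDerivativesUnique.

Lemma iterated_derivativeW (R : realType) (E : lmodType R) (F : normedModType R)
  (A A' : set E) (N : E -> R) (f : E -> F) (k : nat) D : A' `<=` A ->
  iterated_derivative A N f k D -> iterated_derivative A' N f k D.
Proof.
move=> AA [H1 H2 H3 H4]; split.
- by move=> u /AA; exact: H1.
- move=> j jk u Au; have [M1 [C M2]] := H2 j jk u (AA _ Au); split.
    move=> s1 s2 a x y [sz Hv] Ay; apply: M1; last exact: AA.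
    by split=> // z /Hv /AA.
  by exists C => v [sz Hv]; apply: M2; split=> // z /Hv /AA.
- move=> j jk u Au e e0; have [d d0 Hd] := H3 j jk u (AA _ Au) e e0.
  exists d => // h Ah Nh v [sz Hv]; apply: Hd => //; first exact: AA.
  by split=> // z /Hv /AA.
- move=> j jk u Au e e0; have [d d0 Hd] := H4 j jk u (AA _ Au) e e0.
  exists d => // h Ah Nh v [sz Hv]; apply: Hd => //; first exact: AA.
  by split=> // z /Hv /AA.
Qed.

Lemma iterated_derivative_le (R : realType) (E : lmodType R) (F : normedModType R)
  (A : set E) (N : E -> R) (f : E -> F) (k k' : nat) D : (k' <= k)%N ->
  iterated_derivative A N f k D -> iterated_derivative A N f k' D.
Proof.
move=> kk [H1 H2 H3 H4]; split=> // j jk; [apply: H2|apply: H3|apply: H4];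
  exact: leq_trans kk.
Qed.

(** * Regularity along smooth curves *)

Section Tends.
Context (R : realType) (P : Type) (Q : R -> P -> Prop).
Hypothesis Q_mono : forall d d' p, d <= d' -> Q d p -> Q d' p.

Let Ql d1 d2 p : Q (Num.min d1 d2) p -> Q d1 p.
Proof. by apply: Q_mono; rewrite ge_min lexx. Qed.

Let Qr d1 d2 p : Q (Num.min d1 d2) p -> Q d2 p.
Proof. by apply: Q_mono; rewrite ge_min lexx orbT. Qed.

(** Convergence along the filter base of the sets [Q d]. The type [P] is left free because the
    parameters are in turn times, smoothing widths, pairs of triples and points of segments. *)
Definition tends (F : normedModType R) (g : P -> F) (c : F) : Prop :=
  forall e : R, 0 < e -> exists2 d : R, 0 < d & forall p, Q d p -> `|g p - c| <= e.

Lemma tendsD (F : normedModType R) (g1 g2 : P -> F) c1 c2 :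
  tends g1 c1 -> tends g2 c2 -> tends (fun p => g1 p + g2 p) (c1 + c2).
Proof.
move=> H1 H2 e e0; have e2 : 0 < e / 2 by rewrite divr_gt0.
have [d1 d10 D1] := H1 _ e2; have [d2 d20 D2] := H2 _ e2.
exists (Num.min d1 d2) => [|p Qp]; first by rewrite lt_min d10.
have B1 := D1 p (Ql Qp); have B2 := D2 p (Qr Qp).
by rewrite opprD addrACA; apply: (le_trans (ler_normD _ _)); lra.
Qed.

Lemma tendsZ (F : normedModType R) (g : P -> F) c (a : R) :
  tends g c -> tends (fun p => a *: g p) (a *: c).
Proof.
move=> H e e0; have k0 : 0 < `|a| + 1 by rewrite ltr_wpDl.
have [d d0 D] := H _ (divr_gt0 e0 k0); exists d => // p /D B.
rewrite -scalerBr normrZ; apply: (le_trans (ler_wpM2l (normr_ge0 a) B)).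
by rewrite mulrCA ler_piMr ?(ltW e0)// ler_pdivrMr// mul1r lerDl.
Qed.

Lemma tendsB (F : normedModType R) (g1 g2 : P -> F) c1 c2 :
  tends g1 c1 -> tends g2 c2 -> tends (fun p => g1 p - g2 p) (c1 - c2).
Proof.
move=> H1 H2 e e0; have [d d0 H] := tendsD H1 (tendsZ (-1) H2) e0.
by exists d => // p /H; rewrite !scaleN1r.
Qed.

Lemma tends_sum (F : normedModType R) (I : Type) (r : seq I) (g : I -> P -> F) c :
  (forall i, tends (g i) (c i)) ->
  tends (fun p => \sum_(i <- r) g i p) (\sum_(i <- r) c i).
Proof.
move=> H; elim: r => [|i r IH].
  by move=> e e0; exists 1 => // p _; rewrite !big_nil subrr normr0 ltW.
rewrite big_cons => e e0; have [d d0 D] := tendsD (H i) IH e0.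
by exists d => // p /D; rewrite big_cons.
Qed.

Context (tau : R) (n np : nat).
Hypothesis tau_gt0 : 0 < tau.
Local Notation hist := (hist R n np).
Local Notation SH := (@smooth_hist R n np).
Local Notation N := (@hist_norm R tau n np).

(** Eventual smoothness is part of the notion, because the norm is controlled on smooth histories
    only. *)
Definition tendsH l (w : P -> hist) (w0 : hist) : Prop :=
  [/\ SH l w0, exists2 d : R, 0 < d & forall p, Q d p -> SH l (w p) &
  forall e : R, 0 < e -> exists2 d : R, 0 < d &
    forall p, Q d p -> N l (w p - w0) <= e].

Lemma smooth_histB l x y : SH l x -> SH l y -> SH l (x - y).
Proof. by move=> xs ys; rewrite addrC -scaleN1r; exact: smooth_hist_linear. Qed.

Lemma smooth_histD l x y : SH l x -> SH l y -> SH l (x + y).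
Proof. by move=> xs ys; rewrite -[x]scale1r; exact: smooth_hist_linear. Qed.

Lemma smooth_histZ l (a : R) x : SH l x -> SH l (a *: x).
Proof.
by move=> xs; rewrite -[_ *: _]addr0; apply: smooth_hist_linear xs _; exact: smooth_hist0.
Qed.

Lemma hist_norm0 l : N l 0 = 0.
Proof.
apply/eqP; rewrite eq_le (hist_norm_ge0 tau_gt0 (@smooth_hist0 R n np l)) andbT.
apply/(hist_normP tau_gt0 _ (@smooth_hist0 R n np l)); split; last by rewrite normr0.
move=> j t jl _.
have s0 := @smooth_cst R n l 0.
have := (smooth_linear (-1) s0 s0).2 j jl.
rewrite scaler0 addr0 => /(congr1 (fun g => g t)) /=.
rewrite [X in _ = X](_ : _ = 0); first by move=> ->; rewrite normr0.
by rewrite /GRing.scale /GRing.add /= scaleN1r addNr.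
Qed.

Lemma hist_normD l x y : SH l x -> SH l y -> N l (x + y) <= N l x + N l y.
Proof.
by move=> xs ys; have := hist_norm_linear tau_gt0 1 xs ys; rewrite scale1r normr1 mul1r.
Qed.

Lemma hist_normZ l (a : R) x : SH l x -> N l (a *: x) <= `|a| * N l x.
Proof.
move=> xs; have := hist_norm_linear tau_gt0 a xs (@smooth_hist0 R n np l).
by rewrite addr0 hist_norm0 addr0.
Qed.

Lemma tendsH_D l x y x0 y0 : tendsH l x x0 -> tendsH l y y0 ->
  tendsH l (fun p => x p + y p) (x0 + y0).
Proof.
move=> [xs [d1 d10 D1] Hx] [ys [d2 d20 D2] Hy].
have S p : Q (Num.min d1 d2) p -> SH l (x p) /\ SH l (y p).
  by move=> Qp; split; [exact: D1 (Ql Qp)|exact: D2 (Qr Qp)].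
split; first exact: smooth_histD.
  exists (Num.min d1 d2) => [|p /S[? ?]]; first by rewrite lt_min d10.
  exact: smooth_histD.
move=> e e0; have e2 : 0 < e / 2 by rewrite divr_gt0.
have [d3 d30 D3] := Hx _ e2; have [d4 d40 D4] := Hy _ e2.
exists (Num.min (Num.min d1 d2) (Num.min d3 d4)) => [|p Qp].
  by rewrite !lt_min d10 d20 d30 d40.
have [xp yp] := S p (Ql Qp).
have B1 := D3 p (Ql (Qr Qp)); have B2 := D4 p (Qr (Qr Qp)).
rewrite opprD addrACA; apply: (le_trans (hist_normD _ _)); try exact: smooth_histB.
lra.
Qed.

Lemma tendsH_null l (a : P -> R) x (C : R) : 
  (exists2 d : R, 0 < d & forall p, Q d p -> `|a p| <= C) ->
  tendsH l x 0 -> tendsH l (fun p => a p *: x p) 0.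
Proof.
move=> [d0 d00 D0] [xs [d1 d10 D1] Hx]; split; first exact: xs.
  by exists d1; [exact: d10|move=> p /D1; exact: smooth_histZ].
move=> e e0; have k0 : 0 < `|C| + 1 by rewrite ltr_wpDl.
have [d2 d20 D2] := Hx _ (divr_gt0 e0 k0).
exists (Num.min d0 (Num.min d1 d2)) => [|p Qp]; first by rewrite !lt_min d00 d10.
have A := D0 p (Ql Qp); have xp := D1 p (Ql (Qr Qp)); have B := D2 p (Qr (Qr Qp)).
rewrite subr0 in B; rewrite subr0.
apply: (le_trans (hist_normZ _ xp)).
apply: (@le_trans _ _ ((`|C| + 1) * (e / (`|C| + 1)))).
  apply: ler_pM => //; first exact: hist_norm_ge0.
  by apply: (le_trans A); apply: (le_trans (ler_norm _)); rewrite lerDl.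
by rewrite mulrCA divff ?mulr1// lt0r_neq0.
Qed.

Lemma tendsH_Z l (a : R) x x0 : tendsH l x x0 -> tendsH l (fun p => a *: x p) (a *: x0).
Proof.
move=> [xs [d1 d10 D1] Hx]; split; first exact: smooth_histZ.
  by exists d1; [exact: d10|move=> p /D1; exact: smooth_histZ].
move=> e e0; have k0 : 0 < `|a| + 1 by rewrite ltr_wpDl.
have [d2 d20 D2] := Hx _ (divr_gt0 e0 k0).
exists (Num.min d1 d2) => [|p Qp]; first by rewrite !lt_min d10.
have xp := D1 p (Ql Qp); have B := D2 p (Qr Qp).
rewrite -scalerBr; apply: (le_trans (hist_normZ _ _)); first exact: smooth_histB.
apply: (le_trans (ler_wpM2l (normr_ge0 a) B)).
by rewrite mulrCA ler_piMr ?(ltW e0)// ler_pdivrMr// mul1r lerDl.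
Qed.

Lemma tendsH_cst l x0 : SH l x0 -> tendsH l (fun=> x0) x0.
Proof.
move=> xs; split=> //; first by exists 1.
by move=> e e0; exists 1 => // p _; rewrite subrr hist_norm0 ltW.
Qed.

Lemma tendsH_W l l' x x0 : (l' <= l)%N -> tendsH l x x0 -> tendsH l' x x0.
Proof.
move=> ll [xs [d1 d10 D1] Hx]; split; first exact: smooth_histW xs.
  by exists d1; [exact: d10|move=> p /D1; exact: smooth_histW].
move=> e e0; have [d2 d20 D2] := Hx _ e0.
exists (Num.min d1 d2) => [|p Qp]; first by rewrite !lt_min d10.
have xp := D1 p (Ql Qp).
apply: le_trans (D2 p (Qr Qp)).
by apply: (hist_normW tau_gt0 ll); exact: smooth_histB.
Qed.

End Tends.

(** * Shifted and averaged histories *)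

Section Shifts.
Context (R : realType) (tau : R) (n np : nat).
Hypothesis tau_gt0 : 0 < tau.
Local Notation hist := (hist R n np).
Local Notation SH := (@smooth_hist R n np).
Local Notation N := (@hist_norm R tau n np).
Implicit Types (z w : hist) (v : R -> 'rV[R]_n).

Definition shiftH (t : R) w : hist := (fun s => w.1 (t + s), w.2).
(** The time derivative of [t |-> shiftH t w]; the parameters are constant in time, hence the
    component 0. *)
Definition deriveH w : hist := (derive1 w.1, 0).
Definition steklovH (e : R) w : hist := (steklov e w.1, w.2).

Lemma shiftH_smooth l t w : SH l w -> SH l (shiftH t w) /\
  forall j, (j <= l)%N -> derive1n j (shiftH t w).1 = fun s => derive1n j w.1 (t + s).
Proof.
move=> ws; have [A B] := smooth_affine t 1 ws.
have E : (fun s => w.1 (t + 1 * s)) = (shiftH t w).1.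
  by apply/funext => s; rewrite mul1r.
split=> [|j jl]; first by rewrite E in A.
rewrite -E B//.
by apply/funext => s; rewrite expr1n scale1r mul1r.
Qed.

Lemma deriveH_smooth l w : SH l.+1 w -> SH l (deriveH w).
Proof. exact: smooth_derive1. Qed.

Lemma steklovH_smooth l e w : SH l w -> SH l.+1 (steklovH e w).
Proof. by move=> ws; exact: (steklov_smooth e ws).1. Qed.

Lemma smooth_histB_derive l w z : SH l w -> SH l z ->
  forall j, (j <= l)%N -> derive1n j (w - z).1 = fun s => derive1n j w.1 s - derive1n j z.1 s.
Proof.
move=> ws zs j jl.
have -> : (w - z).1 = (-1) *: z.1 + w.1 by rewrite scaleN1r addrC.
by rewrite (smooth_linear (-1) zs ws).2// scaleN1r addrC.
Qed.

Lemma common_modulus l (S : nat -> R -> Prop) :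
  (forall j d d', d <= d' -> S j d' -> S j d) ->
  (forall j, (j <= l)%N -> exists2 d : R, 0 < d & S j d) ->
  exists2 d : R, 0 < d & forall j, (j <= l)%N -> S j d.
Proof.
move=> mono; elim: l => [|l IH] H.
  by have [d d0 Sd] := H 0%N isT; exists d => // j; rewrite leqn0 => /eqP->.
have [d d0 D] := IH (fun j jl => H j (leqW jl)).
have [d' d'0 D'] := H l.+1 (leqnn _).
exists (Num.min d d') => [|j]; first by rewrite lt_min d0.
rewrite leq_eqVlt => /predU1P[->|jl].
  by apply: mono D'; rewrite ge_min lexx orbT.
by apply: mono (D j jl); rewrite ge_min lexx.
Qed.

Lemma derivatives_uniform l w (t e : R) : SH l w -> 0 < e ->
  exists2 d : R, 0 < d & forall j, (j <= l)%N -> forall r s, - tau <= s <= 0 ->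
    `|r - (t + s)| < d -> `|derive1n j w.1 r - derive1n j w.1 (t + s)| < e.
Proof.
move=> ws e0.
apply: (@common_modulus l (fun j d => forall r s, - tau <= s <= 0 ->
    `|r - (t + s)| < d -> `|derive1n j w.1 r - derive1n j w.1 (t + s)| < e)).
  by move=> j d d' dd H r s sI rd; apply: H => //; exact: lt_le_trans dd.
move=> j jl.
have [d d0 D] := @continuous_uniform R _ _ (t - tau) t e (smooth_continuous ws jl) e0.
exists d => // r s /andP[s1 s2] rd; apply: D => //.
by apply/andP; split; lra.
Qed.

Lemma shiftH_tends l z t : SH l z ->
  tendsH (fun d x => `|x - t| < d) tau l (fun x => shiftH x z) (shiftH t z).
Proof.
move=> zs; have St x := shiftH_smooth x zs.
split; [exact: (St t).1|exists 1; [exact: ltr01|move=> x _; exact: (St x).1]|].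
move=> e e0; have [d d0 D] := derivatives_uniform t zs e0.
exists d => // x xd; have Sx := smooth_histB (St x).1 (St t).1.
apply/(hist_normP tau_gt0 _ Sx); split; last by rewrite /= subrr normr0 ltW.
move=> j s jl sI; rewrite (smooth_histB_derive (St x).1 (St t).1)//.
rewrite (St x).2// (St t).2//; apply/ltW/D => //.
by rewrite opprD addrACA subrr addr0.
Qed.

Definition stekQ (t : R) (d : R) (p : R * R) : Prop :=
  `|p.1 - t| < d /\ 0 < p.2 < d.

Lemma steklov_shiftH_tends l z t : SH l z ->
  tendsH (stekQ t) tau l (fun p => shiftH p.1 (steklovH p.2 z)) (shiftH t z).
Proof.
move=> zs; have St x := shiftH_smooth x zs.
have Se e : SH l (steklovH e z) by apply: (@smooth_histW _ _ _ l.+1) => //; exact: steklovH_smooth.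
have Ste x e := shiftH_smooth x (Se e).
split; [exact: (St t).1|exists 1; [exact: ltr01|move=> x _; exact: (Ste _ _).1]|].
move=> e e0; have [d d0 D] := derivatives_uniform t zs e0.
exists (d / 2) => [|[x h] [/= xd /andP[h0 hd]]]; first by rewrite divr_gt0.
have Sx := smooth_histB (Ste x h).1 (St t).1.
apply/(hist_normP tau_gt0 _ Sx); split; last by rewrite /= subrr normr0 ltW.
move=> j s jl sI; rewrite (smooth_histB_derive (Ste x h).1 (St t).1)//.
rewrite (Ste x h).2// (St t).2//= (steklov_smooth h zs).2//.
apply: steklov_near => //; first exact: smooth_continuous zs jl.
move=> r /andP[r1 r2]; apply/ltW/D => //.
have -> : r - (t + s) = (x - t) + (r - (x + s)) by ring.
apply: (le_lt_trans (ler_normD _ _)).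
have : `|r - (x + s)| < d / 2 by rewrite ger0_norm ?subr_ge0//; lra.
lra.
Qed.

Lemma hasD_increment_bound_abs (F : normedModType R) (f f' : R -> F) (t h K : R) :
  (forall s, `|s - t| <= `|h| -> `|f' s| <= K) -> (forall s, hasD f s (f' s)) ->
  `|f (t + h) - f t| <= K * `|h|.
Proof.
move=> H D.
have fc : continuous f by apply: hasD_continuous => s; exists (f' s).
have [h0|h0] := leP 0 h.
  have th : t <= t + h by rewrite lerDl.
  have := @hasD_increment_bound R F f f' t (t + h) K th fc.
  rewrite (_ : t + h - t = h) 1?(ger0_norm h0); last by ring.
  apply => x /andP[x1 x2]; split=> //; apply: H.
  by rewrite !ger0_norm ?subr_ge0//; lra.
have th : t + h <= t by rewrite -lerBrDl subrr ltW.
have := @hasD_increment_bound R F f f' (t + h) t K th fc.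
rewrite (_ : t - (t + h) = - h); last by ring.
rewrite distrC ltr0_norm//.
apply => x /andP[x1 x2]; split=> //; apply: H.
by rewrite ler0_norm ?subr_le0 ?(ltW x2)// ltr0_norm//; lra.
Qed.

Lemma difference_quotient_near (F : normedModType R) (f f' : R -> F) (t h e : R) c :
  h != 0 -> (forall s, hasD f s (f' s)) ->
  (forall s, `|s - t| <= `|h| -> `|f' s - c| <= e) ->
  `|h^-1 *: (f (t + h) - f t) - c| <= e.
Proof.
move=> h0 D H.
have := @hasD_increment_bound_abs F (fun s => f s - s *: c) (fun s => f' s - c) t h e H.
move=> /(_ (fun s => hasDB (D s) (hasD_id_scale c s))) B.
have -> : h^-1 *: (f (t + h) - f t) - c = h^-1 *: (f (t + h) - (t + h) *: c - (f t - t *: c)).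
  rewrite -[X in _ - X = _]scale1r -(mulVf h0) -scalerA -scalerBr; congr (_ *: _).
  rewrite scalerDl !opprD !opprK !addrA [RHS](ACl (1*4*3*(2*5))%AC) /=.
  by rewrite addNr addr0.
by rewrite normrZ normfV mulrC ler_pdivrMr ?normr_gt0.
Qed.

(** The entries of [p] are the time increment, the smoothing width and a position between 0 and the
    increment. Increment and width tend to 0 independently of each other. *)
Definition quotQ (d : R) (p : R * R * R) : Prop :=
  [/\ p.1.1 != 0, `|p.1.1| < d, 0 < p.1.2 < d & `|p.2| <= `|p.1.1|].

(** Each derivative of the smoothed curve is differentiable, and its derivative is a mean of the
    corresponding derivative of [z]; the mean value inequality then puts the quotient close to the
    derivative of [z], uniformly over the window. *)
Lemma steklov_quotient_tends l z t : SH l.+1 z ->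
  tendsH quotQ tau l (fun p => p.1.1^-1 *:
     (shiftH (t + p.1.1) (steklovH p.1.2 z) - shiftH t (steklovH p.1.2 z)))
   (shiftH t (deriveH z)).
Proof.
move=> zs; have ds := deriveH_smooth zs.
have Sd := shiftH_smooth t ds.
have Se e : SH l (steklovH e z).
  by apply: (@smooth_histW _ _ _ l.+2); [exact: leqW|exact: steklovH_smooth].
have Ste x e := shiftH_smooth x (Se e).
have Sq (h e : R) : SH l (h^-1 *: (shiftH (t + h) (steklovH e z) - shiftH t (steklovH e z))).
  by apply: smooth_histZ; apply: smooth_histB; exact: (Ste _ _).1.
split; [exact: Sd.1|exists 1; [exact: ltr01|move=> x _; exact: Sq]|].
move=> e e0; have [d d0 D] := derivatives_uniform t ds e0.
exists (d / 2) => [|[[h k] s'] [/= h0 hd /andP[k0 kd] _]]; first by rewrite divr_gt0.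
apply/(hist_normP tau_gt0 _ (smooth_histB (Sq _ _) Sd.1)); split; last first.
  by rewrite /= subrr scaler0 subrr normr0 ltW.
move=> j s jl sI; rewrite (smooth_histB_derive (Sq _ _) Sd.1)//.
have Sh := smooth_histB (Ste (t + h) k).1 (Ste t k).1.
have -> : (h^-1 *: (shiftH (t + h) (steklovH k z) - shiftH t (steklovH k z))).1 =
  h^-1 *: (shiftH (t + h) (steklovH k z) - shiftH t (steklovH k z)).1 + (fun=> 0).
  by apply/funext => r; rewrite /GRing.add /= addr0.
rewrite (smooth_linear h^-1 Sh (@smooth_cst _ _ l 0)).2//.
have -> : derive1n j (fun=> 0 : 'rV[R]_n) = (fun=> 0).
  have s0 := @smooth_cst R n l 0.
  have := (smooth_linear (-1) s0 s0).2 j jl.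
  have -> : (-1) *: (fun=> 0) + (fun=> 0) = (fun=> 0) :> (R -> 'rV[R]_n).
    by apply/funext => r; rewrite /GRing.scale /GRing.add /= scaleN1r addNr.
  by move=> ->; apply/funext => r; rewrite /GRing.scale /GRing.add /= scaleN1r addNr.
rewrite (smooth_histB_derive (Ste (t + h) k).1 (Ste t k).1)//.
rewrite (Ste (t + h) k).2// (Ste t k).2// Sd.2//=.
rewrite [X in `|X - _|](_ : _ = h^-1 *: (derive1n j (steklov k z.1) (t + s + h) -
   derive1n j (steklov k z.1) (t + s))); last first.
  rewrite (addrAC t s); exact: addr0.
have [jl1 jl2] : (j <= l.+1)%N /\ (j.+1 <= l.+1)%N by rewrite leqW.
rewrite (steklov_smooth k zs).2//.
apply: (difference_quotient_near (f' := steklov k (derive1n j.+1 z.1))) => //.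
  move=> r; apply: steklov_derive; first exact: smooth_continuous zs _.
  by move=> r'; exact: smooth_hasD zs _.
move=> r rh; apply: steklov_near => //; first exact: smooth_continuous zs _.
move=> x /andP[x1 x2]; rewrite derive1Sn; apply/ltW/D => //.
have -> : x - (t + s) = (r - (t + s)) + (x - r) by ring.
apply: (le_lt_trans (ler_normD _ _)).
have : `|x - r| < d / 2 by rewrite ger0_norm ?subr_ge0//; lra.
lra.
Qed.

End Shifts.

Arguments quotQ {R} d p.
Arguments stekQ {R} t d p.

(** * Differentiation along curves of histories *)

Section Regularity.
Context (R : realType) (tau : R) (n np nG lmax : nat).
Hypothesis tau_gt0 : 0 < tau.
Local Notation hist := (hist R n np).
Local Notation SH := (@smooth_hist R n np).
Local Notation N := (@hist_norm R tau n np).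
Variable G : hist -> 'rV[R]_nG.

(** [D r] are the derivatives on C^r, and [X r] is the extension of [D^r G(u)(d, ..., d)] to C^r x
    C^(r-1). Order 0 is included, with [X 0] being [G] of the first component in the family
    constructed below, so that inductions on [r] can start there. *)
Definition mild_family (D : nat -> hist -> seq hist -> 'rV[R]_nG)
    (X : nat -> hist * hist -> 'rV[R]_nG) : Prop :=
  forall r, (r <= lmax)%N ->
  [/\ iterated_derivative (SH r) (N r) G r (D r),
      forall u d, SH r u -> SH r d -> X r (u, d) = D r u (nseq r d) &
      forall u d, SH r u -> SH r.-1 d -> forall e : R, 0 < e ->
        exists2 q : R, 0 < q & forall u' d', SH r u' -> SH r.-1 d' ->
          N r (u' - u) < q -> N r.-1 (d' - d) < q ->
          `|X r (u', d') - X r (u, d)| < e].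

Lemma mild_family_exists : mildly_differentiable tau lmax G ->
  exists D X, mild_family D X /\ forall z, X 0%N z = G z.1.
Proof.
move=> GM.
have SC l := @smooth_hist_C R tau n np tau_gt0 l.
have : forall r, exists DX : (hist -> seq hist -> 'rV[R]_nG) * (hist * hist -> 'rV[R]_nG),
  ((r <= lmax)%N -> [/\ iterated_derivative (SH r) (N r) G r DX.1,
      forall u d, SH r u -> SH r d -> DX.2 (u, d) = DX.1 u (nseq r d) &
      forall u d, SH r u -> SH r.-1 d -> forall e : R, 0 < e ->
        exists2 q : R, 0 < q & forall u' d', SH r u' -> SH r.-1 d' ->
          N r (u' - u) < q -> N r.-1 (d' - d) < q ->
          `|DX.2 (u', d') - DX.2 (u, d)| < e]) /\ (r = 0%N -> forall z, DX.2 z = G z.1).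
  move=> r; have [rl|rl] := leqP r lmax; last first.
    by exists (fun _ _ => 0, fun z => G z.1).
  have [D [HD HX]] := GM r rl.
  have HD' := iterated_derivativeW (SC r) HD.
  case: r rl HX HD HD' => [|r] rl HX HD HD'; last first.
    have [X X1 X2] := HX isT.
    exists (D, X); split=> // _; split=> //.
      by move=> u d us ds; apply: X1; exact: SC.
    move=> u d us ds e e0.
    have [q q0 Hq] := X2 (u, d) (conj (SC _ _ us) (SC _ _ ds)) e e0.
    exists q => // u' d' us' ds' N1 N2.
    apply: (Hq (u', d')); first by split; exact: SC.
    by rewrite /= gt_max N1 N2.
  (* At order 0 the hypothesis provides no extension; continuity of [G] takes its place. *)
  exists (D, fun z => G z.1); split=> // _; split=> //.
    by move=> u d us ds /=; have [-> //] := HD'.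
  move=> u d us ds e e0.
  have [Du _ _ Hc] := HD'.
  have [q q0 Hq] := Hc 0%N isT u us (e / 2) ltac:(lra).
  exists q => // u' d' us' ds' N1 _ /=.
  have A00 : args (SH 0) 0 [::] by split.
  have := Hq _ (smooth_histB us' us) N1 [::] A00.
  rewrite big_nil mulr1 (addrC u) subrK !Du// => H; lra.
move=> /choice[DX H]; exists (fun r => (DX r).1), (fun r => (DX r).2); split.
  by move=> r /((H r).1).
exact: (H 0%N).2.
Qed.

Variables (D : nat -> hist -> seq hist -> 'rV[R]_nG) (X : nat -> hist * hist -> 'rV[R]_nG).
Hypothesis DX : mild_family D X.

Let A0 r := @smooth_hist0 R n np r.
Let A_lin r := @smooth_hist_linear R n np r.
Let N0 r := @hist_norm0 R tau n np tau_gt0 r.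
Let N_ge0 r := @hist_norm_ge0 R tau n np tau_gt0 r.
Let N_lin r := @hist_norm_linear R tau n np tau_gt0 r.

Lemma tends_extension (P : Type) (Q : R -> P -> Prop) r u d u0 d0 :
  (forall d d' p, d <= d' -> Q d p -> Q d' p) -> (r <= lmax)%N ->
  tendsH Q tau r u u0 -> tendsH Q tau r.-1 d d0 ->
  tends Q (fun p => X r (u p, d p)) (X r (u0, d0)).
Proof.
move=> Qm rl [u0s [q1 q10 H1] Hu] [d0s [q2 q20 H2] Hd] e e0.
have [_ _ /(_ _ _ u0s d0s e e0)[q q0 Hq]] := DX rl.
have q2' : 0 < q / 2 by rewrite divr_gt0.
have [q3 q30 H3] := Hu _ q2'; have [q4 q40 H4] := Hd _ q2'.
have Qq (x y : R) p : x <= y -> Q x p -> Q y p by exact: Qm.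
exists (Num.min (Num.min q1 q2) (Num.min q3 q4)) => [|p Qp].
  by rewrite !lt_min q10 q20 q30.
apply/ltW/Hq.
- by apply: H1; apply: Qq Qp; rewrite !ge_min lexx.
- by apply: H2; apply: Qq Qp; rewrite !ge_min lexx orbT.
- apply: (@le_lt_trans _ _ (q / 2)); last lra.
  by apply: H3; apply: Qq Qp; rewrite !ge_min lexx !orbT.
- apply: (@le_lt_trans _ _ (q / 2)); last lra.
  by apply: H4; apply: Qq Qp; rewrite !ge_min lexx !orbT.
Qed.

Let lam r : nat -> R := projT1 (cid (@derivative_weights R 'rV[R]_nG r)).

Let lamP r (c : nat -> 'rV[R]_nG) :
  hasD (fun s : R => \sum_(i < r.+1) s ^+ i *: c i) 0
    (\sum_(j < r.+1) lam r j *: \sum_(i < r.+1) (j%:R ^+ i) *: c i).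
Proof. exact: projT2 (cid (@derivative_weights R 'rV[R]_nG r)) c. Qed.

(* Extends [r D^r G(u)(a, w, ..., w)] to arguments [a], [w] in C^(r-1). *)
Definition polarized r u a w : 'rV[R]_nG :=
  \sum_(j < r.+1) lam r j *: X r (u, w + j%:R *: a).

(** [X r (u, w + s *: a)] is polynomial in [s]. The weights compute its derivative at 0 from the
    values at 0, ..., r, and [hasD_diagonal] identifies that derivative. *)
Lemma polarizedE r u a w : (r <= lmax)%N -> SH r u -> SH r a -> SH r w ->
  polarized r u a w = r%:R *: D r u (a :: nseq r.-1 w).
Proof.
move=> rl us sa ws; have [HD HX _] := DX rl.
have nilA : allA (SH r) [::]; first by move=> x; rewrite in_nil => F; discriminate F.
have [c Hc] := derivative_polynomial (@A_lin r) HD us nilA ws sa (leqnn r).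
have H2 := hasD_diagonal (@A0 r) (@A_lin r) (N0 r) (@N_ge0 r) (@N_lin r) HD us nilA ws sa (leqnn r).
apply: (hasD_unique (t := 0) (f := fun s : R => \sum_(i < r.+1) s ^+ i *: c i)).
  apply: (hasD_val _ (lamP r c)); apply: eq_bigr => j _; congr (_ *: _).
  rewrite HX; [exact/esym/Hc|exact: us|].
  by apply: smooth_histD ws _; exact: smooth_histZ.
by apply: hasD_ext H2 => s; exact: Hc.
Qed.

Lemma tends_polarized (P : Type) (Q : R -> P -> Prop) r u a w u0 a0 w0 :
  (forall d d' p, d <= d' -> Q d p -> Q d' p) -> (r <= lmax)%N ->
  tendsH Q tau r u u0 -> tendsH Q tau r.-1 a a0 -> tendsH Q tau r.-1 w w0 ->
  tends Q (fun p => polarized r (u p) (a p) (w p)) (polarized r u0 a0 w0).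
Proof.
move=> Qm rl Hu Ha Hw; apply: (tends_sum Qm) => j; apply: tendsZ.
exact: (tends_extension Qm rl Hu (tendsH_D Qm tau_gt0 Hw (tendsH_Z Qm tau_gt0 _ Ha))).
Qed.

(** The chain rule [D^(r+1) G(z)(z', w, ..., w) + r D^r G(z)(w', w, ..., w)]. As [polarized r]
    already carries the factor [r], only the first term is normalized. *)
Definition extension_derivative r z w (t : R) : 'rV[R]_nG :=
  r.+1%:R^-1 *: polarized r.+1 (shiftH t z) (shiftH t (deriveH z)) (shiftH t w) +
  polarized r (shiftH t z) (shiftH t (deriveH w)) (shiftH t w).

Let quotQ_mono (d d' : R) (p : R * R * R) : d <= d' -> quotQ d p -> quotQ d' p.
Proof.
move=> dd [p1 p2 /andP[p3 p4] p5]; split=> //; first exact: lt_le_trans dd.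
by rewrite p3 (lt_le_trans p4 dd).
Qed.

(* The smoothed curve is linear in [s] between the times [t] and [t + h]. *)
Let seg (z : hist) (t : R) (p : R * R * R) : hist :=
  shiftH t (steklovH p.1.2 z) +
  p.2 *: (p.1.1^-1 *: (shiftH (t + p.1.1) (steklovH p.1.2 z) - shiftH t (steklovH p.1.2 z))).

Lemma tendsH_comp (P P' : Type) (Q : R -> P -> Prop) (Q' : R -> P' -> Prop) (g : P' -> P) l x x0 :
  (forall d, 0 < d -> exists2 d', 0 < d' & forall p, Q' d' p -> Q d (g p)) ->
  tendsH Q tau l x x0 -> tendsH (n := n) (np := np) Q' tau l (fun p => x (g p)) x0.
Proof.
move=> H [xs [d1 d10 D1] Hx]; split; first exact: xs.
  by have [d' d'0 D'] := H _ d10; exists d'; [exact: d'0|move=> p /D' /D1; exact].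
move=> e /Hx[d /H[d' d'0 D'] Dd]; exists d'; first exact: d'0.
by move=> p /D' /Dd.
Qed.

Let seg_tends l z t : SH l z -> tendsH quotQ tau l (seg z t) (shiftH t z).
Proof.
move=> zs.
have T0 : tendsH quotQ tau l (fun p => shiftH t (steklovH p.1.2 z)) (shiftH t z).
  apply: (tendsH_comp (g := fun p : R * R * R => (t, p.1.2)) _ (steklov_shiftH_tends tau_gt0 t zs)).
  by move=> d d0; exists d => // p [_ _ p3 _]; split=> //=; rewrite subrr normr0.
have T1 : tendsH quotQ tau l (fun p => shiftH (t + p.1.1) (steklovH p.1.2 z)) (shiftH t z).
  apply: (tendsH_comp (g := fun p : R * R * R => (t + p.1.1, p.1.2)) _
    (steklov_shiftH_tends tau_gt0 t zs)).
  by move=> d d0; exists d => // p [_ p2 p3 _]; split=> //=; rewrite addrC addKr.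
rewrite -[X in tendsH _ _ _ _ X]addr0.
apply: (tendsH_D quotQ_mono tau_gt0 T0).
have T2 := tendsH_D quotQ_mono tau_gt0 T1 (tendsH_Z quotQ_mono tau_gt0 (-1) T0).
rewrite scaleN1r subrr in T2.
have c1 : exists2 d : R, 0 < d & forall p, quotQ d p -> `|p.2 / p.1.1| <= 1.
  exists 1; [exact: ltr01|move=> p [p1 _ _ p4]].
  by rewrite normrM normfV ler_pdivrMr ?normr_gt0// mul1r.
have := tendsH_null quotQ_mono tau_gt0 c1 T2; rewrite /seg.
set x := fun p => _; set y := fun p => _; suff -> : x = y by [].
by apply/funext => p; rewrite /x /y scalerA scaleN1r.
Qed.

Let stekQ_mono t (d d' : R) (p : R * R) : d <= d' -> stekQ t d p -> stekQ t d' p.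
Proof.
move=> dd [p1 /andP[p3 p4]]; split; first exact: lt_le_trans dd.
by rewrite p3 (lt_le_trans p4 dd).
Qed.

(** The difference of the values at two times does not depend on the path between them, so the
    smoothed curve is replaced by a chord, along which [hasD_segment] applies. The resulting
    derivative is expressed by [polarized], which is continuous in the weak norms available for [z]
    and [w]; then the smoothing width tends to 0. *)
Lemma extension_hasD r z w t : (r.+1 <= lmax)%N -> SH r.+1 z -> SH r.-1.+1 w ->
  hasD (fun s => X r (shiftH s z, shiftH s w)) t (extension_derivative r z w t).
Proof.
move=> rl zs ws; set V := extension_derivative r z w t.
have rl' := ltnW rl.
have [HD1 _ _] := DX rl; have [HD0 HX _] := DX rl'.
have wr : SH r w by case: (r) ws => [|r'] //=; exact: smooth_histW.
have Z := steklov_quotient_tends tau_gt0 t zs.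
have W := steklov_quotient_tends tau_gt0 t ws.
have Sz := seg_tends t zs.
have Swr := seg_tends t wr.
set qz := fun p : R * R * R => _ in Z; set qw := fun p : R * R * R => _ in W.
have T : tends quotQ (fun p => r.+1%:R^-1 *: polarized r.+1 (seg z t p) (qz p) (seg w t p)
   + polarized r (seg z t p) (qw p) (seg w t p)) V.
  apply: (tendsD quotQ_mono).
    by apply: tendsZ; exact: (tends_polarized quotQ_mono rl Sz Z Swr).
  apply: (tends_polarized quotQ_mono rl' _ W).
    exact: (tendsH_W quotQ_mono tau_gt0 (leqnSn r) Sz).
  exact: (tendsH_W quotQ_mono tau_gt0 (leq_pred r) Swr).
(* The bound is uniform in the width [k], so [k] may tend to 0 with [h] fixed. *)
have key e : 0 < e -> exists2 d : R, 0 < d & forall h k, h != 0 -> `|h| < d -> 0 < k < d ->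
    `|X r (shiftH (t + h) (steklovH k z), shiftH (t + h) (steklovH k w))
      - X r (shiftH t (steklovH k z), shiftH t (steklovH k w)) - h *: V| <= e * `|h|.
  move=> e0; have [d d0 Hd] := T e e0; exists d => // h k h0 hd kd.
  have zk : SH r.+1 (steklovH k z).
    exact: smooth_histW (leqnSn r.+1) (steklovH_smooth k zs).
  have wk : SH r.+1 (steklovH k w) := steklovH_smooth k wr.
  pose u0 := shiftH t (steklovH k z); pose w0 := shiftH t (steklovH k w).
  have u0s : SH r.+1 u0 := (shiftH_smooth t zk).1.
  have w0s : SH r.+1 w0 := (shiftH_smooth t wk).1.
  pose a := h^-1 *: (shiftH (t + h) (steklovH k z) - u0).
  pose b := h^-1 *: (shiftH (t + h) (steklovH k w) - w0).
  have as_ : SH r.+1 a.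
    exact: smooth_histZ (smooth_histB (shiftH_smooth _ zk).1 u0s).
  have bs : SH r.+1 b.
    exact: smooth_histZ (smooth_histB (shiftH_smooth _ wk).1 w0s).
  have Ds s := hasD_segment (@A0 r.+1) (@A_lin r.+1) (N0 r.+1) (@N_ge0 r.+1)
    (@N_lin r.+1) HD1 s u0s as_ w0s bs (ltnSn r).
  have us s : SH r.+1 (u0 + s *: a) := smooth_histD u0s (smooth_histZ s as_).
  have vs s : SH r.+1 (w0 + s *: b) := smooth_histD w0s (smooth_histZ s bs).
  have SS x : SH r.+1 x -> SH r x := smooth_histW (leqnSn r).
  have uniq u v : SH r.+1 u -> allA (SH r.+1) v -> (size v <= r)%N -> D r.+1 u v = D r u v.
    move=> us' vs' sz; symmetry.
    have SW : SH r.+1 `<=` SH r by move=> x; exact: SS.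
    exact: (iterated_derivative_unique (@A0 r.+1) (@A_lin r.+1) (N0 r.+1) (@N_ge0 r.+1)
      (@N_lin r.+1) (@A0 r) (@A_lin r) (N0 r) (@N_ge0 r) (@N_lin r) SW HD0
      (iterated_derivative_le (leqnSn r) HD1)).
  have XD u v : SH r.+1 u -> SH r.+1 v -> D r.+1 u (nseq r v) = X r (u, v).
    move=> us' vs'; rewrite HX; [|exact: SS|exact: SS].
    by apply: (uniq _ _ us'); [exact: (@allA_nseq _ _ _ _ _ vs')|rewrite size_nseq].
  pose f s := D r.+1 (u0 + s *: a) (nseq r (w0 + s *: b)) - s *: V.
  have fD s : hasD f s (r.+1%:R^-1 *: polarized r.+1 (u0 + s *: a) a (w0 + s *: b) +
      polarized r (u0 + s *: a) b (w0 + s *: b) - V).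
    apply: hasDB; last exact: hasD_id_scale.
    apply: (hasD_val _ (Ds s)); congr (_ + _).
      rewrite (polarizedE rl (us s) as_ (vs s)) (scalerA r.+1%:R^-1) mulVf ?pnatr_eq0//.
      by rewrite scale1r.
    rewrite (polarizedE rl' (SS _ (us s)) (SS _ bs) (SS _ (vs s))).
    (* For [r = 0] the list [b :: nseq r.-1 _] is too long for [uniq], but the factor [r]
       vanishes. *)
    have [r0|r0] := eqVneq r 0%N; first have c0 : r%:R = 0 :> R by rewrite r0.
      by rewrite c0 !(scale0r (D _ _ _)).
    rewrite (uniq _ _ (us s)); first by [].
      exact: (allA_cons bs (@allA_nseq _ _ _ _ _ (vs s))).
    by rewrite /= size_nseq prednK// lt0n.
  have := @hasD_increment_bound_abs R _ f _ 0 h e _ fD.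
  rewrite /f add0r !scale0r !addr0 subr0 (XD _ _ u0s w0s) (XD _ _ (us h) (vs h)) => H.
  have Eh (x y : hist) : y + h *: (h^-1 *: (x - y)) = x.
    by rewrite scalerA divff// scale1r addrC subrK.
  rewrite !Eh in H; rewrite addrAC; apply: H => s; rewrite subr0 => sh.
  by apply: (Hd (h, k, s)); split.
move=> e e0; have e2 : 0 < e / 2 by rewrite divr_gt0.
have [d d0 Hd] := key _ e2; exists d => // s sd.
have [->|st] := eqVneq s t; first by rewrite !subrr scale0r subrr !normr0 mulr0.
have h0 : s - t != 0 by rewrite subr_eq0.
(* At the two fixed times the smoothed values converge to the true ones; the width is chosen
   last. *)
have T1 x : tends (stekQ x) (fun p => X r (shiftH p.1 (steklovH p.2 z),
  shiftH p.1 (steklovH p.2 w)))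
   (X r (shiftH x z, shiftH x w)).
  apply: (tends_extension (@stekQ_mono x) rl').
    exact: (tendsH_W (@stekQ_mono x) tau_gt0 (leqnSn r) (steklov_shiftH_tends tau_gt0 x zs)).
  exact: (tendsH_W (@stekQ_mono x) tau_gt0 (leqnSn r.-1) (steklov_shiftH_tends tau_gt0 x ws)).
apply/ler_addgt0Pr => c c0; have c2 : 0 < c / 2 by rewrite divr_gt0.
have [d1 d10 H1] := T1 s _ c2; have [d2 d20 H2] := T1 t _ c2.
pose k := Num.min d (Num.min d1 d2) / 2.
have m0 : 0 < Num.min d (Num.min d1 d2) by rewrite !lt_min d0 d10.
have k0 : 0 < k by rewrite divr_gt0.
have : k < Num.min d (Num.min d1 d2) by rewrite /k; lra.
rewrite !lt_min => /and3P[kd kd1 kd2].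
have Q1 : stekQ s d1 (s, k) by split; rewrite /= ?subrr ?normr0 ?k0.
have Q2 : stekQ t d2 (t, k) by split; rewrite /= ?subrr ?normr0 ?k0.
have {}H1 := H1 _ Q1; have {}H2 := H2 _ Q2.
have := Hd _ k h0 sd; rewrite k0 kd => /(_ isT); rewrite (addrC t) subrK => H3.
move: H1 H2 H3 => /=.
set x1 := X r (shiftH s (steklovH k z), _); set x2 := X r (shiftH t (steklovH k z), _).
set y1 := X r _; set y2 := X r _ => H1 H2 H3.
have -> : y1 - y2 - (s - t) *: V = (x1 - x2 - (s - t) *: V) - (x1 - y1) + (x2 - y2).
  rewrite !opprD !opprK !addrA [RHS](ACl (5*7*3*(1*4)*(2*6))%AC) /=.
  by rewrite subrr addNr !addr0.
apply: (le_trans (ler_normD _ _)); apply: (le_trans (lerD (ler_normB _ _) (lexx _))).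
rewrite /= in H1 H2; have := mulr_ge0 (ltW e0) (normr_ge0 (s - t)); lra.
Qed.

Lemma smooth_sum (I : Type) (s : seq I) (m : nat) (f : I -> R -> 'rV[R]_nG) :
  (forall i, smooth m (f i)) -> smooth m (fun t => \sum_(i <- s) f i t).
Proof.
move=> H; elim: s => [|i s IH].
  rewrite (_ : (fun t => _) = fun=> 0); first exact: smooth_cst.
  by apply/funext => t; rewrite big_nil.
rewrite (_ : (fun t => _) = 1 *: f i + (fun t => \sum_(j <- s) f j t)).
  exact: (smooth_linear 1 (H i) IH).1.
by apply/funext => t; rewrite big_cons scale1r.
Qed.

(** By the chain rule the derivative is a finite combination of functions of the same kind, with [r]
    raised by one or [w] replaced by combinations of [w] with one of the derivatives of [z] and [w].
    The order still to be gained drops by one, so the required smoothness is preserved. *)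
Lemma extension_smooth m r z w : (r + m <= lmax)%N -> SH (r + m) z -> SH (r.-1 + m) w ->
  smooth m (fun t => X r (shiftH t z, shiftH t w)).
Proof.
elim: m r z w => [|m IH] r z w rm zs ws.
  rewrite !addn0 in rm zs ws; split=> // t0; move: t0.
  apply/continuousP_eps => t e e0.
  have T : tends (fun d x => `|x - t| < d) (fun x => X r (shiftH x z, shiftH x w))
     (X r (shiftH t z, shiftH t w)).
    have Qm (d d' p : R) : d <= d' -> `|p - t| < d -> `|p - t| < d'.
      by move=> dd /lt_le_trans; exact.
    exact: (tends_extension Qm rm (shiftH_tends tau_gt0 t zs) (shiftH_tends tau_gt0 t ws)).
  have [d d0 Hd] := T (e / 2) ltac:(lra); exists d => // s /Hd H.
  by apply: (le_lt_trans H); lra.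
have zs1 : SH r.+1 z by apply: smooth_histW zs; rewrite addnS ltnS leq_addr.
have ws1 : SH r.-1.+1 w by apply: smooth_histW ws; rewrite addnS ltnS leq_addr.
have rl : (r.+1 <= lmax)%N by apply: leq_trans rm; rewrite addnS ltnS leq_addr.
apply: (smoothS_hasD (v' := extension_derivative r z w)).
  by move=> t; exact: (extension_hasD t rl zs1 ws1).
rewrite addnS in rm zs; rewrite (addnS r.-1) in ws.
have pol r' (a b : hist) : (r' + m <= lmax)%N -> SH (r' + m) z ->
    SH (r'.-1 + m) a -> SH (r'.-1 + m) b ->
    smooth m (fun t => polarized r' (shiftH t z) (shiftH t a) (shiftH t b)).
  move=> rm' zs' as' bs'; apply: smooth_sum => j.
  rewrite (_ : (fun t => _) = lam r' j *: (fun t => X r' (shiftH t z, shiftH t (b + j%:R *: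
    a))) + (fun=> 0)).
    apply: (smooth_linear _ _ (smooth_cst _ _)).1; apply: (IH _ _ _ rm' zs').
    exact: smooth_histD bs' (smooth_histZ _ as').
  by apply/funext => t; rewrite /GRing.scale /GRing.add /= addr0.
rewrite (_ : extension_derivative r z w = r.+1%:R^-1 *:
   (fun t => polarized r.+1 (shiftH t z) (shiftH t (deriveH z)) (shiftH t w)) +
   (fun t => polarized r (shiftH t z) (shiftH t (deriveH w)) (shiftH t w))); last by [].
have rm' : (r + m <= lmax)%N by exact: ltnW.
apply: (smooth_linear _ _ _).1.
  apply: (pol r.+1 (deriveH z) w _ zs (deriveH_smooth zs)); first by rewrite addSn.
  have le : (r + m <= (r.-1 + m).+1)%N by rewrite -addSn leq_add2r; case: (r).
  exact: smooth_histW le ws.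
apply: (pol r (deriveH w) w rm' _ (deriveH_smooth ws)).
  exact: smooth_histW (leqnSn _) zs.
exact: smooth_histW (leqnSn _) ws.
Qed.

End Regularity.

Lemma functional_smooth (R : realType) (tau : R) (n np nG lmax m : nat)
    (G : hist R n np -> 'rV[R]_nG) (z : hist R n np) : 0 < tau ->
  mildly_differentiable tau lmax G -> (m <= lmax)%N -> smooth_hist m z ->
  smooth m (fun t => G (shiftH t z)).
Proof.
move=> tau0 /(mild_family_exists tau0)[D [X [DX X0]]] ml zs.
have := extension_smooth tau0 DX (m := m) (r := 0%N) ml zs (@smooth_hist0 _ _ _ _).
by rewrite (_ : (fun t => X _ _) = (fun t => G (shiftH t z)))//; apply/funext => t; rewrite X0.
Qed.

(** * Linearization on Lipschitz functions *)

Lemma smooth0 (R : realType) (n : nat) (v : R -> 'rV[R]_n) : continuous v -> smooth 0 v.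
Proof. by split. Qed.

Section FirstDerivative.
Context (R : realType) (tau : R) (n np nG lmax : nat).
Hypothesis tau_gt0 : 0 < tau.
Local Notation hist := (hist R n np).
Local Notation SH := (@smooth_hist R n np).
Local Notation N := (@hist_norm R tau n np).
Variable G : hist -> 'rV[R]_nG.
Variables (D : nat -> hist -> seq hist -> 'rV[R]_nG) (X : nat -> hist * hist -> 'rV[R]_nG).
Hypothesis DX : mild_family tau lmax G D X.
Hypothesis lmax_ge1 : (1 <= lmax)%N.

Let X1 := X 1%N.

Let A0 r := @smooth_hist0 R n np r.
Let A_lin r := @smooth_hist_linear R n np r.
Let N0 r := @hist_norm0 R tau n np tau_gt0 r.
Let N_ge0 r := @hist_norm_ge0 R tau n np tau_gt0 r.
Let N_lin r := @hist_norm_linear R tau n np tau_gt0 r.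

Lemma functional_hasD u a t : SH 1 u -> SH 1 a ->
  hasD (fun s => G (u + s *: a)) t (X1 (u + t *: a, a)).
Proof.
move=> us as_; have [HD HX _] := DX lmax_ge1.
have uas s : SH 1 (u + s *: a) := smooth_histD us (smooth_histZ s as_).
have nilA : allA (SH 1) [::]; first by move=> x; rewrite in_nil => F; discriminate F.
have := hasD_direction_at (@A0 1) (@A_lin 1) (N0 1) (@N_ge0 1) (@N_lin 1) HD t us as_ nilA (ltnSn
  0).
rewrite /X1 (HX _ _ (uas t) as_); apply: hasD_ext => s.
by have [Du _ _ _] := HD; rewrite (Du _ (uas s)).
Qed.

(** Continuity of DG on C^1 in operator norm, hence relative to [N 1 v]. For merely continuous [v]
    joint continuity of the extension takes over. *)
Lemma extension_operator_continuous u e : SH 1 u -> 0 < e ->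
  exists2 d : R, 0 < d & forall u', SH 1 u' -> N 1 (u' - u) < d ->
    forall v, SH 1 v -> `|X1 (u', v) - X1 (u, v)| <= e * N 1 v.
Proof.
move=> us e0; have [HD HX _] := DX lmax_ge1.
have [_ _ _ Hc] := HD; have [d d0 Hd] := Hc 1%N (leqnn _) u us e e0.
exists d; [exact: d0|move=> u' us' Nu v vs].
have Av : args (SH 1) 1 [:: v].
  by split=> [|x]; [by []|rewrite inE => /eqP->].
have := Hd (u' - u) (smooth_histB us' us) Nu [:: v] Av.
by rewrite (addrC u) subrK big_seq1 /X1 (HX _ _ us vs) (HX _ _ us' vs).
Qed.

Lemma steklov_hist_near l v e : SH l v -> 0 < e ->
  exists2 d : R, 0 < d & forall k, 0 < k < d -> N l (steklovH k v - v) <= e.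
Proof.
move=> vs e0; have [_ _ /(_ e e0)[d d0 Hd]] := steklov_shiftH_tends tau_gt0 0 vs.
exists d; [exact: d0|move=> k kd].
have S0 w : shiftH 0 w = w :> hist.
  by case: w => w1 w2; congr pair; apply/funext => s; rewrite /= add0r.
have Q0 : stekQ 0 d (0, k) by split; rewrite /= ?subrr ?normr0.
by have := Hd _ Q0; rewrite !S0.
Qed.

Lemma tends_X1 (P : Type) (Q : R -> P -> Prop) u d u0 d0 :
  (forall d d' p, d <= d' -> Q d p -> Q d' p) ->
  tendsH Q tau 1 u u0 -> tendsH Q tau 0 d d0 ->
  tends Q (fun p => X1 (u p, d p)) (X1 (u0, d0)).
Proof. by move=> Qm Hu Hd; exact: (tends_extension DX Qm lmax_ge1 Hu Hd). Qed.

Let Qstek (d : R) (k : R) : Prop := 0 < k < d.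

Let Qstek_mono (d d' : R) k : d <= d' -> Qstek d k -> Qstek d' k.
Proof. by move=> dd /andP[k0 kd]; rewrite /Qstek k0 (lt_le_trans kd dd). Qed.

Let stek_tends v : SH 0 v -> tendsH Qstek tau 0 (fun k => steklovH k v) v.
Proof.
move=> vs; split; first exact: vs.
  exists 1; [exact: ltr01|move=> k _].
  exact: smooth_histW (leqnSn 0) (steklovH_smooth k vs).
by move=> e e0; exact: steklov_hist_near.
Qed.

Lemma tends_unique (P : Type) (Q : R -> P -> Prop) (F : normedModType R) (g : P -> F) c c' :
  (forall d d' p, d <= d' -> Q d p -> Q d' p) -> (forall d, 0 < d -> exists p, Q d p) ->
  tends Q g c -> tends Q g c' -> c = c'.
Proof.
move=> Qm Qne H1 H2; apply/eqP; rewrite -subr_eq0 -normr_le0; apply/ler_addgt0Pl => e e0.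
rewrite addr0; have e2 : 0 < e / 2 by rewrite divr_gt0.
have [d1 d10 D1] := H1 _ e2; have [d2 d20 D2] := H2 _ e2.
have m0 : 0 < Num.min d1 d2 by rewrite lt_min d10.
have [p Qp] := Qne _ m0.
have B1 : `|g p - c| <= e / 2 by apply: D1; apply: Qm Qp; rewrite ge_min lexx.
have B2 : `|g p - c'| <= e / 2 by apply: D2; apply: Qm Qp; rewrite ge_min lexx orbT.
have -> : c - c' = (g p - c') - (g p - c).
  by rewrite opprB [in RHS]addrC !addrA subrK.
apply: (le_trans (ler_normB _ _)); lra.
Qed.

(** On smooth arguments this is linearity of DG; Steklov means approximate continuous arguments in
    C^0, where the extension is continuous. *)
Lemma extension_linear u (a : R) v w : SH 1 u -> SH 0 v -> SH 0 w ->
  X1 (u, a *: v + w) = a *: X1 (u, v) + X1 (u, w).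
Proof.
move=> us vs ws; have [HD HX _] := DX lmax_ge1.
have Tu := tendsH_cst Qstek tau_gt0 us.
have Tv := stek_tends vs; have Tw := stek_tends ws.
have T1 := tends_X1 Qstek_mono Tu (tendsH_D Qstek_mono tau_gt0 (tendsH_Z Qstek_mono tau_gt0 a Tv)
  Tw).
have T2 := tendsD Qstek_mono (tendsZ a (tends_X1 Qstek_mono Tu Tv)) (tends_X1 Qstek_mono Tu Tw).
apply: (tends_unique Qstek_mono _ T1).
  by move=> d d0; exists (d / 2); rewrite /Qstek; apply/andP; split; lra.
move=> e /T2[d d0 Hd]; exists d; [exact: d0|move=> k /Hd].
have vk := steklovH_smooth k vs; have wk := steklovH_smooth k ws.
have [_ /(_ _ (leqnn 1) _ us)[M _] _ _] := HD.
rewrite /X1 (HX _ _ us vk) (HX _ _ us wk) (HX _ _ us (smooth_hist_linear a vk wk)).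
have Av : args (SH 1) 1 ([::] ++ steklovH k v :: [::]).
  by split=> [|x]; [by []|rewrite inE => /eqP->].
by have := M [::] [::] a _ _ Av wk; rewrite /= => ->.
Qed.

Lemma extension0 u : SH 1 u -> X1 (u, 0) = 0.
Proof.
move=> us; have := extension_linear (-1) us (@A0 0) (@A0 0).
by rewrite scaler0 addr0 scaleN1r addNr.
Qed.

Lemma extensionZ u (a : R) v : SH 1 u -> SH 0 v -> X1 (u, a *: v) = a *: X1 (u, v).
Proof.
move=> us vs; have := extension_linear a us vs (@A0 0).
by rewrite extension0// !addr0.
Qed.

Lemma extensionB u v w : SH 1 u -> SH 0 v -> SH 0 w ->
  X1 (u, v - w) = X1 (u, v) - X1 (u, w).
Proof.
move=> us vs ws; have := extension_linear (-1) us ws vs.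
by rewrite !scaleN1r addrC => ->; rewrite addrC.
Qed.

(** Continuity at [(u, 0)] bounds the extension on a small ball, for all base points near [u] at
    once; homogeneity removes the restriction to the ball. *)
Lemma extension_bounded u : SH 1 u -> exists C d : R, [/\ 0 < C, 0 < d &
  forall u', SH 1 u' -> N 1 (u' - u) < d -> forall v, SH 0 v -> `|X1 (u', v)| <= C * N 0 v].
Proof.
move=> us; have [_ _ /(_ _ _ us (@A0 0) 1 ltr01)[d d0 Hd]] := DX lmax_ge1.
exists (2 / d), d; split=> //; first by rewrite divr_gt0.
move=> u' us' Nu v vs.
apply/ler_addgt0Pr => e e0.
(* The extra term keeps [c] positive when [N 0 v = 0]; multiplied by [2 / d] it is exactly the slack
   [e]. *)
pose c := N 0 v + e * d / 2.
have c0 : 0 < c by rewrite /c ltr_wpDl ?N_ge0// divr_gt0// mulr_gt0.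
pose a := d / (2 * c).
have a0 : 0 < a by rewrite divr_gt0// mulr_gt0.
have sav : SH 0 (a *: v) := smooth_histZ a vs.
have Nav : N 0 (a *: v - 0) < d.
  rewrite subr0; apply: (le_lt_trans (hist_normZ tau_gt0 a vs)).
  rewrite gtr0_norm// /a mulrAC ltr_pdivrMr ?mulr_gt0// ltr_pM2l//.
  have := N_ge0 vs; have : 0 < e * d / 2 by rewrite divr_gt0// mulr_gt0.
  rewrite /c; lra.
have := Hd _ _ us' sav Nu Nav; rewrite -/X1 (extension0 us) subr0 (extensionZ _ us' vs).
rewrite normrZ gtr0_norm// -ltr_pdivlMl// mulr1 => /ltW/le_trans; apply.
have -> : a^-1 = 2 * c / d by rewrite /a invf_div.
rewrite /c mulrDr mulrDl (_ : 2 * (e * d / 2) / d = e); last first.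
  by field; rewrite lt0r_neq0.
by rewrite lerD2r mulrAC.
Qed.

Lemma functional_continuous u e : SH 0 u -> 0 < e ->
  exists2 d : R, 0 < d & forall u', SH 0 u' -> N 0 (u' - u) < d -> `|G u' - G u| <= e.
Proof.
move=> us e0; have [HD _ _] := DX (leq0n lmax).
have [Du _ _ Hc] := HD; have [d d0 Hd] := Hc 0%N (leqnn _) u us e e0.
exists d; [exact: d0|move=> u' us' Nu].
have A00 : args (SH 0) 0 [::] by split.
have := Hd _ (smooth_histB us' us) Nu [::] A00.
by rewrite (addrC u) subrK big_nil mulr1 (Du _ us) (Du _ us').
Qed.

Lemma tends_functional (P : Type) (Q : R -> P -> Prop) u u0 :
  (forall d d' p, d <= d' -> Q d p -> Q d' p) ->
  tendsH Q tau 0 u u0 -> tends Q (fun p => G (u p)) (G u0).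
Proof.
move=> Qm [u0s [q1 q10 H1] Hu] e e0.
have [d d0 Hd] := functional_continuous u0s e0.
have [q2 q20 H2] := Hu _ (divr_gt0 d0 (ltr0Sn R 1)).
exists (Num.min q1 q2) => [|p Qp]; first by rewrite lt_min q10.
apply: Hd; first by apply: H1; apply: Qm Qp; rewrite ge_min lexx.
apply: (@le_lt_trans _ _ (d / 2)); last lra.
by apply: H2; apply: Qm Qp; rewrite ge_min lexx orbT.
Qed.

End FirstDerivative.

Lemma norm_le2 (R : realType) (V : normedModType R) (x y : V) (a b e : R) :
  `|x| <= a -> `|y| <= b -> a + b <= e -> `|x + y| <= e.
Proof. by move=> xa yb; apply: le_trans; apply: (le_trans (ler_normD _ _)); exact: lerD. Qed.

Lemma norm_le3 (R : realType) (V : normedModType R) (x y z : V) (a b c e : R) :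
  `|x| <= a -> `|y| <= b -> `|z| <= c -> a + b + c <= e -> `|x + y + z| <= e.
Proof. by move=> xa yb; apply: norm_le2; exact: norm_le2 xa yb _. Qed.

Section RealArithmetic.
Context (R : realType).
Implicit Types a b c d e x y : R.

Lemma quarters_le2 e : 0 < e -> e / 4 + e / 4 <= e.
Proof. by lra. Qed.

Lemma quarters_le3 e : 0 < e -> e / 4 + e / 4 + e / 4 <= e.
Proof. by lra. Qed.

Lemma quarter_le e : 0 < e -> e / 4 <= e.
Proof. by lra. Qed.

Lemma eighths_le e c : 0 <= e * c -> e / 8 * c + e / 8 * c + e / 4 * c + e / 4 * c <= e * c.
Proof. by lra. Qed.

Lemma le_double x y d : `|x - y| < d -> d <= y -> x <= 2 * y.
Proof. by rewrite ltr_norml => /andP[_]; lra. Qed.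

End RealArithmetic.

Section PeriodicFunctions.
Context (R : realType).

(* One representative in [0, 1] serves all periodic functions at once. *)
Lemma periodic_reduce (t : R) : exists2 t' : R, 0 <= t' < 1 &
  forall (T : Type) (f : R -> T), (forall r, f (r + 1) = f r) -> f t = f t'.
Proof.
have /andP[f1 f2] := floor_itv t; set k := Num.floor t in f1 f2.
exists (t - k%:~R); first by rewrite intrD in f2; apply/andP; split; lra.
move=> T f fp.
have fn (m : nat) r : f (r + m%:R) = f r.
  by elim: m => [|m IH]; rewrite ?addr0// -natr1 addrA fp.
rewrite -{1}[t](subrK k%:~R); case: k {f1 f2} => m; first by rewrite fn.
by rewrite NegzE mulrNz opprK addrK -(fn m.+1 t).
Qed.

Lemma periodic_uniform (n : nat) (y : R -> 'rV[R]_n) e : continuous y -> one_periodic y -> 0 < e ->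
  exists2 d : R, 0 < d & forall s t, `|s - t| < d -> `|y s - y t| < e.
Proof.
move=> yc yp e0; have [d d0 H] := @continuous_uniform R _ y 0 1 e yc e0.
exists d => // s t st; have [t' /andP[t0 t1] red] := periodic_reduce t.
rewrite -[s](subrK t).
rewrite (red _ (fun r => `|y (s - t + r) - y r| < e)); last first.
  by move=> r; rewrite addrA !yp.
by apply: H; [rewrite t0 ltW|rewrite addrK].
Qed.

Lemma hasD_lipschitz (F : normedModType R) (f f' : R -> F) c : (forall t, hasD f t (f' t)) ->
  (forall t, `|f' t| <= c) -> forall s t, `|f s - f t| <= c * `|s - t|.
Proof.
move=> D B s t.
have := @hasD_increment_bound_abs R F f f' t (s - t) c (fun r _ => B r) D.
by rewrite (addrC t) subrK.
Qed.

End PeriodicFunctions.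

(** * Linearization error in the Lipschitz norm *)

Section KeyEstimate.
Context (R : realType) (tau : R) (n np lmax : nat).
Hypothesis tau_gt0 : 0 < tau.
Local Notation hist := (hist R n np).
Local Notation triple := (triple R n np).
Local Notation SH := (@smooth_hist R n np).
Local Notation N := (@hist_norm R tau n np).
Variable G : hist -> 'rV[R]_n.
Variables (D : nat -> hist -> seq hist -> 'rV[R]_n) (X : nat -> hist * hist -> 'rV[R]_n).
Hypothesis DX : mild_family tau lmax G D X.
Hypothesis lmax_ge1 : (1 <= lmax)%N.

Definition small0 (c : R) (x : triple) : Prop :=
  [/\ forall t, `|yof x t| <= c, `|Tof x| <= c & `|pof x| <= c].

(** The inequality [tri_norm01 x <= c] spelled out. It asserts a Lipschitz bound outright, whereas
    [sup] takes a default value on unbounded sets. *)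
Definition small01 (c : R) (x : triple) : Prop :=
  small0 c x /\ forall s t, `|yof x s - yof x t| <= c * `|s - t|.

Lemma small0_ge0 c x : small0 c x -> 0 <= c.
Proof. by case=> _ _; apply: le_trans. Qed.

Lemma small01W c c' x : c <= c' -> small01 c x -> small01 c' x.
Proof.
move=> cc [[x1 x2 x3] x4]; split; first by split=> [t||]; exact: le_trans cc.
by move=> s t; apply: (le_trans (x4 s t)); rewrite ler_wpM2r.
Qed.

Lemma small01_0 c : 0 <= c -> small01 c 0.
Proof.
move=> c0; have z : `|0 : 'rV[R]_n| <= c by rewrite normr0.
split; first by split; [move=> t; exact: z|rewrite normr0|rewrite normr0].
move=> s t; change (`|(0 : 'rV[R]_n) - 0| <= c * `|s - t|).
by rewrite subrr normr0 mulr_ge0.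
Qed.

Lemma lipschitz_hasD (y : R -> 'rV[R]_n) c t v :
  (forall s r, `|y s - y r| <= c * `|s - r|) -> hasD y t v -> `|v| <= c.
Proof.
move=> yc yv; apply/ler_addgt0Pr => e e0; have [d d0 Hd] := yv e e0.
pose s := t + d / 2; have st : s - t = d / 2 by rewrite /s addrC addKr.
have s0 : 0 < d / 2 by rewrite divr_gt0.
have := Hd s; rewrite st gtr0_norm// => /(_ ltac:(lra)) B.
have := yc s t; rewrite st gtr0_norm// => B2.
rewrite -(ler_pM2r s0) mulrDl.
have -> : `|v| * (d / 2) = `|(d / 2) *: v| by rewrite normrZ gtr0_norm// mulrC.
rewrite -[X in `|X| <= _](subKr (y s - y t)).
by apply: (le_trans (ler_normB _ _)); lra.
Qed.

Definition state (t : R) (x : triple) : hist := (fun s => yof x (t + s / Tof x), pof x).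

Lemma state_smooth l t x : smooth l (yof x) -> SH l (state t x) /\
  forall j, (j <= l)%N -> derive1n j (state t x).1 =
    fun s => (Tof x)^-1 ^+ j *: derive1n j (yof x) (t + s / Tof x).
Proof.
move=> xl; have [A B] := smooth_affine t (Tof x)^-1 xl.
have E (y : R -> 'rV[R]_n) : (fun s => y (t + (Tof x)^-1 * s)) = (fun s => y (t + s / Tof x)).
  by apply/funext => s; rewrite (mulrC _ s).
split=> [|j jl]; first by rewrite E in A.
have := B j jl; rewrite (E (yof x)) /= => ->.
by apply/funext => s; rewrite (mulrC _ s).
Qed.

Variable xs : triple.
Hypothesis Ts_gt0 : 0 < Tof xs.
Hypothesis ys_smooth : smooth 1 (yof xs).
Hypothesis ys_periodic : one_periodic (yof xs).

Let Ts : R := Tof xs.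
Let ths : R := Ts^-1.
Let ys := yof xs.
Let dys := derive1 ys.

Let ths_gt0 : 0 < ths. Proof. by rewrite invr_gt0. Qed.

Let dys_continuous : continuous dys.
Proof. by have := smooth_continuous ys_smooth (leqnn 1). Qed.

Let ys_continuous : continuous ys.
Proof. by have := smooth_continuous ys_smooth (leq0n 1). Qed.

Let ys_hasD t : hasD ys t (dys t).
Proof. exact: (@smooth_hasD _ _ 1 ys 0 t ys_smooth isT). Qed.

(** The derivative of [ys (t + s / T)] with respect to [T] at [Ts]. It contains [dys], so it is a
    C^0 history when [ys] is C^1. *)
Let period_derivative t : hist := (fun s => - (s * ths ^+ 2) *: dys (t + s / Ts), 0).

Definition linear_state t (d : triple) : hist :=
  (fun s => yof d (t + s / Ts), pof d) + Tof d *: period_derivative t.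

(** The operator A of the overview. Through the extension [X 1] it is defined for every continuous
    [yof d], smooth or not. *)
Definition linop t (d : triple) : 'rV[R]_n :=
  Tof d *: G (state t xs) + Ts *: X 1%N (state t xs, linear_state t d).

(** Here [x] is C^1, as differentiability of [G] requires, but its distance to [xs] is measured in
    C^{0,1}. The reciprocal period is controlled separately, since histories are sampled at
    [s / T]. *)
Let nearQ (t0 d : R) (p : R * triple) : Prop :=
  [/\ `|p.1 - t0| < d, smooth 1 (yof p.2), small01 d (p.2 - xs),
      `|(Tof p.2)^-1 - ths| < d & 0 < Tof p.2].

Let nearQ_mono t0 (d d' : R) p : d <= d' -> nearQ t0 d p -> nearQ t0 d' p.
Proof.
move=> dd [p1 p2 p3 p4 p5]; split; [|exact: p2| | |exact: p5].
- exact: lt_le_trans p1 dd.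
- exact: small01W dd p3.
- exact: lt_le_trans p4 dd.
Qed.

Let moving_point (v : R -> 'rV[R]_n) (t0 e : R) : continuous v -> 0 < e ->
  exists2 d : R, 0 < d & forall r s, - tau <= s <= 0 ->
    `|r - (t0 + s * ths)| < d -> `|v r - v (t0 + s * ths)| < e.
Proof.
move=> vc e0.
have [d d0 H] := @continuous_uniform R _ v (t0 - tau * ths) t0 e vc e0.
exists d => // r s /andP[s1 s2] rd; apply: H => //; apply/andP; split.
  by rewrite lerD2l -mulNr ler_pM2r.
by rewrite gerDl mulr_le0_ge0// ltW.
Qed.

Let point_bound (t t0 th d s : R) : `|t - t0| < d -> `|th - ths| < d -> - tau <= s <= 0 ->
  `|t + s * th - (t0 + s * ths)| < d + tau * d.
Proof.
move=> td thd /andP[s1 s2].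
have -> : t + s * th - (t0 + s * ths) = (t - t0) + s * (th - ths) by ring.
apply: (le_lt_trans (ler_normD _ _)); apply: ltr_leD => //.
rewrite normrM; apply: ler_pM; [exact: normr_ge0|exact: normr_ge0| |exact: ltW].
by rewrite ler0_norm//; lra.
Qed.

(** Closeness in C^{0,1} suffices for convergence in C^1: for differentiable functions a Lipschitz
    bound on the difference bounds the difference of the derivatives. *)
Let state_tends t0 : tendsH (nearQ t0) tau 1 (fun p => state p.1 p.2) (state t0 xs).
Proof.
have S0 := state_smooth t0 ys_smooth.
split; first exact: S0.1.
  by exists 1; [exact: ltr01|move=> p [_ ps _ _ _]; exact: (state_smooth p.1 ps).1].
move=> e e0.
have e4 : 0 < e / 4 by rewrite divr_gt0.
have [d1 d10 H1] := moving_point t0 ys_continuous e4.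
pose k := e / (4 * (2 * ths)).
have k0 : 0 < k by rewrite divr_gt0// !mulr_gt0.
have [d2 d20 H2] := moving_point t0 dys_continuous k0.
have [M M0 HM] := continuous_bounded (t0 - tau * ths) t0 dys_continuous.
pose d := Num.min (Num.min (Num.min (d1 / (1 + tau)) (d2 / (1 + tau))) (Num.min (e / 4) k))
   (Num.min ths (e / (4 * M))).
have t1 : 0 < 1 + tau by rewrite ltr_wpDl.
have d0 : 0 < d by rewrite !lt_min k0 ths_gt0 e4 !divr_gt0// mulr_gt0.
exists d => // -[t x] [/= td xl [[x1 x2 x3] x4] x5 x6].
have S := state_smooth t xl.
apply/(hist_normP tau_gt0 _ (smooth_histB S.1 S0.1)).
have dd1 : d + tau * d <= d1.
  have : d <= d1 / (1 + tau) by rewrite !ge_min lexx.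
  by rewrite ler_pdivlMr//; lra.
have dd2 : d + tau * d <= d2.
  have : d <= d2 / (1 + tau) by rewrite !ge_min lexx !orbT.
  by rewrite ler_pdivlMr//; lra.
have de4 : d <= e / 4 by rewrite !ge_min lexx !orbT.
have dk : d <= k by rewrite !ge_min lexx !orbT.
have dth : d <= ths by rewrite !ge_min lexx !orbT.
have dM : d <= e / (4 * M) by rewrite !ge_min lexx !orbT.
split; last by apply: (le_trans x3); apply: (le_trans de4); exact: quarter_le.
move=> j s jl sI; rewrite (smooth_histB_derive S.1 S0.1 jl) S.2// S0.2//.
set th := (Tof x)^-1 in x5 *.
have P := point_bound td x5 sI; 
have thp : 0 < th by rewrite invr_gt0.
have th2 : th <= 2 * ths by exact: le_double x5 dth.
case: j jl => [|[|//]] _.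
  rewrite !expr0 !scale1r /=.
  have B1 := H1 _ _ sI (lt_le_trans P dd1).
  have B2 := le_trans (x1 (t + s * th)) de4.
  rewrite -(subrK (ys (t + s * th)) (yof x _)) -addrA.
  by apply: (norm_le2 B2 (ltW B1)); exact: quarters_le2.
rewrite !expr1 /=.
have xD : hasD (yof x) (t + s * th) (derive1 (yof x) (t + s * th)).
  exact: (@smooth_hasD _ _ 1 (yof x) 0 _ xl isT).
have B1 : `|derive1 (yof x) (t + s * th) - dys (t + s * th)| <= d.
  by apply: (lipschitz_hasD x4); exact: hasDB xD (ys_hasD _).
have B2 := H2 _ _ sI (lt_le_trans P dd2).
have B3 : `|dys (t0 + s * ths)| <= M.
  case/andP: sI => s1 s2; apply: HM; apply/andP; split.
    by rewrite lerD2l -mulNr ler_pM2r.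
  by rewrite gerDl mulr_le0_ge0// ltW.
set a := derive1 (yof x) _ in B1 *; set b := dys (t + _) in B1 B2; set c := dys _ in B2 B3 *.
have -> : th *: a - (Tof xs)^-1 *: derive1 (yof xs) (t0 + s / Tof xs) =
   th *: (a - b) + th *: (b - c) + (th - ths) *: c.
  by rewrite -scalerDr addrA subrK scalerBr scalerBl addrA subrK.
have thk : 2 * ths * k = e / 4 by rewrite /k; field; rewrite lt0r_neq0.
have Mk : e / (4 * M) * M = e / 4 by field; rewrite lt0r_neq0.
have C1 : `|th *: (a - b)| <= e / 4.
  rewrite normrZ (gtr0_norm thp) -thk.
  apply: ler_pM; [exact: ltW thp|exact: normr_ge0|exact: th2|exact: le_trans B1 dk].
have C2 : `|th *: (b - c)| <= e / 4.
  rewrite normrZ (gtr0_norm thp) -thk.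
  apply: ler_pM; [exact: ltW thp|exact: normr_ge0|exact: th2|exact: ltW B2].
have C3 : `|(th - ths) *: c| <= e / 4.
  rewrite normrZ -Mk; apply: ler_pM; [exact: normr_ge0|exact: normr_ge0| |exact: B3].
  exact: le_trans (ltW x5) dM.
by apply: (norm_le3 C1 C2 C3); exact: quarters_le3.
Qed.

Let period_derivative_smooth t : SH 0 (period_derivative t).
Proof.
have c : continuous (fun s : R => dys (t + s / Ts)).
  move=> s; apply: (@continuous_comp _ _ _ (fun s : R => t + s / Ts) dys); last exact:
    dys_continuous.
  by apply: cvgD; [exact: cvg_cst|apply: cvgM; [exact: cvg_id|exact: cvg_cst]].
apply: smooth0 => s; apply: cvgZ; last exact: c.
by apply: cvgN; apply: cvgM; [exact: cvg_id|exact: cvg_cst].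
Qed.

Let scaled_bound (s e : R) : - tau <= s <= 0 -> `|s * e| <= tau * `|e|.
Proof. by move=> /andP[s1 s2]; rewrite normrM ler_wpM2r// ler0_norm//; lra. Qed.

Let hist_norm0_le (w : hist) c : SH 0 w -> (forall s, - tau <= s <= 0 -> `|w.1 s| <= c) ->
  `|w.2| <= c -> N 0 w <= c.
Proof.
move=> ws H1 H2; apply/(hist_normP tau_gt0 _ ws); split; last exact: H2.
by move=> [|j] s // _; exact: H1.
Qed.

Let period_derivative_tends t0 :
  tendsH (fun d t => `|t - t0| < d) tau 0 period_derivative (period_derivative t0).
Proof.
split; first exact: period_derivative_smooth.
  by exists 1; [exact: ltr01|move=> t _; exact: period_derivative_smooth].
move=> e e0; pose k := e / (tau * ths ^+ 2).
have k0 : 0 < k by rewrite divr_gt0// mulr_gt0// exprn_gt0.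
have [d d0 H] := moving_point t0 dys_continuous k0.
exists d => // t td; apply: hist_norm0_le.
- exact: smooth_histB (period_derivative_smooth t) (period_derivative_smooth t0).
- move=> s sI /=.
  have B : `|dys (t + s * ths) - dys (t0 + s * ths)| < k.
    by apply: H => //; rewrite opprD addrACA subrr addr0.
  rewrite [X in `|X|](_ : _ = - (s * ths ^+ 2) *: (dys (t + s * ths) - dys (t0 + s * ths))).
    rewrite normrZ normrN; apply: (@le_trans _ _ (tau * `|ths ^+ 2| * k)).
      apply: ler_pM; [exact: normr_ge0|exact: normr_ge0|exact: scaled_bound|].
      exact: ltW B.
    rewrite ger0_norm ?exprn_ge0 ?(ltW ths_gt0)// /k mulrC mulrVK//.
    by rewrite unitfE lt0r_neq0// mulr_gt0// exprn_gt0.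
  by rewrite scalerBr.
- by rewrite /= subrr normr0 ltW.
Qed.

(* Histories of [x2] run through at the period of [x1]. *)
Let mixed (t : R) (x1 x2 : triple) : hist := (fun s => yof x2 (t + s / Tof x1), pof x2).

Let mixed_smooth l t x1 x2 : smooth l (yof x2) -> SH l (mixed t x1 x2).
Proof. by move=> xl; have [] := @state_smooth l t (tri (yof x2) (Tof x1) (pof x2)) xl. Qed.

(** Extended by its limit to equal periods, so that [mixedE] holds without a case distinction. *)
Let period_quotient (t : R) (x1 x2 : triple) : hist :=
  if Tof x1 == Tof x2 then period_derivative t
  else (Tof x1 - Tof x2)^-1 *: (mixed t x1 x2 - state t x2).

(** The last entry is the position on the segment between the two states. *)
Let pairQ (t0 d : R) (p : R * triple * triple * R) : Prop :=
  [/\ nearQ t0 d (p.1.1.1, p.1.1.2), nearQ t0 d (p.1.1.1, p.1.2) & 0 <= p.2 <= 1].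

Let pairQ_mono t0 (d d' : R) p : d <= d' -> pairQ t0 d p -> pairQ t0 d' p.
Proof.
move=> dd [p1 p2 p3].
by split; [exact: nearQ_mono dd p1|exact: nearQ_mono dd p2|exact: p3].
Qed.

Let period_quotient_smooth t x1 x2 : smooth 1 (yof x2) -> SH 0 (period_quotient t x1 x2).
Proof.
move=> x2s; rewrite /period_quotient; case: ifP => _; first exact: period_derivative_smooth.
apply: smooth_histZ; apply: smooth_histB.
  exact: smooth_histW (leqnSn 0) (mixed_smooth t x1 x2s).
exact: smooth_histW (leqnSn 0) (state_smooth t x2s).1.
Qed.

Let mixedE t x1 x2 : smooth 1 (yof x2) ->
  mixed t x1 x2 - state t x2 = (Tof x1 - Tof x2) *: period_quotient t x1 x2.
Proof.
move=> x2s; rewrite /period_quotient; case: eqVneq => [E|T12].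
  by rewrite E subrr scale0r /mixed E subrr.
by rewrite scalerA divff ?scale1r// subr_eq0.
Qed.

(** Near [xs] the derivative of [yof x2] is close to [dys], so the mean value inequality determines
    the increment between the two sampling points. A C^1 version would require second derivatives;
    C^0 is what [X 1] admits in its second argument. *)
Let period_quotient_tends t0 : tendsH (pairQ t0) tau 0
  (fun p => period_quotient p.1.1.1 p.1.1.2 p.1.2) (period_derivative t0).
Proof.
split; first exact: period_derivative_smooth.
  by exists 1; [exact: ltr01|move=> p [_ [_ ps _ _ _] _]; exact: period_quotient_smooth].
move=> e e0.
have [_ _ /(_ e e0)[d1 d10 H1]] := period_derivative_tends t0.
have [M M0 HM] := continuous_bounded (t0 - tau * ths) t0 dys_continuous.
(* [k] and, below, [k3] are chosen so that each of the two contributions [C1] and [C2] is at most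
   [e / 2]. *)
pose k := e / (16 * (tau * ths ^+ 2)).
have tt0 : 0 < tau * ths ^+ 2 by rewrite mulr_gt0// exprn_gt0.
have k0 : 0 < k by rewrite divr_gt0// mulr_gt0.
have [d2 d20 H2] := moving_point t0 dys_continuous k0.
have t1 : 0 < 1 + 4 * tau by rewrite ltr_wpDl// mulr_gt0.
pose k3 := e / (6 * (tau * ths * M)).
have ttM : 0 < tau * ths * M by rewrite !mulr_gt0.
have k30 : 0 < k3 by rewrite divr_gt0// mulr_gt0.
pose d := Num.min (Num.min d1 (d2 / (1 + 4 * tau))) (Num.min k (Num.min ths k3)).
have d0 : 0 < d by rewrite !lt_min d10 k0 ths_gt0 k30 !divr_gt0.
exists d => // -[[[t x1] x2] r] [/= [td x1s _ x1t x1p] [_ x2s [_ x24] x2t x2p] _].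
have dd1 : d <= d1 by rewrite !ge_min lexx.
have dd2 : d * (1 + 4 * tau) <= d2.
  by rewrite -ler_pdivlMr// !ge_min lexx !orbT.
have dk : d <= k by rewrite !ge_min lexx !orbT.
have dth : d <= ths by rewrite !ge_min lexx !orbT.
have dk3 : d <= k3 by rewrite !ge_min lexx !orbT.
have sm := smooth_histB (period_quotient_smooth t x1 x2s) (period_derivative_smooth t0).
rewrite /period_quotient in sm *; move: sm; case: eqVneq => [_ _|T12 sm].
  by apply: H1; exact: lt_le_trans dd1.
apply: hist_norm0_le; [exact: sm| |by rewrite /= subrr scaler0 subrr normr0 ltW].
move=> s sI.
set th1 := (Tof x1)^-1 in x1t; set th2 := (Tof x2)^-1 in x2t.
pose w := dys (t0 + s * ths); pose h := s * (th1 - th2).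
have th10 : 0 < th1 by rewrite invr_gt0.
have th20 : 0 < th2 by rewrite invr_gt0.
have th1u : th1 <= 2 * ths by exact: le_double x1t dth.
have th2u : th2 <= 2 * ths by exact: le_double x2t dth.
have hb : `|h| <= tau * (2 * d).
  apply: (le_trans (scaled_bound _ sI)); apply: ler_wpM2l; first exact: ltW.
  have -> : th1 - th2 = (th1 - ths) + (ths - th2) by ring.
  have x2t' : `|ths - th2| < d by rewrite distrC.
  apply: (le_trans (ler_normD _ _)); apply: (le_trans (lerD (ltW x1t) (ltW x2t'))).
  by rewrite mulr_natl mulr2n.
have x2D q : hasD (yof x2) q (derive1 (yof x2) q).
  exact: (@smooth_hasD _ _ 1 (yof x2) 0 _ x2s isT).
have near q : `|q - (t + s * th2)| <= `|h| -> `|derive1 (yof x2) q - w| <= 2 * k.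
  move=> qh; have B1 : `|derive1 (yof x2) q - dys q| <= d.
    by apply: (lipschitz_hasD x24); exact: hasDB (x2D q) (ys_hasD q).
  have P := point_bound td x2t sI.
  have B2 : `|dys q - w| < k.
    apply: H2 => //; apply: lt_le_trans dd2.
    rewrite -[q](subrK (t + s * th2)) -addrA.
    apply: (le_lt_trans (ler_normD _ _)); apply: (@lt_le_trans _ _ (tau * (2 * d) + (d + tau * d))).
      by apply: ler_ltD P; exact: le_trans qh hb.
    rewrite (_ : _ + _ = d * (1 + 3 * tau)); last by ring.
    by rewrite (ler_pM2l d0) lerD2l (ler_pM2r tau_gt0) ler_nat.
  rewrite -[derive1 (yof x2) q](subrK (dys q)) -addrA.
  by apply: (norm_le2 (le_trans B1 dk) (ltW B2)); rewrite mulr_natl mulr2n.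
have := @hasD_increment_bound_abs R _ (fun q => yof x2 q - q *: w)
  (fun q => derive1 (yof x2) q - w) (t + s * th2) h (2 * k) near
  (fun q => hasDB (x2D q) (hasD_id_scale w q)).
have -> : t + s * th2 + h = t + s * th1 by rewrite /h; ring.
set Y1 := yof x2 (t + s * th1); set Y2 := yof x2 (t + s * th2) => B.
have T1n : Tof x1 != 0 by rewrite lt0r_neq0.
have T2n : Tof x2 != 0 by rewrite lt0r_neq0.
have T12' : Tof x1 - Tof x2 != 0 by rewrite subr_eq0.
have Eth : th1 - th2 = - (Tof x1 - Tof x2) * (th1 * th2).
  by rewrite /th1 /th2; field; rewrite T1n T2n.
(* The mean value remainder for the slope [w], plus the discrepancy between [- (th1 * th2)], the
   difference quotient of the reciprocal, and its limit [- ths ^+ 2]. *)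
rewrite [X in `|X|](_ : _ =
  (Tof x1 - Tof x2)^-1 *: (Y1 - (t + s * th1) *: w - (Y2 - (t + s * th2) *: w)) +
  (s * (ths ^+ 2 - th1 * th2)) *: w); last first.
  transitivity ((Tof x1 - Tof x2)^-1 *: (Y1 - Y2) - - (s * ths ^+ 2) *: w); first by [].
  by apply/rowP => j; rewrite !mxE /th1 /th2; field; rewrite T12' T1n T2n.
have s0 : `|s| <= tau by have := scaled_bound 1 sI; rewrite !mulr1 normr1 mulr1.
have C1 : `|(Tof x1 - Tof x2)^-1 *: (Y1 - (t + s * th1) *: w - (Y2 - (t + s * th2) *: w))|
    <= e / 2.
  rewrite normrZ; apply: (le_trans (ler_wpM2l (normr_ge0 _) B)).
  have -> : h = s * (- (Tof x1 - Tof x2) * (th1 * th2)) by rewrite /h Eth.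
  rewrite !normrM normrN normfV (gtr0_norm th10) (gtr0_norm th20).
  set Z := `|Tof x1 - Tof x2|; have Z0 : Z != 0 by rewrite normr_eq0.
  have -> : Z^-1 * (2 * k * (`|s| * (Z * (th1 * th2)))) = 2 * k * (`|s| * (th1 * th2)).
    by field.
  apply: (@le_trans _ _ (2 * k * (tau * (2 * ths * (2 * ths))))).
    apply: ler_wpM2l; first by rewrite mulr_ge0// ltW.
    apply: ler_pM; [exact: normr_ge0|exact: mulr_ge0 (ltW th10) (ltW th20)|exact: s0|].
    by apply: ler_pM; [exact: ltW th10|exact: ltW th20|exact: th1u|exact: th2u].
  rewrite (_ : _ * _ = e / 2) //.
  by rewrite /k; field; rewrite !lt0r_neq0.
have C2 : `|(s * (ths ^+ 2 - th1 * th2)) *: w| <= e / 2.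
  have Bw : `|w| <= M.
    case/andP: sI => s1 s2; apply: HM; apply/andP; split.
      by rewrite lerD2l -mulNr ler_pM2r.
    by rewrite gerDl mulr_le0_ge0// ltW.
  rewrite normrZ normrM.
  have B3 : `|ths ^+ 2 - th1 * th2| <= 3 * (ths * k3).
    have -> : ths ^+ 2 - th1 * th2 = ths * (ths - th1) + th1 * (ths - th2) by ring.
    apply: (le_trans (ler_normD _ _)); rewrite !normrM (gtr0_norm ths_gt0) (gtr0_norm th10).
    rewrite !(distrC ths).
    have -> : 3 * (ths * k3) = ths * k3 + 2 * ths * k3 by ring.
    apply: lerD.
      by apply: ler_wpM2l; [exact: ltW|exact: le_trans (ltW x1t) dk3].
    apply: ler_pM; [exact: ltW th10|exact: normr_ge0|exact: th1u|].
    exact: le_trans (ltW x2t) dk3.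
  apply: (@le_trans _ _ (tau * (3 * (ths * k3)) * M)).
    apply: ler_pM; [exact: mulr_ge0|exact: normr_ge0| |exact: Bw].
    by apply: ler_pM; [exact: normr_ge0|exact: normr_ge0|exact: s0|exact: B3].
  rewrite (_ : _ * _ = e / 2) //.
  by rewrite /k3; field; rewrite !lt0r_neq0.
by apply: (norm_le2 C1 C2); rewrite -splitr.
Qed.

Let segment_state (p : R * triple * triple * R) : hist :=
  state p.1.1.1 p.1.2 + p.2 *: (state p.1.1.1 p.1.1.2 - state p.1.1.1 p.1.2).

Let segment_tends t0 : tendsH (pairQ t0) tau 1 segment_state (state t0 xs).
Proof.
have T1 : tendsH (pairQ t0) tau 1 (fun p => state p.1.1.1 p.1.1.2) (state t0 xs).
  apply: (tendsH_comp (g := fun p : R * triple * triple * R => (p.1.1.1,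
    p.1.1.2)) _ (state_tends t0)).
  by move=> d d0; exists d; [exact: d0|move=> p []].
have T2 : tendsH (pairQ t0) tau 1 (fun p => state p.1.1.1 p.1.2) (state t0 xs).
  apply: (tendsH_comp (g := fun p : R * triple * triple * R => (p.1.1.1,
    p.1.2)) _ (state_tends t0)).
  by move=> d d0; exists d; [exact: d0|move=> p []].
rewrite -[X in tendsH _ _ _ _ X]addr0; apply: (tendsH_D (@pairQ_mono t0) tau_gt0 T2).
have T3 := tendsH_D (@pairQ_mono t0) tau_gt0 T1 (tendsH_Z (@pairQ_mono t0) tau_gt0 (-1) T2).
rewrite scaleN1r subrr in T3.
have c1 : exists2 d : R, 0 < d & forall p, pairQ t0 d p -> `|p.2| <= 1.
  by exists 1; [exact: ltr01|move=> p [_ _ /andP[p0 p1]]; rewrite ger0_norm].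
have := tendsH_null (@pairQ_mono t0) tau_gt0 c1 T3.
set x := fun p => _; set y := fun p => _; suff -> : x = y by [].
by apply/funext => p; rewrite /x /y scaleN1r.
Qed.

Lemma linear_state_smooth t d : continuous (yof d) -> SH 0 (linear_state t d).
Proof.
move=> dc; apply: smooth_histD; last exact: smooth_histZ (period_derivative_smooth t).
exact: (@state_smooth 0 t (tri (yof d) Ts (pof d)) (smooth0 dc)).1.
Qed.

Let X1_bounded t0 : exists C : R, 0 < C /\ exists2 d : R, 0 < d & forall t, `|t - t0| < d ->
  forall v, SH 0 v -> `|X 1%N (state t xs, v)| <= C * N 0 v.
Proof.
have S0 t := (state_smooth t ys_smooth).1.
have [C [d [C0 d0 H]]] := extension_bounded tau_gt0 DX lmax_ge1 (S0 t0).
exists C; split=> //.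
have [_ _ T] := state_tends t0; have [d1 d10 H1] := T _ (divr_gt0 d0 (ltr0Sn R 1)).
exists d1 => // t td v vs; apply: H; [exact: S0| |exact: vs].
apply: (@le_lt_trans _ _ (d / 2)); last by rewrite ltr_pdivrMr// ltr_pMr// ltr1n.
apply: (H1 (t, xs)); split; rewrite /= ?subrr ?normr0//.
by apply: small01_0; exact: ltW.
Qed.

(** The difference of the states splits at [mixed]. The part with common period is of size [c] in
    C^1, so operator-norm continuity lets the base point move. The other part is [Tof x1 - Tof x2]
    times a quotient convergent in C^0, for which joint continuity of the extension suffices. *)
Let close_derivative t0 e : 0 < e -> exists2 d : R, 0 < d &
  forall t x1 x2 r c, pairQ t0 d (t, x1, x2, r) -> small01 c (x1 - x2) ->
  `|X 1%N (segment_state (t, x1, x2, r), state t x1 - state t x2) -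
    X 1%N (state t xs, linear_state t (x1 - x2))| <= e * c.
Proof.
move=> e0.
have S0 t := (state_smooth t ys_smooth).1.
pose e1 := e / (8 * (1 + 2 * ths)).
have th1 : 0 < 1 + 2 * ths by rewrite ltr_wpDl// mulr_gt0.
have e10 : 0 < e1 by rewrite divr_gt0// mulr_gt0.
have [d1 d10 H1] := extension_operator_continuous DX lmax_ge1 (S0 t0) e10.
have [C [C0 [d2 d20 H2]]] := X1_bounded t0.
have [_ _ /(_ _ (divr_gt0 d10 (ltr0Sn R 1)))[d3 d30 H3]] := segment_tends t0.
have Txs : tendsH (pairQ t0) tau 1 (fun p => state p.1.1.1 xs) (state t0 xs).
  apply: (tendsH_comp (Q := nearQ t0) (g := fun p : R * triple * triple * R => (p.1.1.1,
    xs)) _ (state_tends t0)).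
  move=> d d0; exists d; [exact: d0|move=> p [[p1 _ _ _ _] _ _]].
  split; rewrite /= ?subrr ?normr0//.
  by apply: small01_0; exact: ltW.
have [_ _ /(_ _ (divr_gt0 d10 (ltr0Sn R 1)))[d4 d40 H4]] := Txs.
have Tper : tendsH (pairQ t0) tau 0 (fun p => period_derivative p.1.1.1) (period_derivative t0).
  apply: (tendsH_comp (Q := fun d t => `|t - t0| < d) (g := fun p : R * triple * triple * R =>
    p.1.1.1) _ (period_derivative_tends t0)).
  by move=> d d0; exists d; [exact: d0|move=> p [[p1 _ _ _ _] _ _]].
have TXa := tends_X1 DX lmax_ge1 (@pairQ_mono t0) (segment_tends t0) (period_quotient_tends t0).
have TXb := tends_X1 DX lmax_ge1 (@pairQ_mono t0) Txs Tper.
have e8 : 0 < e / 8 by rewrite divr_gt0.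
have [d5 d50 H5] := TXa _ e8; have [d6 d60 H6] := TXb _ e8.
pose k := e / (4 * (C * tau)).
have k0 : 0 < k by rewrite divr_gt0// !mulr_gt0.
pose d := Num.min (Num.min (Num.min d2 d3) (Num.min d4 d5)) (Num.min (Num.min d6 k) ths).
have d0 : 0 < d by rewrite !lt_min d20 d30 d40 d50 d60 k0 ths_gt0.
exists d => // t x1 x2 r c Q sc.
have c0 := small0_ge0 sc.1.
have Qd d' : d <= d' -> pairQ t0 d' (t, x1, x2, r) by move=> dd; exact: pairQ_mono dd Q.
have {}H3 := H3 _ (Qd d3 ltac:(by rewrite !ge_min lexx ?orbT)).
have {}H4 := H4 _ (Qd d4 ltac:(by rewrite !ge_min lexx ?orbT)).
have {}H5 := H5 _ (Qd d5 ltac:(by rewrite !ge_min lexx ?orbT)).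
have {}H6 := H6 _ (Qd d6 ltac:(by rewrite !ge_min lexx ?orbT)).
have dk : d <= k by rewrite !ge_min lexx !orbT.
have dth : d <= ths by rewrite !ge_min lexx !orbT.
have dd2 : d <= d2 by rewrite !ge_min lexx.
rewrite /= in H3 H4 H5 H6.
case: Q => [[/= td x1s _ x1t x1p] [_ x2s _ x2t x2p] rI].
set w := segment_state _ in H3 H5 *.
have ws : SH 1 w.
  apply: smooth_histD (state_smooth t x2s).1 _; apply: smooth_histZ.
  exact: smooth_histB (state_smooth t x1s).1 (state_smooth t x2s).1.
have half_lt (y : R) : y <= d1 / 2 -> y < d1.
  by move=> yd; apply: (le_lt_trans yd); rewrite ltr_pdivrMr// ltr_pMr// ltr1n.
pose m := mixed t x1 x2.
have ms : SH 1 m := mixed_smooth t x1 x2s.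
have u1m : SH 1 (state t x1 - m) := smooth_histB (state_smooth t x1s).1 ms.
have SW z : SH 1 z -> SH 0 z := smooth_histW (leq0n 1).
have qs := period_quotient_smooth t x1 x2s.
have bs := period_derivative_smooth t.
pose dx := x1 - x2.
pose v : hist := state t (tri (yof dx) Ts (pof dx)).
have dxc : continuous (yof dx).
  by have := smooth_continuous (smooth_linear (-1) x2s x1s).1 (leq0n 1); rewrite scaleN1r addrC.
have vs : SH 0 v by exact: (@state_smooth 0 t (tri (yof dx) Ts (pof dx)) (smooth0 dxc)).1.
have Ew : X 1%N (w, state t x1 - state t x2) =
    X 1%N (w, state t x1 - m) + Tof dx *: X 1%N (w, period_quotient t x1 x2).
  have -> : state t x1 - state t x2 = Tof dx *: period_quotient t x1 x2 + (state t x1 - m).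
    by rewrite -(mixedE t x1 x2s) -/m [RHS]addrC addrA subrK.
  by rewrite (extension_linear tau_gt0 DX lmax_ge1 _ ws qs (SW _ u1m)) addrC.
have El : X 1%N (state t xs, linear_state t dx) =
    X 1%N (state t xs, v) + Tof dx *: X 1%N (state t xs, period_derivative t).
  rewrite /linear_state addrC.
  by rewrite (extension_linear tau_gt0 DX lmax_ge1 _ (S0 t) bs vs) addrC.
rewrite Ew El.
(* Both histories run at the period of [x1], so the Lipschitz bound on [x1 - x2] controls the
   derivative of their difference, up to the factor [1 / Tof x1 <= 2 * ths]. *)
have N1 : N 1 (state t x1 - m) <= (1 + 2 * ths) * c.
  apply/(hist_normP tau_gt0 _ u1m).
  have Su := state_smooth t x1s; have Sm := @state_smooth 1 t (tri (yof x2) (Tof x1) (pof x2)) x2s.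
  have le1 : c <= (1 + 2 * ths) * c by rewrite ler_peMl// lerDl mulr_ge0// ltW.
  have [[sc1 _ sc3] sc4] := sc.
  split=> [j s jl sI|]; last exact: le_trans sc3 le1.
  rewrite (smooth_histB_derive Su.1 Sm.1 jl) Su.2// Sm.2//.
  case: j jl => [|[|//]] _.
    by rewrite !expr0 !scale1r; exact: le_trans (sc1 _) le1.
  have xD q : hasD (yof dx) q (derive1 (yof x1) q - derive1 (yof x2) q).
    exact: (hasDB (@smooth_hasD _ _ 1 (yof x1) 0 q x1s isT) (@smooth_hasD _ _ 1 (yof x2) 0 q x2s
      isT)).
  rewrite !expr1 -scalerBr normrZ gtr0_norm ?invr_gt0//.
  apply: ler_pM; [by rewrite invr_ge0 ltW|exact: normr_ge0| |exact: (lipschitz_hasD sc4 (xD _))].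
  by apply: (le_trans (le_double x1t dth)); rewrite lerDr.
(* Passing from the period of [x1] to [Ts] costs the Lipschitz constant [c] times the displacement
   [tau * d]. *)
have N2 : N 0 (state t x1 - m - v) <= c * (tau * d).
  have [[_ _ _] sc4] := sc.
  apply: hist_norm0_le; first exact: smooth_histB (SW _ u1m) vs.
    move=> s sI; apply: (le_trans (sc4 (t + s / Tof x1) (t + s / Ts))).
    apply: ler_wpM2l => //.
    have -> : t + s / Tof x1 - (t + s / Ts) = s * ((Tof x1)^-1 - ths) by rewrite /ths; ring.
    apply: (le_trans (scaled_bound _ sI)); apply: ler_wpM2l; [exact: ltW|exact: ltW].
  by rewrite /= subrr normr0 !mulr_ge0// ltW.
have E1 : e1 * (1 + 2 * ths) = e / 8 by rewrite /e1; field; rewrite lt0r_neq0.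
have Ek : C * tau * k = e / 4 by rewrite /k; field; rewrite !lt0r_neq0.
have E4 : e / 4 = e / 8 + e / 8 by field.
have C1 : `|X 1%N (w, state t x1 - m) - X 1%N (state t0 xs, state t x1 - m)| <= e / 8 * c.
  apply: (le_trans (H1 w ws (half_lt _ H3) _ u1m)).
  apply: (le_trans (ler_wpM2l (ltW e10) N1)).
  by rewrite mulrA E1.
have C2 : `|X 1%N (state t0 xs, state t x1 - m) - X 1%N (state t xs, state t x1 - m)| <= e / 8 * c.
  rewrite distrC; apply: (le_trans (H1 _ (S0 t) (half_lt _ H4) _ u1m)).
  apply: (le_trans (ler_wpM2l (ltW e10) N1)).
  by rewrite mulrA E1.
have C3 : `|X 1%N (state t xs, state t x1 - m) - X 1%N (state t xs, v)| <= e / 4 * c.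
  rewrite -(extensionB tau_gt0 DX lmax_ge1 (S0 t) (SW _ u1m) vs).
  apply: (le_trans (H2 t (lt_le_trans td dd2) _ (smooth_histB (SW _ u1m) vs))).
  apply: (le_trans (ler_wpM2l (ltW C0) N2)).
  have -> : C * (c * (tau * d)) = (C * tau * d) * c by ring.
  apply: ler_wpM2r => //; apply: (@le_trans _ _ (C * tau * k)).
    by apply: ler_wpM2l dk; rewrite mulr_ge0// ltW.
  by rewrite Ek.
have C4 : `|Tof dx *: (X 1%N (w, period_quotient t x1 x2) - X 1%N (state t xs,
  period_derivative t))|
    <= e / 4 * c.
  have [[_ Tc _] _] := sc.
  rewrite normrZ mulrC; apply: ler_pM; [exact: normr_ge0|exact: normr_ge0| |exact: Tc].
  pose Y := X 1%N (state t0 xs, period_derivative t0).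
  rewrite -[X 1%N (w, _)](subrK Y) -addrA; apply: (norm_le2 H5).
    by rewrite distrC; exact: H6.
  by rewrite E4.
rewrite scalerBr in C4.
set a := X 1%N (w, state t x1 - m) in C1 *; set b := X 1%N (state t0 xs, _) in C1 C2.
set g := X 1%N (state t xs, _ - m) in C2 C3; set h := X 1%N (state t xs, v) in C3 *.
have -> : a + Tof dx *: X 1%N (w, period_quotient t x1 x2) -
   (h + Tof dx *: X 1%N (state t xs, period_derivative t)) =
   (a - b) + (b - g) + (g - h) + (Tof dx *: X 1%N (w, period_quotient t x1 x2) -
      Tof dx *: X 1%N (state t xs, period_derivative t)).
  by rewrite !addrA !subrK opprD !addrA [LHS](ACl (1*3*2*4)%AC).
apply: (norm_le2 (norm_le3 C1 C2 C3 (lexx _)) C4).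
by apply: eighths_le; rewrite mulr_ge0// ltW.
Qed.

(** The increment bound along the segment from [state t x2] to [state t x1], where the derivative is
    controlled by [close_derivative]. *)
Let close_functional t0 e : 0 < e -> exists2 d : R, 0 < d &
  forall t x1 x2 c, nearQ t0 d (t, x1) -> nearQ t0 d (t, x2) -> small01 c (x1 - x2) ->
  `|G (state t x1) - G (state t x2) - X 1%N (state t xs, linear_state t (x1 - x2))| <= e * c.
Proof.
move=> e0; have [d d0 H] := close_derivative t0 e0.
exists d => // t x1 x2 c Q1 Q2 sc.
case: (Q1) (Q2) => [_ x1s _ _ _] [_ x2s _ _ _].
have u1s := (state_smooth t x1s).1; have u2s := (state_smooth t x2s).1.
pose L := X 1%N (state t xs, linear_state t (x1 - x2)).
set u1 := state t x1 in u1s *; set u2 := state t x2 in u2s *.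
have Df s : hasD (fun s : R => G (u2 + s *: (u1 - u2)) - s *: L) s
    (X 1%N (u2 + s *: (u1 - u2), u1 - u2) - L).
  apply: hasDB; last exact: hasD_id_scale.
  exact: (functional_hasD tau_gt0 DX lmax_ge1 s u2s (smooth_histB u1s u2s)).
have Cf : continuous (fun s : R => G (u2 + s *: (u1 - u2)) - s *: L).
  by apply: hasD_continuous => s; eexists; exact: Df.
have Bf s : 0 <= s < 1 -> hasD (fun s : R => G (u2 + s *: (u1 - u2)) - s *: L) s
    (X 1%N (u2 + s *: (u1 - u2), u1 - u2) - L) /\
    `|X 1%N (u2 + s *: (u1 - u2), u1 - u2) - L| <= e * c.
  move=> /andP[s0 s1]; split; first exact: Df.
  by apply: (H t x1 x2 s c) sc; split; [exact: Q1|exact: Q2|rewrite s0 ltW].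
have := hasD_increment_bound ler01 Cf Bf.
by rewrite !scale1r !scale0r addr0 !subr0 mulr1 (addrC u2) subrK addrAC.
Qed.

Let linear_state_bound t0 : exists K : R, 0 < K /\ exists2 d : R, 0 < d & forall t, `|t - t0| < d ->
  forall dx c, continuous (yof dx) -> small0 c dx ->
  `|X 1%N (state t xs, linear_state t dx)| <= K * c /\
  `|Tof dx *: G (state t xs)| <= K * c.
Proof.
have [C [C0 [d1 d10 H1]]] := X1_bounded t0.
have [_ _ /(_ _ ltr01)[d2 d20 H2]] := period_derivative_tends t0.
have bs := period_derivative_smooth.
have Gt : tends (nearQ t0) (fun p => G (state p.1 p.2)) (G (state t0 xs)).
  exact: (tends_functional DX (@nearQ_mono t0) (tendsH_W (@nearQ_mono t0) tau_gt0 (leq0n 1)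
    (state_tends t0))).
have [d3 d30 H3] := Gt _ ltr01.
pose M := N 0 (period_derivative t0) + 1.
have M0 : 0 <= M by rewrite addr_ge0// (hist_norm_ge0 tau_gt0 (bs t0)).
pose g := `|G (state t0 xs)| + 1.
have g0 : 0 <= g by rewrite addr_ge0.
pose K := C * (1 + M) + g + 1.
have K0 : 0 < K by rewrite ltr_wpDl// addr_ge0// mulr_ge0 ?(ltW C0)// addr_ge0.
exists K; split=> //; exists (Num.min d1 (Num.min d2 d3)) => [|t]; first by rewrite !lt_min d10 d20.
rewrite !lt_min => /and3P[t1 t2 t3] dx c dc sc.
have c0 := small0_ge0 sc; case: sc => sc1 sc2 sc3.
split; last first.
  rewrite normrZ mulrC; apply: ler_pM => //.
  have := H3 (t, xs); rewrite /= => /(_ _)-H.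
  have {}H : `|G (state t xs) - G (state t0 xs)| <= 1.
    by apply: H; split; rewrite /= ?subrr ?normr0//; apply: small01_0; exact: ltW.
  rewrite -[G (state t xs)](subrK (G (state t0 xs))); apply: (norm_le2 H (lexx _)).
  rewrite addrC -/g /K (addrC (C * _)) -addrA lerDl.
  by rewrite addr_ge0// mulr_ge0 ?(ltW C0)// addr_ge0.
apply: (le_trans (H1 t t1 _ (linear_state_smooth t dc))).
have Nb : N 0 (period_derivative t) <= M.
  rewrite -[period_derivative t](subrK (period_derivative t0)) /M addrC.
  apply: (le_trans (hist_normD tau_gt0 (bs t0) (smooth_histB (bs t) (bs t0)))).
  by rewrite lerD2l; exact: H2.
have vs : SH 0 ((fun s => yof dx (t + s / Ts), pof dx) : hist).
  exact: (@state_smooth 0 t (tri (yof dx) Ts (pof dx)) (smooth0 dc)).1.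
have Nl : N 0 (linear_state t dx) <= c * (1 + M).
  apply: (le_trans (hist_normD tau_gt0 vs (smooth_histZ _ (bs t)))).
  rewrite mulrDr mulr1; apply: lerD; first by apply: hist_norm0_le => // s _; exact: sc1.
  apply: (le_trans (hist_normZ tau_gt0 _ (bs t))).
  by apply: ler_pM => //; exact: (hist_norm_ge0 tau_gt0 (bs t)).
apply: (le_trans (ler_wpM2l (ltW C0) Nl)).
rewrite mulrCA mulrC; apply: ler_wpM2r => //.
by rewrite /K -addrA lerDl addr_ge0.
Qed.

Definition rhs (t : R) (x : triple) : 'rV[R]_n := Tof x *: G (state t x).

Let rhs_local t0 e : 0 < e -> exists2 d : R, 0 < d &
  forall t x1 x2 c, nearQ t0 d (t, x1) -> nearQ t0 d (t, x2) -> small01 c (x1 - x2) ->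
  `|rhs t x1 - rhs t x2 - linop t (x1 - x2)| <= e * c.
Proof.
move=> e0; pose e1 := e / (4 * Ts).
have e10 : 0 < e1 by rewrite divr_gt0// mulr_gt0.
have [d1 d10 H1] := close_functional t0 e10.
have [K [K0 [d2 d20 H2]]] := linear_state_bound t0.
have Gt : tends (nearQ t0) (fun p => G (state p.1 p.2)) (G (state t0 xs)).
  exact: (tends_functional DX (@nearQ_mono t0) (tendsH_W (@nearQ_mono t0) tau_gt0 (leq0n 1)
    (state_tends t0))).
have e8 : 0 < e / 8 by rewrite divr_gt0.
have [d3 d30 H3] := Gt _ e8.
pose k := e / (4 * (e1 + K)).
have eK : 0 < e1 + K by rewrite addr_gt0.
have k0 : 0 < k by rewrite divr_gt0// mulr_gt0.
pose d := Num.min (Num.min d1 d2) (Num.min d3 k).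
have d0 : 0 < d by rewrite !lt_min d10 d20 d30.
exists d => // t x1 x2 c Q1 Q2 sc; have c0 := small0_ge0 sc.1.
have dd1 : d <= d1 by rewrite !ge_min lexx.
have dd2 : d <= d2 by rewrite !ge_min lexx orbT.
have dd3 : d <= d3 by rewrite !ge_min lexx orbT.
have dk : d <= k by rewrite !ge_min lexx !orbT.
have B1 := H1 t x1 x2 c (nearQ_mono dd1 Q1) (nearQ_mono dd1 Q2) sc.
have {}H3 x : nearQ t0 d (t, x) -> `|G (state t x) - G (state t0 xs)| <= e / 8.
  by move=> Q; apply: (H3 (t, x)); exact: nearQ_mono dd3 Q.
case: (Q1) (Q2) => [/= td x1s _ _ _] [_ x2s [[_ T2 _] _] _ _].
have Qs : nearQ t0 d (t, xs).
  by split; rewrite /= ?subrr ?normr0//; apply: small01_0; exact: ltW.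
have B2 := H3 _ Q1; have B3 := H3 _ Qs.
have dxc : continuous (yof (x1 - x2)).
  by have := smooth_continuous (smooth_linear (-1) x2s x1s).1 (leq0n 1); rewrite scaleN1r addrC.
have [B4 _] := H2 t (lt_le_trans td dd2) _ c dxc sc.1.
case: (sc) => [[_ Tc _] _].
rewrite /rhs /linop.
set L := X 1%N _ in B1 B4 *; set g1 := G (state t x1) in B1 B2 *.
set g2 := G (state t x2) in B1 *; set g := G (state t xs) in B3 *.
have C1 : `|(Tof x1 - Tof x2) *: (g1 - g)| <= e / 4 * c.
  rewrite normrZ mulrC; apply: ler_pM; [exact: normr_ge0|exact: normr_ge0| |exact: Tc].
  rewrite -[g1](subrK (G (state t0 xs))) -addrA; apply: (norm_le2 B2).
    by rewrite distrC; exact: B3.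
  by rewrite (_ : e / 4 = e / 8 + e / 8)//; field.
have C2 : `|(Tof x2 - Ts) *: (g1 - g2)| <= e / 4 * c.
  have B5 : `|g1 - g2| <= (e1 + K) * c.
    by rewrite -[g1 - g2](subrK L) mulrDl; exact: norm_le2 B1 B4 (lexx _).
  have Ek : e / 4 = k * (e1 + K) by rewrite /k; field; rewrite lt0r_neq0.
  rewrite normrZ Ek -mulrA; apply: ler_pM; [exact: normr_ge0|exact: normr_ge0| |exact: B5].
  exact: le_trans T2 dk.
have C3 : `|Ts *: (g1 - g2 - L)| <= e / 4 * c.
  rewrite normrZ (gtr0_norm Ts_gt0).
  have -> : e / 4 * c = Ts * (e1 * c) by rewrite /e1; field; rewrite lt0r_neq0.
  by apply: ler_wpM2l B1; exact: ltW.
have -> : Tof x1 *: g1 - Tof x2 *: g2 - (Tof (x1 - x2) *: g + Ts *: L) =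
   (Tof x1 - Tof x2) *: (g1 - g) + (Tof x2 - Ts) *: (g1 - g2) + Ts *: (g1 - g2 - L).
  have -> : Tof (x1 - x2) = Tof x1 - Tof x2 by [].
  by apply/rowP => j; rewrite !mxE; ring.
apply: (norm_le3 C1 C2 C3); have ec := mulr_ge0 (ltW e0) c0.
have -> : e / 4 * c + e / 4 * c + e / 4 * c = e * c * (3 / 4) by field.
by rewrite ler_piMr// ler_pdivrMr// mul1r ler_nat.
Qed.


Let dys_periodic t : dys (t + 1) = dys t.
Proof.
have := @hasD_affine R _ ys t (dys (1 + 1 * t)) 1 1 (ys_hasD _).
rewrite scale1r mul1r addrC => H.
by apply: (hasD_unique _ (ys_hasD t)); apply: hasD_ext H => s; rewrite mul1r addrC; exact:
  ys_periodic.
Qed.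

Lemma state_periodic t x : one_periodic (yof x) -> state (t + 1) x = state t x.
Proof.
move=> xp; congr pair; apply/funext => s.
by rewrite (_ : t + 1 + s / Tof x = t + s / Tof x + 1) ?xp//; ring.
Qed.

Lemma rhs_periodic t x : one_periodic (yof x) -> rhs (t + 1) x = rhs t x.
Proof. by move=> xp; rewrite /rhs state_periodic. Qed.

Lemma linop_periodic t d : one_periodic (yof d) -> linop (t + 1) d = linop t d.
Proof.
move=> dp; rewrite /linop (state_periodic t ys_periodic).
have E (r : R) : t + 1 + r = t + r + 1 by ring.
have E1 : (fun s => yof d (t + 1 + s / Ts)) = (fun s => yof d (t + s / Ts)).
  by apply/funext => s; rewrite E dp.
have E2 : (fun s => - (s * ths ^+ 2) *: dys (t + 1 + s / Ts)) =
    (fun s => - (s * ths ^+ 2) *: dys (t + s / Ts)).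
  by apply/funext => s; rewrite E dys_periodic.
have E2' : period_derivative (t + 1) = period_derivative t.
  exact: (congr1 (fun f => (f, 0) : hist) E2).
have E3 : linear_state (t + 1) d = linear_state t d.
  exact: (congr2 (fun f h => ((f, pof d) : hist) + Tof d *: h) E1 E2').
by rewrite E3.
Qed.

Lemma linear_state_linear t (a : R) x y :
  linear_state t (a *: x + y) = a *: linear_state t x + linear_state t y.
Proof.
rewrite /linear_state.
have -> : ((fun s => yof (a *: x + y) (t + s / Ts), pof (a *: x + y)) : hist) =
  a *: ((fun s => yof x (t + s / Ts), pof x) : hist) +
  ((fun s => yof y (t + s / Ts), pof y) : hist) by [].
have -> : Tof (a *: x + y) = a * Tof x + Tof y by [].
by rewrite scalerDl scalerDr -scalerA addrACA.
Qed.

Lemma linop_linear t (a : R) x y : continuous (yof x) -> continuous (yof y) ->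
  linop t (a *: x + y) = a *: linop t x + linop t y.
Proof.
move=> xc yc; rewrite /linop linear_state_linear.
rewrite (extension_linear tau_gt0 DX lmax_ge1 a (state_smooth t ys_smooth).1
  (linear_state_smooth t xc) (linear_state_smooth t yc)).
have -> : Tof (a *: x + y) = a * Tof x + Tof y by [].
by apply/rowP => j; rewrite !mxE; ring.
Qed.

Lemma linopB t x y : continuous (yof x) -> continuous (yof y) ->
  linop t (x - y) = linop t x - linop t y.
Proof.
move=> xc yc; have := linop_linear t (-1) yc xc.
by rewrite scaleN1r addrC => ->; rewrite scaleN1r addrC.
Qed.

(** Local constants are made uniform by compactness, with [d^-1] as bound, and extended to all times
    by periodicity. *)
Lemma linop_bounded : exists K : R, 0 < K /\ forall t dx c,
  continuous (yof dx) -> one_periodic (yof dx) -> small0 c dx -> `|linop t dx| <= K * c.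
Proof.
have := @segment_uniform R (fun d t => 0 < d -> forall dx c, continuous (yof dx) ->
  small0 c dx -> `|linop t dx| <= d^-1 * c) 0 1.
case=> [d d' t dd H d'0 dx c dc sc|t _|d d0 H].
- have d0 := lt_le_trans d'0 dd; apply: (le_trans (H d0 dx c dc sc)).
  by apply: ler_wpM2r; [exact: small0_ge0 sc|rewrite lef_pV2].
- have [K [K0 [d d0 H]]] := linear_state_bound t.
  pose K' := K + Ts * K; have K'0 : 0 < K' by rewrite addr_gt0// mulr_gt0.
  exists (Num.min d K'^-1) => [|s]; first by rewrite lt_min d0 invr_gt0.
  rewrite lt_min => /andP[sd _] m0 dx c dc sc; have [H1 H2] := H s sd dx c dc sc.
  have c0 := small0_ge0 sc.
  apply: (@le_trans _ _ (K' * c)); last first.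
    apply: ler_wpM2r => //; rewrite -[leLHS]invrK lef_pV2 ?posrE ?invr_gt0//.
    by rewrite ge_min lexx orbT.
  rewrite mulrDl; apply: (norm_le2 H2 (b := Ts * K * c)) => //.
  by rewrite normrZ (gtr0_norm Ts_gt0) -mulrA; apply: ler_wpM2l; [exact: ltW|].
- exists d^-1; split=> [|t dx c dc dp sc]; first by rewrite invr_gt0.
  have [t' /andP[t0 t1] red] := periodic_reduce t.
  rewrite (red _ (fun r => linop r dx)); last by move=> r; exact: linop_periodic.
  by apply: H => //; rewrite t0 ltW.
Qed.

Lemma linop_continuous dx : continuous (yof dx) -> continuous (fun t : R => linop t dx).
Proof.
move=> dc; apply/continuousP_eps => t0 e e0.
pose Q (d t : R) := `|t - t0| < d.
have Qm (d d' t : R) : d <= d' -> Q d t -> Q d' t by move=> dd; move/lt_le_trans; exact.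
have Ts1 : tendsH Q tau 1 (fun t => state t xs) (state t0 xs).
  apply: (tendsH_comp (Q := nearQ t0) (g := fun t : R => (t, xs)) _ (state_tends t0)).
  move=> d d0; exists d; [exact: d0|move=> t td].
  by split; rewrite /= ?subrr ?normr0//; apply: small01_0; exact: ltW.
have Tv : tendsH Q tau 0 (fun t => ((fun s => yof dx (t + s / Ts), pof dx) : hist))
    ((fun s => yof dx (t0 + s / Ts), pof dx) : hist).
  have S t := (@state_smooth 0 t (tri (yof dx) Ts (pof dx)) (smooth0 dc)).1.
  split; [exact: S|by exists 1; [exact: ltr01|move=> t _; exact: S]|].
  move=> h h0; have [d d0 H] := moving_point t0 dc h0.
  exists d => // t td; apply: hist_norm0_le; first exact: smooth_histB (S t) (S t0).
    move=> s sI; apply/ltW/H => //.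
    by rewrite opprD addrACA subrr addr0.
  by rewrite /= subrr normr0 ltW.
have Tl : tendsH Q tau 0 (fun t => linear_state t dx) (linear_state t0 dx).
  exact: (tendsH_D Qm tau_gt0 Tv (tendsH_Z Qm tau_gt0 (Tof dx) (period_derivative_tends t0))).
have T1 := tends_X1 DX lmax_ge1 Qm Ts1 Tl.
have T2 := tends_functional DX Qm (tendsH_W Qm tau_gt0 (leq0n 1) Ts1).
have [d d0 H] := tendsD Qm (tendsZ (Tof dx) T2) (tendsZ Ts T1) (divr_gt0 e0 (ltr0Sn R 1)).
exists d => // s /H B; apply: (le_lt_trans B).
by rewrite ltr_pdivrMr// ltr_pMr// ltr1n.
Qed.

Lemma period_inverse_close d : 0 < d -> exists2 r : R, 0 < r & forall T : R,
  `|T - Ts| <= r -> `|T^-1 - ths| < d /\ 0 < T.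
Proof.
move=> d0; pose r := Num.min (Ts / 2) (d * Ts ^+ 2 / 4).
have r0 : 0 < r by rewrite lt_min !divr_gt0// mulr_gt0// exprn_gt0.
exists r => // T; rewrite le_min => /andP[T1 T2].
have Th : Ts / 2 <= T by move: T1; rewrite ler_norml => /andP[]; lra.
have T0 : 0 < T by apply: lt_le_trans Th; rewrite divr_gt0.
split=> //.
have -> : T^-1 - ths = (Ts - T) * (T^-1 * ths).
  by rewrite /ths; field; rewrite !lt0r_neq0.
rewrite normrM distrC (@gtr0_norm _ (T^-1 * ths)) ?mulr_gt0 ?invr_gt0//.
have Tu : T^-1 <= 2 / Ts by rewrite -[2 / Ts]invrK lef_pV2 ?posrE ?invr_gt0 ?divr_gt0// invf_div.
apply: (@le_lt_trans _ _ (d * Ts ^+ 2 / 4 * (2 / Ts * ths))).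
  apply: ler_pM => //; first by rewrite mulr_ge0// ?invr_ge0 ltW.
  by rewrite ler_pM2r.
have -> : d * Ts ^+ 2 / 4 * (2 / Ts * ths) = d / 2 by rewrite /ths; field; rewrite lt0r_neq0.
by rewrite ltr_pdivrMr// ltr_pMr// ltr1n.
Qed.

Let rhs_estimate_smooth e : 0 < e -> exists2 r : R, 0 < r & forall t x1 x2 c,
  smooth 1 (yof x1) -> smooth 1 (yof x2) -> one_periodic (yof x1) -> one_periodic (yof x2) ->
  small01 r (x1 - xs) -> small01 r (x2 - xs) -> small01 c (x1 - x2) ->
  `|rhs t x1 - rhs t x2 - linop t (x1 - x2)| <= e * c.
Proof.
move=> e0.
pose C (d : R) (x : triple) :=
  [/\ smooth 1 (yof x), small01 d (x - xs), `|(Tof x)^-1 - ths| < d & 0 < Tof x].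
have Cm d d' x : d <= d' -> C d x -> C d' x.
  move=> dd [p1 p2 p3 p4].
  by split; [exact: p1|exact: small01W dd p2|exact: lt_le_trans p3 dd|exact: p4].
have := @segment_uniform R (fun d t => forall x1 x2 c, C d x1 -> C d x2 -> small01 c (x1 - x2) ->
  `|rhs t x1 - rhs t x2 - linop t (x1 - x2)| <= e * c) 0 1.
case=> [d d' t dd H x1 x2 c C1 C2|t _|d d0 H].
- by apply: H; [exact: Cm dd C1|exact: Cm dd C2].
- have [d d0 H] := rhs_local t e0; exists d => // s sd x1 x2 c [a1 a2 a3 a4] [b1 b2 b3 b4].
  exact: (H s x1 x2 c (And5 sd a1 a2 a3 a4) (And5 sd b1 b2 b3 b4)).
- have [r r0 Hr] := period_inverse_close d0.
  exists (Num.min r d) => [|t x1 x2 c s1 s2 p1 p2 n1 n2 sc]; first by rewrite lt_min r0.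
  have [t' /andP[t0 t1] red] := periodic_reduce t.
  have dxp : one_periodic (yof (x1 - x2)).
    by move=> q; congr (_ - _); [exact: p1|exact: p2].
  rewrite (red _ (fun r => rhs r x1 - rhs r x2 - linop r (x1 - x2))); last first.
    by move=> q; rewrite (rhs_periodic q p1) (rhs_periodic q p2) (linop_periodic q dxp).
  have Cx x : smooth 1 (yof x) -> small01 (Num.min r d) (x - xs) -> C d x.
    move=> xs1 xn; have [[_ Tx _] _] := xn.
    have Txr : `|Tof x - Ts| <= r by apply: (le_trans Tx); rewrite ge_min lexx.
    have [q1 q2] := Hr (Tof x) Txr.
    have md : Num.min r d <= d by rewrite ge_min lexx orbT.
    by split; [exact: xs1|exact: small01W md xn|exact: q1|exact: q2].
  by apply: H sc; [rewrite t0 ltW|exact: Cx|exact: Cx].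
Qed.


Definition smoothing (k : R) (x : triple) : triple :=
  tri (steklov k (yof x)) (Tof x) (pof x).

(** The derivative of a mean is a difference quotient of the function, so the Lipschitz constant
    does not grow. *)
Lemma small01_smoothing k c x : 0 < k -> continuous (yof x) -> small01 c x ->
  small01 c (smoothing k x).
Proof.
move=> k0 xc [[x1 x2 x3] x4]; split.
  split; [move=> t|exact: x2|exact: x3].
  have := @steklov_near _ _ k (yof x) t 0 c xc k0 (fun s _ => _).
  by rewrite subr0; apply=> s; rewrite subr0; exact: x1.
apply: (hasD_lipschitz (fun t => steklov_hasD k t xc)) => t.
rewrite normrZ ger0_norm ?invr_ge0 ?(ltW k0)// mulrC ler_pdivrMr//.
by apply: (le_trans (x4 _ _)); rewrite (addrC t) addrK gtr0_norm.
Qed.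

Lemma smoothingB k x1 x2 : continuous (yof x1) -> continuous (yof x2) ->
  smoothing k x1 - smoothing k x2 = smoothing k (x1 - x2).
Proof.
move=> c1 c2; congr (_, _, _) => /=.
transitivity (steklov k ((-1) *: yof x2 + yof x1)).
  by rewrite (steklov_linear k (-1) c2 c1) scaleN1r addrC.
by rewrite scaleN1r addrC.
Qed.

Lemma small01D a b x1 x2 : small01 a x1 -> small01 b x2 -> small01 (a + b) (x1 + x2).
Proof.
move=> [[p1 p2 p3] p4] [[q1 q2 q3] q4]; split.
  split=> [t||]; first exact: norm_le2 (p1 t) (q1 t) (lexx _).
    exact: le_trans (ler_normD _ _) (lerD p2 q2).
  exact: norm_le2 p3 q3 (lexx _).
move=> s t; rewrite mulrDl.
change (`|(yof x1 s + yof x2 s) - (yof x1 t + yof x2 t)| <= a * `|s - t| + b * `|s - t|).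
rewrite opprD addrACA; exact: norm_le2 (p4 s t) (q4 s t) (lexx _).
Qed.

Lemma smoothing_close0 e x : continuous (yof x) -> one_periodic (yof x) -> 0 < e ->
  exists2 d : R, 0 < d & forall k, 0 < k < d -> small0 e (smoothing k x - x).
Proof.
move=> xc xp e0; have [d d0 H] := periodic_uniform xc xp e0.
exists d => // k /andP[k0 kd].
have T0 : Tof (smoothing k x - x) = 0 by exact: subrr.
have p0 : pof (smoothing k x - x) = 0 by exact: subrr.
split; [|by rewrite T0 normr0 ltW|by rewrite p0 normr0 ltW].
move=> t; apply: steklov_near => // s /andP[s1 s2]; apply/ltW/H.
by rewrite ger0_norm ?subr_ge0// ltrBlDl (lt_trans s2)// ltrD2l.
Qed.

(** For [xs], which is C^1, means converge even in C^{0,1}: the derivative of the mean is the mean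
    of the derivative. For Lipschitz functions there is convergence in C^0 only. *)
Lemma smoothing_close1 e : 0 < e ->
  exists2 d : R, 0 < d & forall k, 0 < k < d -> small01 e (smoothing k xs - xs).
Proof.
move=> e0; have [d1 d10 H1] := smoothing_close0 ys_continuous ys_periodic e0.
have [d2 d20 H2] := smoothing_close0 (x := tri dys 0 0) dys_continuous dys_periodic e0.
exists (Num.min d1 d2) => [|k]; first by rewrite lt_min d10.
rewrite lt_min => /and3P[k0 k1 k2].
split; first by apply: H1; rewrite k0.
have [B _ _] := H2 k ltac:(by rewrite k0).
apply: (hasD_lipschitz (f := fun t => steklov k ys t - ys t) (f' := fun t =>
  steklov k dys t - dys t)).
  by move=> t; apply: hasDB; [exact: steklov_derive|exact: ys_hasD].
exact: B.
Qed.

Lemma state_smoothing_tends t x : continuous (yof x) -> one_periodic (yof x) ->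
  tendsH (fun d k : R => 0 < k < d) tau 0 (fun k => state t (smoothing k x)) (state t x).
Proof.
move=> xc xp.
have S := (state_smooth t (smooth0 xc)).1.
have Sk k := (@state_smooth 0 t (smoothing k x) (smooth0 (@steklov_continuous _ _ k _ xc))).1.
split; [exact: S|by exists 1; [exact: ltr01|move=> k _; exact: Sk]|].
move=> e e0; have [d d0 H] := smoothing_close0 xc xp e0; exists d => // k kd.
have [B _ B3] := H k kd.
by apply: hist_norm0_le; [exact: smooth_histB (Sk k) S|move=> s _; exact: B|exact: B3].
Qed.

Lemma small0W c c' x : c <= c' -> small0 c x -> small0 c' x.
Proof. by move=> cc [x1 x2 x3]; split=> [t||]; exact: le_trans cc. Qed.

(** Steklov means satisfy the C^1 estimate with the same [c], and both sides are continuous under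
    C^0 convergence. This carries the estimate over to Lipschitz functions, among them piecewise
    polynomials. *)
Lemma rhs_estimate e : 0 < e -> exists2 r : R, 0 < r & forall t x1 x2 c,
  continuous (yof x1) -> continuous (yof x2) -> one_periodic (yof x1) -> one_periodic (yof x2) ->
  small01 r (x1 - xs) -> small01 r (x2 - xs) -> small01 c (x1 - x2) ->
  `|rhs t x1 - rhs t x2 - linop t (x1 - x2)| <= e * c.
Proof.
move=> e0; have [r r0 H] := rhs_estimate_smooth e0.
have r20 : 0 < r / 2 by rewrite divr_gt0.
exists (r / 2) => // t x1 x2 c c1 c2 p1 p2 n1 n2 sc.
pose Q (d k : R) := 0 < k < d.
have Qm (d d' k : R) : d <= d' -> Q d k -> Q d' k.
  by move=> dd /andP[k0 kd]; rewrite /Q k0 (lt_le_trans kd).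
have cx : continuous (yof (x1 - x2)) by move=> s; apply: cvgB; [exact: c1|exact: c2].
have px : one_periodic (yof (x1 - x2)) by move=> s; congr (_ - _); [exact: p1|exact: p2].
have Tr x : continuous (yof x) -> one_periodic (yof x) ->
    tends Q (fun k => rhs t (smoothing k x)) (rhs t x).
  by move=> xc xp; apply: tendsZ; exact: (tends_functional DX Qm (state_smoothing_tends t xc xp)).
have Tl : tends Q (fun k => linop t (smoothing k (x1 - x2))) (linop t (x1 - x2)).
  have [K [K0 HK]] := linop_bounded.
  move=> h h0; have [d d0 Hd] := smoothing_close0 cx px (divr_gt0 h0 K0).
  exists d => // k kd.
  have ck := @steklov_continuous _ _ k _ cx.
  rewrite -(@linopB t (smoothing k (x1 - x2)) (x1 - x2) ck cx).
  have -> : h = K * (h / K) by rewrite mulrCA divff ?mulr1// lt0r_neq0.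
  apply: HK; [by move=> s; apply: cvgB; [exact: ck|exact: cx]| |exact: Hd].
  by move=> s; congr (_ - _); [exact: steklov_periodic|exact: px].
have T := tendsB Qm (tendsB Qm (Tr _ c1 p1) (Tr _ c2 p2)) Tl.
apply/ler_addgt0Pr => h h0.
have [d1 d10 H1] := T h h0; have [d2 d20 H2] := smoothing_close1 r20.
pose k := Num.min d1 d2 / 2.
have m0 : 0 < Num.min d1 d2 by rewrite lt_min d10.
have k0 : 0 < k by rewrite divr_gt0.
have : k < Num.min d1 d2 by rewrite ltr_pdivrMr// ltr_pMr// ltr1n.
rewrite lt_min => /andP[k1 k2].
(* The radius was halved to make room for the distance between [xs] and its own mean. *)
have near x : continuous (yof x) -> small01 (r / 2) (x - xs) -> small01 r (smoothing k x - xs).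
  move=> xc xn; rewrite [r]splitr.
  have -> : smoothing k x - xs = smoothing k (x - xs) + (smoothing k xs - xs).
    by rewrite -(smoothingB k xc ys_continuous) addrA subrK.
  apply: small01D; last by apply: H2; rewrite k0.
  have cxs : continuous (yof (x - xs)).
    by move=> s; apply: cvgB; [exact: xc|exact: ys_continuous].
  exact: (small01_smoothing k0 cxs xn).
have S x : continuous (yof x) -> smooth 1 (yof (smoothing k x)).
  by move=> xc; exact: (steklov_smooth k (smooth0 xc)).1.
have Sp x : continuous (yof x) -> one_periodic (yof x) -> one_periodic (yof (smoothing k x)).
  by move=> xc xp s; exact: steklov_periodic.
have := H t (smoothing k x1) (smoothing k x2) c (S _ c1) (S _ c2) (Sp _ c1 p1) (Sp _ c2 p2)
  (near _ c1 n1) (near _ c2 n2).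
rewrite (smoothingB k c1 c2) => /(_ (small01_smoothing k0 cx sc)) B.
have := H1 k; rewrite /Q k0 k1 => /(_ isT); rewrite distrC => B2.
set v := _ - _ - _; set w := _ - _ - _ in B B2.
by rewrite -(subrK w v); apply: (norm_le2 B2 B); rewrite addrC.
Qed.

End KeyEstimate.

(** * Norms of triples *)

Section TripleNorms.
Context (R : realType) (n np : nat).
Local Notation triple := (triple R n np).
Implicit Types (x : triple) (y : R -> 'rV[R]_n) (l : nat).

Lemma CpiP l y : Cpi l y <-> one_periodic y /\ smooth l y.
Proof. by split=> [[p d c]|[p [d c]]]; split. Qed.

Lemma derive1n_periodic l y j t : smooth l y -> one_periodic y -> (j <= l)%N ->
  derive1n j y (t + 1) = derive1n j y t.
Proof.
move=> ys yp jl; have [_ /(_ j jl)] := smooth_affine 1 1 ys.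
have -> : (fun s => y (1 + 1 * s)) = y by apply/funext => s; rewrite mul1r addrC yp.
by move=> /(congr1 (fun f => f t)); rewrite expr1n scale1r mul1r addrC => <-.
Qed.

Lemma Cpi_normP l y (c : R) : Cpi l y ->
  (Cpi_norm l y <= c <-> forall j t, (j <= l)%N -> `|derive1n j y t| <= c).
Proof.
move=> /CpiP[yp ys]; rewrite /Cpi_norm.
set S := [set z | _].
have I0 : (0 : R) \in `[0, 1] by rewrite in_itv /= lexx ler01.
have S0 : S !=set0 by exists `|y 0|, 0%N, 0; split.
have Sub : has_ubound S.
  have bnd j : exists C : R, forall t, (j <= l)%N -> 0 <= t <= 1 -> `|derive1n j y t| <= C.
    have [jl|jl] := leqP j l; last by exists 0.
    have [C C0 HC] := @continuous_bounded R _ _ 0 1 (smooth_continuous ys jl).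
    by exists C => t _; exact: HC.
  have /choice[C HC] := bnd.
  exists (\big[Num.max/0]_(j < l.+1) C j) => z [j [t [jl tI ->]]].
  apply: (le_trans (HC j t jl _)); first by move: tI; rewrite in_itv.
  exact: (@le_bigmax _ _ _ _ (fun j : 'I_l.+1 => C j) (Ordinal (jl : (j < l.+1)%N))).
split=> [Sc j t jl|H].
  have [t' /andP[t0 t1] red] := periodic_reduce t.
  rewrite (red _ (derive1n j y)); last by move=> r; exact: derive1n_periodic ys yp jl.
  have Sz : S `|derive1n j y t'|.
    by exists j, t'; split; [exact: jl|rewrite in_itv /= t0 ltW|].
  exact: le_trans (ub_le_sup Sub Sz) Sc.
by apply: ge_sup => // z [j [t [jl _ ->]]]; exact: H.
Qed.

Lemma tri_norm0P x (c : R) : tri_C 0 x -> (tri_norm 0 x <= c <-> small0 c x).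
Proof.
move=> xC; rewrite /tri_norm !ge_max.
split=> [/and3P[/(Cpi_normP _ xC) H T p]|[H T p]].
  by split=> // t; exact: (H 0%N t isT).
rewrite T p !andbT; apply/(Cpi_normP _ xC) => j t; rewrite leqn0 => /eqP->; exact: H.
Qed.

Lemma tri_norm1_small x : tri_C 1 x -> small01 (tri_norm 1 x) x.
Proof.
move=> xC; have /CpiP[xp xs] := xC.
have : tri_norm 1 x <= tri_norm 1 x by exact: lexx.
rewrite {1}/tri_norm !ge_max => /and3P[/(Cpi_normP _ xC) H T p].
split; first by split=> // t; exact: (H 0%N t isT).
apply: (hasD_lipschitz (f' := derive1 (yof x))) => t; last exact: (H 1%N t isT).
exact: (@smooth_hasD _ _ 1 (yof x) 0 t xs isT).
Qed.

Lemma tri_normZ l (a : R) x : tri_C l x -> tri_C l (a *: x) /\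
  tri_norm l (a *: x) <= `|a| * tri_norm l x.
Proof.
move=> xC; have /CpiP[xp xs] := xC.
have s0 := @smooth_cst R n l 0.
have [s1 E] := smooth_linear a xs s0.
have E0 : a *: yof x + (fun=> 0) = yof (a *: x).
  by apply/funext => t; exact: addr0.
rewrite E0 in s1 E.
have aC : tri_C l (a *: x).
  by apply/CpiP; split=> // t; congr (_ *: _); exact: xp.
split=> //.
have [c Ec] : {c | c = tri_norm l x} by exists (tri_norm l x).
have Hc : tri_norm l x <= c by rewrite Ec.
rewrite -Ec; move: Hc; rewrite /tri_norm !ge_max => /and3P[/(Cpi_normP _ xC) H T p].
apply/and3P; split.
- apply/(Cpi_normP _ aC) => j t jl; rewrite E//.
  have -> : derive1n j (fun=> 0 : 'rV[R]_n) = (fun=> 0).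
    have := (smooth_linear (-1) s0 s0).2 j jl.
    have -> : (-1) *: (fun=> 0) + (fun=> 0) = (fun=> 0) :> (R -> 'rV[R]_n).
      by apply/funext => r; rewrite /GRing.scale /GRing.add /= scaleN1r addNr.
    by move=> ->; apply/funext => r; rewrite /GRing.scale /GRing.add /= scaleN1r addNr.
  have -> : (a *: derive1n j (yof x) + (fun=> 0)) t = a *: derive1n j (yof x) t by exact: addr0.
  by rewrite normrZ; apply: ler_wpM2l => //; exact: H.
- by have -> : Tof (a *: x) = a * Tof x by []; rewrite normrM ler_wpM2l.
- by have -> : pof (a *: x) = a *: pof x by []; rewrite normrZ ler_wpM2l.
Qed.

Lemma tri_C_linear l (a : R) x z : tri_C l x -> tri_C l z -> tri_C l (a *: x + z).
Proof.
move=> /CpiP[xp xs] /CpiP[zp zs]; apply/CpiP; split; last exact: (smooth_linear a xs zs).1.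
by move=> t; congr (_ *: _ + _); [exact: xp|exact: zp].
Qed.

Lemma tri_C0 l : tri_C l (0 : triple).
Proof. by apply/CpiP; split; [move=> t|exact: (@smooth_cst R n l 0)]. Qed.

Lemma tri_norm01_le x (c : R) : small01 c x -> tri_norm01 x <= c.
Proof.
move=> [[H T p] L]; have c0 := le_trans (normr_ge0 _) T.
rewrite /tri_norm01 !ge_max T p !andbT; apply/andP; split.
  rewrite /Cpi_norm; apply: ge_sup.
    by exists `|yof x 0|, 0%N, 0; split=> //; rewrite in_itv /= lexx ler01.
  by move=> z [j [t [j0 _ ->]]]; move: j0; rewrite leqn0 => /eqP->; exact: H.
rewrite /Lip; apply: ge_sup.
  by exists (`|yof x 1 - yof x 0| / `|1 - 0|), 1, 0; split=> //; exact: oner_neq0.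
move=> z [t [s [ts ->]]]; rewrite ler_pdivrMr ?normr_gt0 ?subr_eq0//; exact: L.
Qed.

(** An a priori Lipschitz bound is required because [sup] carries no information on unbounded
    sets. *)
Lemma small01_tri_norm01 x (c : R) : tri_C 0 x -> (exists K, small01 K x) -> tri_norm01 x <= c ->
  small01 c x.
Proof.
move=> xC [K [[_ _ _] L]]; rewrite /tri_norm01 !ge_max => /andP[/andP[Hy HL] /andP[T p]].
have H := (Cpi_normP c xC).1 Hy.
split; first by split=> // t; exact: (H 0%N t isT).
move=> s t; have [->|st] := eqVneq s t.
  by rewrite !subrr !normr0 mulr0.
have st0 : 0 < `|s - t| by rewrite normr_gt0 subr_eq0.
rewrite -ler_pdivrMr//; apply: le_trans HL; apply: ub_le_sup.
  exists K => z [t' [s' [ts ->]]]; rewrite ler_pdivrMr ?normr_gt0 ?subr_eq0//; exact: L.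
by exists s, t.
Qed.

Lemma tri_norm01_ge0 x : 0 <= tri_norm01 x.
Proof. by rewrite /tri_norm01 !le_max !normr_ge0 !orbT. Qed.

(** Continuity at 0 and homogeneity, with the same scaling as in [extension_bounded]. *)
Lemma affine_bounded (q : nat) (Raff : triple -> 'rV[R]_q) :
  continuous_affine (@tri_C R n np 0) (@tri_norm R n np 0) Raff ->
  exists K : R, 0 < K /\ forall x c, tri_C 0 x -> small0 c x -> `|linear_part Raff x| <= K * c.
Proof.
move=> [Lin Cont].
have C0 := tri_C0 0.
have [d d0 H] := Cont 0 C0 1 ltr01.
have LZ a x : tri_C 0 x -> linear_part Raff (a *: x) = a *: linear_part Raff x.
  move=> xC; have := Lin a x 0 xC C0.
  by rewrite /linear_part subrr !addr0.
exists (2 / d); split=> [|x c xC xc]; first by rewrite divr_gt0.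
apply/ler_addgt0Pr => e e0.
pose b := c + e * d / 2.
have c0 := small0_ge0 xc.
have b0 : 0 < b by rewrite ltr_wpDl// divr_gt0// mulr_gt0.
pose a := d / (2 * b); have a0 : 0 < a by rewrite divr_gt0// mulr_gt0.
have [aC aN] := tri_normZ a xC.
have : `|Raff (a *: x) - Raff 0| < 1.
  apply: H => //; rewrite subr0; apply: (le_lt_trans aN); rewrite gtr0_norm//.
  have Nx : tri_norm 0 x <= c by apply/tri_norm0P.
  apply: (le_lt_trans (ler_wpM2l (ltW a0) Nx)).
  rewrite /a mulrAC ltr_pdivrMr ?mulr_gt0// ltr_pM2l//.
  have : 0 < e * d / 2 by rewrite divr_gt0// mulr_gt0.
  by rewrite /b; lra.
rewrite -/(linear_part Raff (a *: x)) LZ// normrZ gtr0_norm// -ltr_pdivlMl// mulr1 =>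
  /ltW/le_trans; apply.
have -> : a^-1 = 2 * b / d by rewrite /a invf_div.
rewrite /b mulrDr mulrDl (_ : 2 * (e * d / 2) / d = e); last first.
  by field; rewrite lt0r_neq0.
by rewrite lerD2r mulrAC.
Qed.

End TripleNorms.

(** Two derivatives agree to first order on small multiples of [x], hence at [x] by homogeneity.
    This evaluates the choice made in [frechet_derivative]. *)
Lemma frechet_derivative_unique (R : realType) (E : lmodType R) (F : normedModType R)
    (A : set E) (N : E -> R) (f : E -> F) u (L : E -> F) x :
  (forall (a : R) y, A y -> A (a *: y) /\ N (a *: y) <= `|a| * N y) -> A 0 ->
  (forall y, A y -> 0 <= N y) ->
  is_frechet_derivative A N f u L -> A x -> frechet_derivative A N f u x = L x.
Proof.
move=> AN A0 N0 HL Ax.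
have HG : is_frechet_derivative A N f u (frechet_derivative A N f u).
  exact: (@getI _ [set L : E -> F | is_frechet_derivative A N f u L] L HL).
set M := frechet_derivative A N f u in HG *.
have Z (L' : E -> F) (a : R) : is_frechet_derivative A N f u L' -> L' (a *: x) = a *: L' x.
  case=> [lin _ _]; have L0 : L' 0 = 0.
    by have := lin (-1) 0 0 A0 A0; rewrite scaler0 addr0 scaleN1r addNr.
  by have := lin a x 0 Ax A0; rewrite addr0 L0 addr0.
have Nx0 := N0 _ Ax.
apply/eqP; rewrite -subr_eq0 -normr_le0; apply/ler_addgt0Pl => e e0; rewrite addr0.
pose e' := e / (2 * (N x + 1)).
have n0 : 0 < N x + 1 by rewrite ltr_wpDl.
have e'0 : 0 < e' by rewrite divr_gt0// mulr_gt0.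
have [_ _ /(_ e' e'0)[d1 d10 H1]] := HG; have [_ _ /(_ e' e'0)[d2 d20 H2]] := HL.
pose a := Num.min d1 d2 / (2 * (N x + 1)).
have m0 : 0 < Num.min d1 d2 by rewrite lt_min d10.
have a0 : 0 < a by rewrite divr_gt0// mulr_gt0.
have [Aa Na] := AN a _ Ax; rewrite gtr0_norm// in Na.
have am : N (a *: x) < Num.min d1 d2.
  apply: (le_lt_trans Na); rewrite /a mulrAC ltr_pdivrMr ?mulr_gt0// ltr_pM2l//; lra.
move: (am); rewrite lt_min => /andP[am1 am2].
have B1 := H1 _ Aa am1; have B2 := H2 _ Aa am2; rewrite (Z _ _ HG) in B1; rewrite (Z _ _ HL) in B2.
rewrite -(ler_pM2l a0) -{1}(gtr0_norm a0) -normrZ scalerBr.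
set D := f _ - _ in B1 B2.
have -> : a *: M x - a *: L x = (D - a *: L x) - (D - a *: M x).
  by rewrite opprB !addrA [RHS](ACl (3*(1*4)*2)%AC) /= subrr addr0.
apply: (le_trans (ler_normB _ _)); apply: (le_trans (lerD B2 B1)).
apply: (@le_trans _ _ (e' * (a * N x) + e' * (a * N x))); first by rewrite lerD// ler_wpM2l// ltW.
have -> : e' * (a * N x) + e' * (a * N x) = a * (e * (N x / (N x + 1))).
  by rewrite /e'; field; rewrite lt0r_neq0.
rewrite ler_wpM2l ?(ltW a0)// ler_piMr ?(ltW e0)// ler_pdivrMr// mul1r lerDl//.
Qed.

(** * Regularity of the solution and the linearized problem *)

Section Linearization.
Context (R : realType) (tau : R) (n np lmax : nat).
Hypothesis tau_gt0 : 0 < tau.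
Hypothesis lmax_ge1 : (1 <= lmax)%N.
Local Notation hist := (hist R n np).
Local Notation triple := (triple R n np).
Variable G : hist -> 'rV[R]_n.
Variables (D : nat -> hist -> seq hist -> 'rV[R]_n) (X : nat -> hist * hist -> 'rV[R]_n).
Hypothesis DX : mild_family tau lmax G D X.
Hypothesis GM : mildly_differentiable tau lmax G.
Variables (Raff : triple -> 'rV[R]_np.+1) (xs : triple).
Hypothesis xs_sol : bvp_solution G Raff xs.

Let Ts_gt0 : 0 < Tof xs. Proof. by case: xs_sol. Qed.
Let ys_periodic : one_periodic (yof xs). Proof. by case: xs_sol. Qed.

Let ys_hasD t : hasD (yof xs) t (rhs G t xs).
Proof.
have [_ _ /(_ t)[d e] _] := xs_sol; rewrite /rhs /state -e; exact: derivable_hasD.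
Qed.

Lemma solution_smooth : smooth lmax.+1 (yof xs).
Proof.
have s0 : smooth 0 (yof xs).
  by apply: smooth0; apply: hasD_continuous => t; eexists; exact: ys_hasD.
suff H m : (m <= lmax)%N -> smooth m (yof xs) -> smooth m.+1 (yof xs).
  have : forall m, (m <= lmax.+1)%N -> smooth m (yof xs).
    by elim=> [//|m IH] ml; apply: H => //; exact: IH (ltnW ml).
  exact.
move=> ml ys; apply: smoothS_hasD ys_hasD _.
(* In the time scale of the delay, [state t xs] is the shift by [Tof xs * t] of one fixed curve, so
   [functional_smooth] applies. *)
pose z : hist := (fun s => yof xs (0 + (Tof xs)^-1 * s), pof xs).
have zs : smooth_hist m z := (smooth_affine 0 (Tof xs)^-1 ys).1.
have Gs := functional_smooth tau_gt0 GM ml zs.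
have [Gs' _] := smooth_affine 0 (Tof xs) Gs.
have := (smooth_linear (Tof xs) Gs' (smooth_cst m 0)).1.
suff -> : (fun t => rhs G t xs) =
    Tof xs *: (fun s : R => G (shiftH (0 + Tof xs * s) z)) + (fun=> 0) by [].
apply/funext => t; rewrite /rhs.
have -> : state t xs = shiftH (0 + Tof xs * t) z.
  congr pair; apply/funext => s /=; congr (yof xs _).
  by field; rewrite lt0r_neq0.
exact/esym/addr0.
Qed.

Let ys_smooth : smooth 1 (yof xs).
Proof. by apply: smoothW solution_smooth. Qed.

Lemma tri_C_shift l t d : tri_C l d -> tri_C l (@shift_tri R n np t d).
Proof.
move=> /CpiP[dp ds]; apply/CpiP; split=> [s|]; first by rewrite /yof /= addrA; exact: dp.
have [+ _] := smooth_affine t 1 ds.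
by rewrite (_ : (fun s => _) = yof (shift_tri t d))//; apply/funext => s; rewrite mul1r.
Qed.

Lemma small01_shift c t d : small01 c d -> small01 c (@shift_tri R n np t d).
Proof.
move=> [[d1 d2 d3] d4]; split; first by split=> // s; exact: d1.
by move=> s r; apply: (le_trans (d4 _ _)); rewrite opprD addrACA subrr add0r.
Qed.

(** This is [rhs_estimate] with [x2 = xs], the norm of C^1 dominating that of C^{0,1}. Shifting back
    by [t] is needed because [Grhs] reads histories at time 0. *)
Lemma linop_frechet t : is_frechet_derivative (@tri_C R n np 1) (@tri_norm R n np 1)
  (Grhs G) (shift_tri t xs) (fun h => linop G X xs t (shift_tri (- t) h)).
Proof.
have Ccont x : tri_C 1 x -> continuous (yof x).
  by move=> /CpiP[_ xs1]; exact: smooth_continuous xs1 (leq0n 1).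
have Cper x : tri_C 1 x -> one_periodic (yof x) by move=> /CpiP[].
split.
- move=> a x y xC yC.
  have xC' := tri_C_shift (- t) xC; have yC' := tri_C_shift (- t) yC.
  have E : shift_tri (- t) (a *: x + y) = a *: shift_tri (- t) x + shift_tri (- t) y by [].
  rewrite E; apply: (linop_linear tau_gt0 DX lmax_ge1 ys_smooth t a); exact: Ccont.
- have [K [K0 HK]] := linop_bounded tau_gt0 DX lmax_ge1 Ts_gt0 ys_smooth ys_periodic.
  exists K => x xC; have xC' := tri_C_shift (- t) xC.
  apply: HK; [exact: Ccont|exact: Cper|].
  exact: (small01_shift (- t) (tri_norm1_small xC)).1.
- move=> e e0.
  have [r r0 Hr] := rhs_estimate tau_gt0 DX lmax_ge1 Ts_gt0 ys_smooth ys_periodic e0.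
  exists r => // h hC hr.
  pose k := shift_tri (- t) h; have kC : tri_C 1 k := tri_C_shift (- t) hC.
  have kn : small01 (tri_norm 1 h) k := small01_shift (- t) (tri_norm1_small hC).
  have xkc : continuous (yof (xs + k)).
    move=> s; apply: cvgD; last exact: Ccont.
    by have := smooth_continuous ys_smooth (leq0n 1); exact.
  have xkp : one_periodic (yof (xs + k)).
    by move=> s; congr (_ + _); [exact: ys_periodic|exact: Cper kC s].
  have xc := smooth_continuous ys_smooth (leq0n 1).
  have Ek : xs + k - xs = k by rewrite addrC addKr.
  have := Hr t (xs + k) xs (tri_norm 1 h) xkc xc xkp ys_periodic.
  rewrite Ek subrr => /(_ (small01W (ltW hr) kn) (small01_0 _ _ (ltW r0)) kn).
  have -> : rhs G t (xs + k) = Grhs G (shift_tri t xs + h).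
    rewrite /rhs /Grhs; congr (_ *: G _); congr pair; apply/funext => s.
    by congr (_ + _); rewrite /k /yof /= addKr.
  by have -> : rhs G t xs = Grhs G (shift_tri t xs) by [].
Qed.

Lemma linearized_trivial : (forall d, linearized_solution G Raff xs d -> d = 0) ->
  forall d, tri_C 1 d -> (forall t, derive1 (yof d) t = linop G X xs t d) ->
  linear_part Raff d = 0 -> d = 0.
Proof.
move=> nd d dC dE dR; apply: nd; split=> // t; rewrite dE.
have dC' := tri_C_shift t dC.
rewrite (frechet_derivative_unique _ _ _ (linop_frechet t) dC').
- congr (linop _ _ _ _ _); rewrite /shift_tri /tri /yof /Tof /pof /=.
  case: d {dC dE dR dC'} => [[y T] p] /=; congr (_, _, _).
  by apply/funext => s; rewrite addrA subrr add0r.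
- by move=> a y yC; exact: tri_normZ.
- exact: tri_C0.
- by move=> y /tri_norm1_small[/small0_ge0].
Qed.

End Linearization.

(** * Collocation and Lagrange interpolation *)

Section LagrangeBasis.
Context (R : realType) (k : nat) (x : 'I_k -> R).
Hypothesis x_inj : injective x.

Definition lagrange_poly (i : 'I_k) : {poly R} :=
  \prod_(j < k | j != i) ((x i - x j)^-1 *: ('X - (x j)%:P)).

Lemma size_lagrange_poly i : (size (lagrange_poly i) <= k)%N.
Proof.
rewrite /lagrange_poly scaler_prod; apply: (leq_trans (size_scale_leq _ _)).
rewrite size_prod => [|j _]; last by rewrite polyXsubC_eq0.
rewrite (eq_bigr (fun=> (2 * 1)%N)); last by move=> j _; rewrite size_XsubC.
rewrite -big_distrr /= sum1_card cardC1 card_ord.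
by case: (k) i => [[]//|k'] i; rewrite mul2n -addnn -addSn addnK.
Qed.

Lemma lagrange_poly_node i j : (lagrange_poly i).[x j] = (i == j)%:R.
Proof.
rewrite /lagrange_poly horner_prod; have [<-|ij] := eqVneq i j.
  rewrite big1// => l li; rewrite hornerZ hornerXsubC mulVf// subr_eq0.
  by rewrite inj_eq// eq_sym.
rewrite (bigD1 j) 1?eq_sym//= hornerZ hornerXsubC subrr mulr0 mul0r//.
Qed.

Lemma lagrange_interpolation (p : {poly R}) : (size p <= k)%N ->
  p = \sum_i p.[x i] *: lagrange_poly i.
Proof.
move=> sp; apply/eqP; rewrite -subr_eq0; apply/eqP.
apply: (@roots_geq_poly_eq0 _ _ [seq x i | i <- enum 'I_k]).
- apply/allP => _ /mapP[j _ ->]; rewrite /root hornerD hornerN horner_sum.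
  rewrite (bigD1 j)//= hornerZ lagrange_poly_node eqxx mulr1 big1 ?addr0 ?subrr// => i ij.
  by rewrite hornerZ lagrange_poly_node (negPf ij) mulr0.
- by rewrite map_inj_uniq// enum_uniq.
- rewrite size_map size_enum_ord; apply: (leq_trans (size_polyD _ _)).
  rewrite geq_max sp size_polyN; apply: (leq_trans (size_sum _ _ _)).
  by apply/bigmax_leqP => i _; apply: (leq_trans (size_scale_leq _ _)); exact: size_lagrange_poly.
Qed.

Lemma lagrange_partition s : (0 < k)%N -> \sum_i (lagrange_poly i).[s] = 1.
Proof.
move=> k0; have := @lagrange_interpolation 1; rewrite size_poly1 => /(_ k0).
move=> /(congr1 (fun p => p.[s])); rewrite hornerE horner_sum => ->.
by apply: eq_bigr => i _; rewrite hornerZ hornerE mul1r.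
Qed.

End LagrangeBasis.

Section PolynomialBounds.
Context (R : realType).
Implicit Types p : {poly R}.

Definition poly_height p : R := \sum_(i < size p) `|p`_i|.

Lemma poly_height_ge0 p : 0 <= poly_height p. Proof. exact: sumr_ge0. Qed.

Lemma horner_bound p (s : R) : 0 <= s <= 1 -> `|p.[s]| <= poly_height p.
Proof.
move=> /andP[s0 s1]; rewrite horner_coef; apply: (le_trans (ler_norm_sum _ _ _)).
apply: ler_sum => i _; rewrite normrM ler_piMr// normrX exprn_ile1// ger0_norm//.
Qed.

Lemma hasD_horner p t : hasD (horner p : R -> R^o) t (p^`().[t]).
Proof.
have /derivable_hasD : derivable (horner p : R -> R^o) t 1 by exact: derivable_horner.
by rewrite -derivE.
Qed.

End PolynomialBounds.

(** At mesh points a piecewise polynomial has a derivative from the right, which is all that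
    [increment_bound] asks for. *)
Definition right_derivative (R : realType) (n : nat) (y : R -> 'rV[R]_n) (x : R) (v : 'rV[R]_n) :
  Prop :=
  forall e : R, 0 < e -> exists2 d : R, 0 < d &
    forall s, x <= s < x + d -> `|y s - y x - (s - x) *: v| <= e * (s - x).

Lemma right_derivative_reduce (R : realType) (n : nat) (y : R -> 'rV[R]_n) x x' v :
  one_periodic y -> (forall (T : Type) (f : R -> T), (forall r, f (r + 1) = f r) -> f x = f x') ->
  right_derivative y x' v -> right_derivative y x v.
Proof.
move=> yp red Hv e e0; have [d d0 H] := Hv e e0; exists d => // s /andP[xs sd].
have := H (x' + (s - x)); rewrite (addrC x') addrK => B.
have ys : y (s - x + x') = y s.
  rewrite -(red _ (fun r => y (s - x + r))) ?subrK// => r.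
  by rewrite addrA yp.
by rewrite ys -(red _ y) in B; [apply: B; apply/andP; split; lra|exact: yp].
Qed.

Section Mesh.
Context (R : realType) (n m L : nat) (t : nat -> R) (tc : 'I_m -> R).
Hypothesis m_gt0 : (0 < m)%N.
Hypothesis tc_inj : injective tc.
Hypothesis tc_in : forall j, 0 < tc j < 1.
Hypothesis mesh : is_mesh L t.

Lemma mesh_locate (s : R) : 0 <= s < 1 -> exists2 i : nat, (i < L)%N & t i <= s < t i.+1.
Proof.
move=> /andP[s0 s1]; have [t0 tL _] := mesh.
have : exists i, (s < t i) by exists L; rewrite tL.
move=> /ex_minnP[[|i] si mini]; first by move: si; rewrite t0 ltNge s0.
exists i; last by rewrite si andbT leNgt; apply/negP => /mini; rewrite ltnn.
by apply: mini; rewrite tL.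
Qed.

Lemma mesh_in01 i : (i <= L)%N -> 0 <= t i <= 1.
Proof.
have [t0 tL tS] := mesh => iL.
have mono j k : (j + k <= L)%N -> t j <= t (j + k).
  elim: k => [|k IH] jk; first by rewrite addn0.
  rewrite addnS in jk *; exact: le_trans (IH (ltnW jk)) (ltW (tS _ jk)).
apply/andP; split; first by rewrite -t0; have := mono 0%N i; rewrite add0n; exact.
by rewrite -tL -(subnKC iL); apply: mono; rewrite subnKC.
Qed.

Let step i := t i.+1 - t i.

Lemma step_gt0 i : (i < L)%N -> 0 < step i.
Proof. by move=> iL; have [_ _ tS] := mesh; rewrite subr_gt0 tS. Qed.

Lemma colloc_in i j : (i < L)%N -> t i < colloc_point t tc i j < t i.+1.
Proof.
move=> iL; have s0 := step_gt0 iL; have /andP[c0 c1] := tc_in j.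
rewrite /colloc_point -/(step i); apply/andP; split; first by rewrite ltrDl mulr_gt0.
by rewrite -ltrBrDl -/(step i) gtr_pMr.
Qed.

(** An upper bound for the usual Lebesgue constant on [0, 1]; what matters is that it depends on the
    collocation nodes but not on the mesh. *)
Definition lebesgue_constant : R := \sum_j poly_height (lagrange_poly tc j).

Lemma lebesgue_constant_ge0 : 0 <= lebesgue_constant.
Proof. by apply: sumr_ge0 => j _; exact: poly_height_ge0. Qed.

Lemma lebesgue_bound (V : normedModType R) (w : 'I_m -> V) K s : 0 <= s <= 1 ->
  (forall j, `|w j| <= K) ->
  `|\sum_j (lagrange_poly tc j).[s] *: w j| <= lebesgue_constant * K.
Proof.
move=> s01 wK; apply: (le_trans (ler_norm_sum _ _ _)).
rewrite /lebesgue_constant mulr_suml; apply: ler_sum => j _; rewrite normrZ.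
by apply: ler_pM => //; exact: horner_bound.
Qed.

Lemma piecewise_poly_derivative (y : R -> 'rV[R]_n) i x : piecewise_poly m L t y -> (i < L)%N ->
  t i <= x < t i.+1 ->
  let v := \sum_j (lagrange_poly tc j).[(x - t i) / step i] *: derive1 y (colloc_point t tc i j) in
  right_derivative y x v /\ (t i < x -> hasD y x v).
Proof.
move=> pp iL /andP[x0 x1] v; have s0 := step_gt0 iL.
have /choice[q Hq] : forall c, exists q : {poly R}, (size q <= m.+1)%N /\
    forall s, s \in `[t i, t i.+1] -> y s ord0 c = q.[s].
  by move=> c; have [q q1 q2] := pp i iL c; exists q.
pose qy s : 'rV[R]_n := \row_c (q c).[s].
have qyE s : t i <= s <= t i.+1 -> y s = qy s.
  by move=> sI; apply/rowP => c; rewrite mxE; apply: (Hq c).2; rewrite in_itv.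
have qD s : hasD qy s (\row_c (q c)^`().[s]).
  apply: hasD_rV => c; rewrite mxE; apply: hasD_ext (hasD_horner (q c) s) => r.
  by rewrite mxE.
have inner s : t i < s < t i.+1 -> hasD y s (\row_c (q c)^`().[s]).
  move=> /andP[s1 s2]; apply: hasD_near (qD s).
  exists (Num.min (s - t i) (t i.+1 - s)); first by rewrite lt_min !subr_gt0 s1.
  move=> r; rewrite lt_min !ltr_norml => /andP[/andP[r1 _] /andP[_ r2]].
  by rewrite qyE//; apply/andP; split; lra.
have -> : v = \row_c (q c)^`().[x].
  apply/rowP => c; rewrite /v summxE mxE.
  (* The derivative in the coordinate of the reference interval has size at most [m], so its values
     at the [m] nodes determine it. *)
  pose g := (q c)^`() \Po (step i *: 'X + (t i)%:P).
  have gE s : g.[s] = (q c)^`().[t i + step i * s].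
    by rewrite horner_comp hornerD hornerZ hornerX hornerC addrC.
  have sg : (size g <= m)%N.
    apply: (leq_trans (size_comp_poly_leq _ _)).
    have sl : (size (step i *: 'X + (t i)%:P)).-1 = 1%N.
      by rewrite -mul_polyC size_MXaddC polyC_eq0 gt_eqF//= size_polyC gt_eqF.
    rewrite sl muln1; have [->|q0] := eqVneq (q c) 0; first by rewrite deriv0 size_poly0 m_gt0.
    have := leq_trans (lt_size_deriv q0) (Hq c).1.
    by rewrite ltnS; case: (size _).
  have -> : (q c)^`().[x] = g.[(x - t i) / step i].
    rewrite gE mulrC divfK; last by rewrite gt_eqF.
    by rewrite addrC subrK.
  rewrite (lagrange_interpolation tc_inj sg) horner_sum; apply: eq_bigr => j _.
  rewrite !mxE hornerZ gE mulrC; congr (_ * _).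
  have -> : t i + step i * tc j = colloc_point t tc i j by [].
  by rewrite (hasD_derivable (inner _ (colloc_in j iL))).2 mxE.
split=> [e e0|tx]; last by apply: inner; rewrite tx.
have [d d0 Hd] := qD x e e0.
exists (Num.min d (t i.+1 - x)); first by rewrite lt_min d0 subr_gt0.
move=> s /andP[xs sx].
have : s - x < Num.min d (t i.+1 - x) by rewrite ltrBlDl.
rewrite lt_min => /andP[sd sx1].
have := Hd s; rewrite ger0_norm ?subr_ge0// => /(_ sd).
by rewrite !qyE//; apply/andP; split; lra.
Qed.

Lemma colloc_hasD (y : R -> 'rV[R]_n) i j : piecewise_poly m L t y -> (i < L)%N ->
  hasD y (colloc_point t tc i j) (derive1 y (colloc_point t tc i j)).
Proof.
move=> pp iL; have /andP[c1 c2] := colloc_in j iL.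
have I : t i <= colloc_point t tc i j < t i.+1 by rewrite ltW.
have [_ /(_ c1) D] := piecewise_poly_derivative pp iL I.
by rewrite (hasD_derivable D).2.
Qed.

(** The right derivative is a combination of collocation values with weights of sum 1, so closeness
    of these values to any [c] is inherited, up to the Lebesgue constant. *)
Lemma right_derivative_near_colloc (y : R -> 'rV[R]_n) x : piecewise_poly m L t y -> one_periodic
  y ->
  exists v i x', [/\ (i < L)%N, 0 <= x' < 1, t i <= x' < t i.+1,
    forall (T : Type) (f : R -> T), (forall r, f (r + 1) = f r) -> f x = f x' &
    right_derivative y x v /\
    forall c K, (forall j, `|derive1 y (colloc_point t tc i j) - c| <= K) ->
      `|v - c| <= lebesgue_constant * K].
Proof.
move=> pp yp; have [x' x'I red] := periodic_reduce x.
have [i iL x'i] := mesh_locate x'I.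
have [Hv _] := piecewise_poly_derivative pp iL x'i.
set v := \sum_j _ in Hv.
exists v, i, x'; split=> //; split=> [|c K HK].
  exact: right_derivative_reduce yp red Hv.
have s01 : 0 <= (x' - t i) / step i <= 1.
  have s0 := step_gt0 iL; have /andP[x0 x1] := x'i.
  apply/andP; split; first by apply: divr_ge0; [rewrite subr_ge0|exact: ltW].
  by rewrite ler_pdivrMr// mul1r lerD2r ltW.
rewrite (_ : v - c = \sum_j (lagrange_poly tc j).[(x' - t i) / step i] *:
    (derive1 y (colloc_point t tc i j) - c)); first exact: lebesgue_bound.
rewrite -[c in LHS]scale1r -(lagrange_partition tc_inj ((x' - t i) / step i) m_gt0).
rewrite scaler_suml -sumrB.
by apply: eq_bigr => j _; rewrite scalerBr.
Qed.

End Mesh.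

Lemma right_derivative_increment (R : realType) (n : nat) (y : R -> 'rV[R]_n) K a b :
  continuous y -> a <= b ->
  (forall x, a <= x < b -> exists2 v, right_derivative y x v & `|v| <= K) ->
  `|y b - y a| <= K * (b - a).
Proof.
move=> yc ab H; apply: (increment_bound ab yc) => x xI e e0.
have [v /(_ e e0)[d d0 Hd] vK] := H x xI.
exists d => // s sI; have := Hd s sI; have /andP[xs _] := sI => B.
rewrite -(subrK ((s - x) *: v) (y s - y x)); apply: (norm_le2 B (lexx _)).
by rewrite normrZ ger0_norm ?subr_ge0// [leRHS]mulrDl [leRHS]addrC lerD2l mulrC ler_wpM2r ?subr_ge0.
Qed.

Lemma right_derivative_lipschitz (R : realType) (n : nat) (y : R -> 'rV[R]_n) K :
  continuous y -> (forall x, exists2 v, right_derivative y x v & `|v| <= K) ->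
  forall s r, `|y s - y r| <= K * `|s - r|.
Proof.
move=> yc H s r; wlog rs : s r / r <= s.
  by move=> W; have [/W//|/ltW/W] := leP r s; rewrite distrC (distrC s).
by rewrite ger0_norm ?subr_ge0//; apply: right_derivative_increment.
Qed.

(** * Stability *)

Section UltrafilterLimits.
Context (R : realType) (I : Type) (U : set_system I) (UU : UltraFilter U).

(** Compactness provides a cluster point, and along an ultrafilter a cluster point is a limit. No
    subsequences have to be extracted. *)
Lemma ultra_limit_real (a b : R) (v : I -> R) : (forall k, a <= v k <= b) ->
  exists l : R, forall e : R, 0 < e -> U [set k | `|v k - l| < e].
Proof.
move=> vab.
have vI : (v @ U) `[a, b]%classic.
  by apply: (@filterE _ U) => k; rewrite /= in_itv /=; exact: vab.
have [l [_ cl]] := @segment_compact R a b (v @ U) _ vI.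
exists l => e e0; have [//|UC] := in_ultra_setVsetC [set k | `|v k - l| < e] UU.
have nb : nbhs l (ball l e) by exact: nbhsx_ballx.
have /cl/(_ nb)[_ [[k kC <-]]] : (v @ U) (v @` (~` [set k | `|v k - l| < e])).
  by apply: (filterS (F := U) _ UC) => k kC; exists k.
by rewrite /ball /= distrC.
Qed.

Lemma ultra_limit (n : nat) c (v : I -> 'rV[R]_n) : (forall k, `|v k| <= c) ->
  exists l : 'rV[R]_n, forall e : R, 0 < e -> U [set k | `|v k - l| <= e].
Proof.
move=> vc.
have /choice[l Hl] : forall j, exists l : R, forall e : R, 0 < e ->
    U [set k | `|v k ord0 j - l| < e].
  move=> j; apply: (@ultra_limit_real (- c) c) => k; rewrite -ler_norml.
  exact: le_trans (rV_norm_ge _ _) (vc k).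
exists (\row_j l j) => e e0.
have /filterS : forall k, (forall j, `|v k ord0 j - l j| < e) -> `|v k - \row_j l j| <= e.
  by move=> k H; apply: rV_norm_le (ltW e0) _ => j; rewrite !mxE ltW.
apply; apply: filter_forall => j; exact: Hl.
Qed.

End UltrafilterLimits.

Section DiscreteSpace.
Context (R : realType) (n np m L : nat) (t : nat -> R).
Local Notation triple := (triple R n np).

Definition discrete (x : triple) : Prop :=
  [/\ one_periodic (yof x), continuous (yof x) & piecewise_poly m L t (yof x)].

Lemma discrete_linear a x z : discrete x -> discrete z -> discrete (a *: x + z).
Proof.
move=> [xp xc xq] [zp zc zq]; split.
- by move=> s; congr (_ *: _ + _); [exact: xp|exact: zp].
- move=> s; apply: cvgD; last exact: zc.
  apply: cvgZ; [exact: cvg_cst|exact: xc].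
- move=> i iL c; have [q q1 q2] := xq i iL c; have [r r1 r2] := zq i iL c.
  exists (a *: q + r).
    apply: (leq_trans (size_polyD _ _)); rewrite geq_max r1 andbT.
    exact: leq_trans (size_scale_leq _ _) q1.
  move=> s sI; rewrite hornerD hornerZ -q2// -r2//.
  have -> : yof (a *: x + z) s = a *: yof x s + yof z s by [].
  by rewrite !mxE.
Qed.

Lemma discrete0 : discrete 0.
Proof.
split=> [//|s|i iL c]; first exact: cvg_cst.
exists 0; first by rewrite size_poly0.
move=> s _; rewrite horner0.
have -> : yof (0 : triple) s = 0 by [].
by rewrite mxE.
Qed.

Lemma discreteB x z : discrete x -> discrete z -> discrete (x - z).
Proof. by move=> xd zd; rewrite addrC -scaleN1r; exact: discrete_linear. Qed.

Lemma discreteZ a x : discrete x -> discrete (a *: x).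
Proof. by move=> xd; have := discrete_linear a xd discrete0; rewrite addr0. Qed.

Lemma discrete_tri_C x : discrete x -> tri_C 0 x.
Proof. by move=> [xp xc _]; apply/CpiP; split; [exact: xp|exact: smooth0]. Qed.

End DiscreteSpace.

Lemma norm_telescope4 (R : realType) (V : normedModType R) (x y z u w : V) (a b c d : R) :
  `|x - y| <= a -> `|y - z| <= b -> `|z - u| <= c -> `|u - w| <= d ->
  `|x - w| <= a + b + c + d.
Proof.
move=> xy yz zu uw.
have -> : x - w = (x - y) + (y - z) + (z - u) + (u - w) by rewrite !addrA !subrK.
exact: norm_le2 (norm_le3 xy yz zu (lexx _)) uw (lexx _).
Qed.

Lemma ler_sum_term (R : realType) (I : finType) (F : I -> R) : (forall k, 0 <= F k) ->
  forall i, F i <= \sum_k F k.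
Proof. by move=> F0 i; rewrite (bigD1 i)//= lerDl sumr_ge0. Qed.

Lemma ultra_eventually_inv (R : realType) (U : set_system nat) (c e : R) :
  \oo `<=` U -> 0 < e -> U [set k | c / k.+1%:R <= e].
Proof.
move=> U_oo e0; apply: U_oo; pose N := Num.truncn (c / e).
near=> k => /=.
have kN : (N <= k)%N by near: k; exact: nbhs_infty_ge.
rewrite ler_pdivrMr ?ltr0n// mulrC -ler_pdivrMr//.
have [ce|ce] := leP 0 (c / e); last by apply: ltW; apply: (lt_le_trans ce).
have /andP[_ /ltW h] := truncn_itv ce.
by apply: (le_trans h); rewrite ler_nat ltnS.
Unshelve. all: by end_near. Qed.

Lemma small01Z (R : realType) (n np : nat) (b a : R) (x : triple R n np) :
  0 <= b -> small01 a x -> small01 (b * a) (b *: x).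
Proof.
move=> b0 [[x1 x2 x3] x4]; split; first split=> [t||].
- have -> : yof (b *: x) t = b *: yof x t by [].
  by rewrite normrZ ger0_norm// ler_wpM2l.
- have -> : Tof (b *: x) = b * Tof x by [].
  by rewrite normrM ger0_norm// ler_wpM2l.
- have -> : pof (b *: x) = b *: pof x by [].
  by rewrite normrZ ger0_norm// ler_wpM2l.
- move=> s r; have -> : yof (b *: x) s - yof (b *: x) r = b *: (yof x s - yof x r).
    by rewrite scalerBr.
  by rewrite normrZ ger0_norm// -mulrA ler_wpM2l.
Qed.

Section Stability.
Context (R : realType) (tau : R) (n np lmax m : nat).
Hypothesis tau_gt0 : 0 < tau.
Hypothesis lmax_ge1 : (1 <= lmax)%N.
Hypothesis m_gt0 : (0 < m)%N.
Local Notation hist := (hist R n np).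
Local Notation triple := (triple R n np).
Variable G : hist -> 'rV[R]_n.
Variables (D : nat -> hist -> seq hist -> 'rV[R]_n) (X : nat -> hist * hist -> 'rV[R]_n).
Hypothesis DX : mild_family tau lmax G D X.
Variables (Raff : triple -> 'rV[R]_np.+1) (xs : triple).
Hypothesis Raff_affine : continuous_affine (@tri_C R n np 0) (@tri_norm R n np 0) Raff.
Hypothesis Ts_gt0 : 0 < Tof xs.
Hypothesis ys_smooth : smooth 1 (yof xs).
Hypothesis ys_periodic : one_periodic (yof xs).
Hypothesis lin_trivial : forall d, tri_C 1 d ->
  (forall t, derive1 (yof d) t = linop G X xs t d) -> linear_part Raff d = 0 -> d = 0.
Variables (Cmsh : R) (mesh : nat -> nat -> R) (tc : 'I_m -> R).
Hypothesis tc_inj : injective tc.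
Hypothesis tc_in : forall j, 0 < tc j < 1.
Hypothesis mesh_ok : forall L, (1 <= L)%N -> is_mesh L (mesh L) /\
  forall i, (i < L)%N -> mesh L i.+1 - mesh L i <= Cmsh / L%:R.

Let A t (d : triple) := linop G X xs t d.
Let rl (d : triple) := linear_part Raff d.
Let cp L i (j : 'I_m) := colloc_point (mesh L) tc i j.

Implicit Type d : triple.

Definition residual_le (L : nat) (d : triple) (c : R) : Prop :=
  (forall i j, (i < L)%N -> `|derive1 (yof d) (cp L i j) - A (cp L i j) d| <= c) /\
  `|rl d| <= c.

Lemma linear_partZ a d : tri_C 0 d -> rl (a *: d) = a *: rl d.
Proof.
move=> dC; have := Raff_affine.1 a d 0 dC (@tri_C0 R n np 0).
by rewrite addr0 /rl => ->; rewrite /linear_part subrr addr0.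
Qed.

Lemma linear_partB d d' : tri_C 0 d -> tri_C 0 d' -> rl (d - d') = rl d - rl d'.
Proof.
move=> dC dC'; have := Raff_affine.1 (-1) d' d dC' dC.
by rewrite !scaleN1r (addrC (- d')) /rl => ->; rewrite addrC.
Qed.

Lemma discrete_lipschitz L d K : (1 <= L)%N -> discrete m L (mesh L) d ->
  (forall i j, (i < L)%N -> `|derive1 (yof d) (cp L i j)| <= K) ->
  forall s r, `|yof d s - yof d r| <= lebesgue_constant tc * K * `|s - r|.
Proof.
move=> L1 [dp dc dq] H; apply: right_derivative_lipschitz => // x.
have [v [i [x' [iL _ _ _ [vD vB]]]]] :=
  right_derivative_near_colloc m_gt0 tc_inj tc_in (mesh_ok L1).1 x dq dp.
exists v => //; rewrite -[v]subr0; apply: vB => j; rewrite subr0; exact: H.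
Qed.

(** The constant depends on [L] and [d]; it only ensures that [tri_norm01 d] is a genuine Lipschitz
    norm. *)
Lemma discrete_small01 L d : (1 <= L)%N -> discrete m L (mesh L) d -> exists K, small01 K d.
Proof.
move=> L1 dd; have [dp dc dq] := dd.
pose K : R := \sum_(i < L) \sum_j `|derive1 (yof d) (cp L i j)|.
have KH i j : (i < L)%N -> `|derive1 (yof d) (cp L i j)| <= K.
  move=> iL.
  apply: (le_trans (ler_sum_term (fun j : 'I_m => normr_ge0 (derive1 (yof d) (cp L i j))) j)).
  pose F (i : 'I_L) : R := \sum_j `|derive1 (yof d) (cp L i j)|.
  have F0 k : 0 <= F k by apply: sumr_ge0 => l _; exact: normr_ge0.
  exact: (ler_sum_term F0 (Ordinal iL)).
have lip := discrete_lipschitz L1 dd KH.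
have [M M0 HM] := @continuous_bounded R _ _ 0 1 dc.
set C := lebesgue_constant tc * K in lip.
have C0 : 0 <= C.
  have := lip 1 0; rewrite subr0 normr1 mulr1; exact: le_trans.
have T0 := normr_ge0 (Tof d); have p0 := normr_ge0 (pof d).
exists (C + M + `|Tof d| + `|pof d|); split; [split|].
- move=> t; have [t' /andP[t0 t1] red] := periodic_reduce t.
  rewrite (red _ (yof d))//; apply: (le_trans (HM t' _)); last by lra.
  by rewrite t0 ltW.
- by lra.
- by lra.
- move=> s r; apply: (le_trans (lip s r)); apply: ler_wpM2r => //; lra.
Qed.

Section Limit.
Variables (U : set_system nat) (UU : UltraFilter U) (d : nat -> triple) (Lk : nat -> nat).
Hypothesis U_oo : \oo `<=` U.
Hypothesis Lk_ge : forall k, (k < Lk k)%N.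
Hypothesis d_discrete : forall k, discrete m (Lk k) (mesh (Lk k)) (d k).
Hypothesis d_small : forall k, small01 1 (d k).
Hypothesis d_residual : forall k, residual_le (Lk k) (d k) (k.+1%:R^-1).

Let Lk1 k : (1 <= Lk k)%N. Proof. by have := Lk_ge k; case: (Lk k). Qed.

(** The theorem of Arzela and Ascoli along an ultrafilter: limits exist pointwise, and the common
    Lipschitz constant 1 makes the convergence uniform. *)
Lemma ultra_limit_triple : exists x : triple,
  [/\ one_periodic (yof x), continuous (yof x)
   & forall e : R, 0 < e -> U [set k | small0 e (d k - x)]].
Proof.
have /choice[Y HY] : forall t, exists l, forall e : R, 0 < e ->
    U [set k | `|yof (d k) t - l| <= e].
  by move=> t; apply: (ultra_limit UU (c := 1)) => k; have [[H _ _] _] := d_small k.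
have [T HT] : exists l : R, forall e : R, 0 < e -> U [set k | `|Tof (d k) - l| < e].
  apply: (ultra_limit_real UU (a := -1) (b := 1)) => k; rewrite -ler_norml.
  by have [[_ H _] _] := d_small k.
have [p Hp] : exists l, forall e : R, 0 < e -> U [set k | `|pof (d k) - l| <= e].
  by apply: (ultra_limit UU (c := 1)) => k; have [[_ _ H] _] := d_small k.
have YL s t : `|Y s - Y t| <= `|s - t|.
  apply/ler_addgt0Pr => e e0; have e2 : 0 < e / 2 by rewrite divr_gt0.
  have [k [Hs Ht]] := @filter_ex _ U _ _ (filterI (HY s _ e2) (HY t _ e2)).
  have [_ /(_ s t)] := d_small k; rewrite mul1r => B.
  rewrite (_ : Y s - Y t = (yof (d k) s - yof (d k) t) + - (yof (d k) s - Y s)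
     + (yof (d k) t - Y t)); last by apply/rowP => j; rewrite !mxE; ring.
  by apply: (norm_le3 B _ Ht); [rewrite normrN; exact: Hs|lra].
have Yp : one_periodic Y.
  move=> t; apply/eqP; rewrite -subr_eq0 -normr_le0; apply/ler_addgt0Pr => e e0.
  have e2 : 0 < e / 2 by rewrite divr_gt0.
  have [k [Hs Ht]] := @filter_ex _ U _ _ (filterI (HY (t + 1) _ e2) (HY t _ e2)).
  have [dp _ _] := d_discrete k; rewrite /= dp in Hs.
  rewrite (_ : Y (t + 1) - Y t = - (yof (d k) t - Y (t + 1)) + (yof (d k) t - Y t)); last first.
    by apply/rowP => j; rewrite !mxE; ring.
  by apply: (norm_le2 _ Ht); [rewrite normrN; exact: Hs|lra].
have unif e : 0 < e -> U [set k | forall t, `|yof (d k) t - Y t| <= e].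
  move=> e0; set P := [set k | _].
  have [//|UP] := in_ultra_setVsetC P UU.
  (* Points where the uniform bound fails, with 0 as default. Their limit [t0] transfers the failure
     to a fixed point, where convergence is known. *)
  have /choice[t Ht] : forall k, exists t : R, 0 <= t <= 1 /\
      (~ P k -> e < `|yof (d k) t - Y t|).
    move=> k; have [Pk|nPk] := pselect (P k); first by exists 0; rewrite lexx ler01.
    have /existsNP[t /negP] := nPk; rewrite -ltNge => Ht.
    have [t' /andP[t0 t1] red] := periodic_reduce t.
    exists t'; rewrite t0 ltW//; split=> // _.
    rewrite -(red _ (fun t => `|yof (d k) t - Y t|))// => r.
    by have [dp _ _] := d_discrete k; rewrite dp Yp.
  have [t0 Ht0] := ultra_limit_real UU (fun k => (Ht k).1).
  have e4 : 0 < e / 4 by rewrite divr_gt0.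
  have [k [[nPk tk] yk]] := @filter_ex _ U _ _ (filterI (filterI UP (Ht0 _ e4)) (HY t0 _ e4)).
  have := (Ht k).2 nPk; rewrite ltNge => /negP[].
  have [_ /(_ (t k) t0)] := d_small k; rewrite mul1r => B1.
  have B2 := YL t0 (t k); rewrite (distrC t0) in B2.
  rewrite (_ : yof (d k) (t k) - Y (t k) = (yof (d k) (t k) - yof (d k) t0)
    + (yof (d k) t0 - Y t0) + (Y t0 - Y (t k))); last by apply/rowP => j; rewrite !mxE; ring.
  by apply: (norm_le3 B1 yk B2); move: tk => /= tk; lra.
exists (tri Y T p); split=> //.
  change (continuous Y); apply/continuousP_eps => s e e0; exists e => // r rs.
  exact: le_lt_trans (YL _ _) rs.
move=> e e0; apply: (filterS (F := U) _ (filterI (filterI (unif e e0) (HT e e0)) (Hp e e0))).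
by move=> k [[H1 H2] H3]; split; [exact: H1|exact: ltW|exact: H3].
Qed.

(** The limit [x] has derivative [phi]: the increments of [d k] are governed by right derivatives,
    these by nearby collocation values, and these by [phi] up to the residual and the error of [A].
    The bound passes to the limit, which makes [x] C^1 and a solution of the linearized problem. *)
Lemma limit_zero (e : R) : 0 < e -> U [set k | small0 e (d k)].
Proof.
have [x [xp xc xlim]] := ultra_limit_triple.
have [K [K0 HK]] := linop_bounded tau_gt0 DX lmax_ge1 Ts_gt0 ys_smooth ys_periodic.
have [K' [K'0 HK']] := affine_bounded Raff_affine.
have dc k : continuous (yof (d k)) by have [_] := d_discrete k.
have dp k : one_periodic (yof (d k)) by have [] := d_discrete k.
have Adiff k c t : small0 c (d k - x) -> `|A t (d k) - A t x| <= K * c.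
  move=> H; rewrite -(linopB tau_gt0 DX lmax_ge1 ys_smooth t (dc k) xc).
  apply: HK H => [s|s]; first by apply: cvgB; [exact: dc|exact: xc].
  by congr (_ - _); [exact: dp|exact: xp].
pose phi t := A t x.
have phic : continuous phi.
  exact (@linop_continuous R tau n np lmax tau_gt0 G D X DX lmax_ge1 xs Ts_gt0 ys_smooth x xc).
have phip : one_periodic phi by move=> t; exact: (linop_periodic G X ys_smooth ys_periodic t xp).
set Lam := lebesgue_constant tc.
have Lam0 : 0 <= Lam by exact: lebesgue_constant_ge0.
have xD t : hasD (yof x) t (phi t).
  (* Four errors of size [e1] meet at a collocation point and are amplified by [Lam]. *)
  move=> e' e'0; pose e1 := e' / (4 * (Lam + 1)).
  have L10 : 0 < 4 * (Lam + 1) by rewrite mulr_gt0// ltr_wpDl.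
  have e10 : 0 < e1 by rewrite divr_gt0.
  have Le1 : Lam * (e1 + e1 + e1 + e1) <= e'.
    rewrite (_ : Lam * _ = Lam * (4 * e1)); last by ring.
    rewrite /e1 [4 * _]mulrCA invfM [4 * _]mulrA divff ?pnatr_eq0// mul1r mulrCA.
    by rewrite ger_pMr// ler_pdivrMr ?ltr_wpDl// mul1r lerDl.
  have [r r0 Hr] := periodic_uniform phic phip e10.
  exists r => // s st.
  have key a b : a <= b -> (forall z, a <= z < b -> `|z - t| < r) -> 
      `|(yof x b - b *: phi t) - (yof x a - a *: phi t)| <= e' * (b - a).
    move=> ab zr; apply/ler_addgt0Pr => e2 e20.
    have e22 : 0 < e2 / 2 by rewrite divr_gt0.
    have e1K : 0 < Num.min (e1 / K) (e2 / 2) by rewrite lt_min e22 divr_gt0.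
    have r2 : 0 < r / 2 by rewrite divr_gt0.
    (* The index is chosen after [a], [b] and [e2], with small residual, small distance to [x], and
       mesh width at most [r / 2]. *)
    have [k [[ks k1] kC]] := @filter_ex _ U _ _ (filterI (filterI (xlim _ e1K)
      (ultra_eventually_inv 1 U_oo e10)) (ultra_eventually_inv `|Cmsh| U_oo r2)).
    have ks1 : small0 (e1 / K) (d k - x) by apply: small0W ks; rewrite ge_min lexx.
    have [ks2 _ _] : small0 (e2 / 2) (d k - x) by apply: small0W ks; rewrite ge_min lexx orbT.
    have zc : continuous (fun z : R => yof (d k) z - z *: phi t).
      move=> z; apply: cvgB; [exact: dc|apply: cvgZ; [exact: cvg_id|exact: cvg_cst]].
    have B : `|(yof (d k) b - b *: phi t) - (yof (d k) a - a *: phi t)| <= e' * (b - a).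
      apply: (right_derivative_increment zc ab) => z zab.
      have [_ _ dq] := d_discrete k; have [msh step] := mesh_ok (Lk1 k).
      have [v [i [x' [iL _ /andP[x'1 x'2] red [vD vB]]]]] :=
        right_derivative_near_colloc m_gt0 tc_inj tc_in msh z dq (dp k).
      exists (v - phi t) => [e3 e30|].
        have [r3 r30 H] := vD e3 e30; exists r3 => // u uI.
        rewrite (_ : _ - _ - _ = yof (d k) u - yof (d k) z - (u - z) *: v); first exact: H.
        by apply/rowP => j; rewrite !mxE; ring.
      apply: le_trans Le1; apply: vB => j.
      have /andP[c1 c2] := colloc_in tc_in msh j iL.
      have cr : `|cp (Lk k) i j - x'| < r.
        have stepr : mesh (Lk k) i.+1 - mesh (Lk k) i <= r / 2.
          apply: (le_trans (step i iL)); apply: le_trans kC.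
          apply: (@le_trans _ _ (`|Cmsh| / (Lk k)%:R)).
            by rewrite ler_wpM2r ?invr_ge0// ler_norm.
          have Lk0 : 0 < (Lk k)%:R :> R by rewrite ltr0n; exact: Lk1.
          apply: ler_wpM2l; first exact: normr_ge0.
          by rewrite lef_pV2 ?posrE ?ltr0Sn// ler_nat; exact: Lk_ge.
        rewrite ltr_norml; move: c1 c2; rewrite -/(cp (Lk k) i j) => c1 c2.
        by apply/andP; split; lra.
      have B1 := (d_residual k).1 i j iL.
      have B2 := Adiff k _ (cp (Lk k) i j) ks1; rewrite mulrC divfK ?gt_eqF// in B2.
      have B3 := ltW (Hr _ _ cr).
      have B4 := ltW (Hr _ _ (zr z zab)); rewrite (red _ phi phip) in B4.
      move: k1 => /=; rewrite mul1r => k1.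
      exact: (norm_telescope4 (le_trans B1 k1) B2 B3 B4).
    have Ba := ks2 a; have Bb := ks2 b.
    rewrite (_ : _ - _ = (yof (d k) b - b *: phi t - (yof (d k) a - a *: phi t))
      + (yof (d k) a - yof x a) + - (yof (d k) b - yof x b)); last first.
      by apply/rowP => l; rewrite !mxE; ring.
    apply: (norm_le3 B Ba); first by rewrite normrN; exact: Bb.
    by rewrite -addrA -splitr.
  rewrite (_ : _ - _ = (yof x s - s *: phi t) - (yof x t - t *: phi t)); last first.
    by apply/rowP => l; rewrite !mxE; ring.
  have [ts|ts] := leP t s.
    rewrite (ger0_norm (_ : 0 <= s - t)) ?subr_ge0//; apply: key => // z /andP[z1 z2].
    rewrite ger0_norm ?subr_ge0//; apply: le_lt_trans st.
    by rewrite ger0_norm ?subr_ge0// lerD2r ltW.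
  rewrite distrC [`|s - t|]distrC (ger0_norm (_ : 0 <= t - s)) ?subr_ge0 ?(ltW ts)//.
  apply: key => [|z /andP[z1 z2]]; first exact: ltW.
  move: st; rewrite ltr0_norm ?subr_lt0// ltr0_norm ?subr_lt0// => st.
  by lra.
have xs1 : smooth 1 (yof x) by apply: (smoothS_hasD xD); apply: smooth0.
have x0 : x = 0.
  apply: lin_trivial; first by apply/CpiP; split.
    by move=> t; rewrite (hasD_derivable (xD t)).2.
  have xC0 : tri_C 0 x by apply/CpiP; split; [|exact: smooth0].
  apply/eqP; rewrite -normr_le0; apply/ler_addgt0Pr => e' e'0; rewrite add0r.
  have e'2 : 0 < e' / 2 by rewrite divr_gt0.
  have [k [k1 k2]] := @filter_ex _ U _ _ (filterI (xlim _ (divr_gt0 e'2 K'0))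
    (ultra_eventually_inv 1 U_oo e'2)).
  move: k2 => /=; rewrite mul1r => k2.
  have dC := discrete_tri_C (d_discrete k).
  have dxC : tri_C 0 (d k - x).
    by have := tri_C_linear (-1) xC0 dC; rewrite scaleN1r addrC.
  have B1 := HK' _ _ dxC k1; rewrite mulrC divfK ?gt_eqF// in B1.
  have B2 := le_trans (d_residual k).2 k2.
  rewrite -/(rl (d k - x)) (linear_partB dC xC0) in B1.
  rewrite -/(rl x) (_ : rl x = rl (d k) + - (rl (d k) - rl x)); last by rewrite opprB addrC subrK.
  by apply: (norm_le2 B2); [rewrite normrN; exact: B1|rewrite -splitr].
by move=> e0; apply: (filterS (F := U) _ (xlim e e0)) => k; rewrite x0 /= subr0.
Qed.

End Limit.

(** The counterexamples tend to 0 in C^0, so [A] and the residuals become small at the collocation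
    points; this bounds their Lipschitz constants by 1/2 as well. The bound 1/2 instead of 1 is what
    [stability] contradicts after scaling. *)
Lemma small_residual_half : exists2 e : R, 0 < e & exists L0, forall L, (L0 < L)%N ->
  forall d, discrete m L (mesh L) d -> small01 1 d -> residual_le L d e -> small01 (1 / 2) d.
Proof.
apply: contrapT => H.
have /choice[Ld HLd] : forall k, exists Ld : nat * triple,
    [/\ (k < Ld.1)%N, discrete m Ld.1 (mesh Ld.1) Ld.2, small01 1 Ld.2,
      residual_le Ld.1 Ld.2 k.+1%:R^-1 & ~ small01 (1 / 2) Ld.2].
  move=> k; apply: contrapT => nLd; apply: H.
  exists k.+1%:R^-1; first by rewrite invr_gt0 ltr0Sn.
  exists k => L kL d dd d1 dr; apply: contrapT => nd.
  by apply: nLd; exists (L, d).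
have [U [UU U_oo]] := ultraFilterLemma eventually_filter.
pose Lk k := (Ld k).1; pose d k := (Ld k).2.
have H1 k : (k < Lk k)%N by case: (HLd k).
have H2 k : discrete m (Lk k) (mesh (Lk k)) (d k) by case: (HLd k).
have H3 k : small01 1 (d k) by case: (HLd k).
have H4 k : residual_le (Lk k) (d k) k.+1%:R^-1 by case: (HLd k).
have H5 k : ~ small01 (1 / 2) (d k) by case: (HLd k).
have zero := limit_zero UU U_oo H1 H2 H3 H4.
have [K [K0 HK]] := linop_bounded tau_gt0 DX lmax_ge1 Ts_gt0 ys_smooth ys_periodic.
set Lam := lebesgue_constant tc.
have Lam0 : 0 <= Lam by exact: lebesgue_constant_ge0.
pose e := 1 / (4 * (Lam + 1)).
have L10 : 0 < 4 * (Lam + 1) by rewrite mulr_gt0// ltr_wpDl.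
have e0 : 0 < e by rewrite divr_gt0.
have Le : Lam * (e + e) <= 1 / 2.
  rewrite /e (_ : Lam * _ = (1 / 2) * (Lam / (Lam + 1))); last by field;
    rewrite lt0r_neq0// ltr_wpDl.
  by rewrite ger_pMr ?divr_gt0// ler_pdivrMr ?ltr_wpDl// mul1r lerDl.
have eK : 0 < Num.min (e / K) (1 / 2) by rewrite lt_min !divr_gt0.
have [k [k1 k2]] := @filter_ex _ U _ _ (filterI (zero _ eK) (ultra_eventually_inv 1 U_oo e0)).
move: k2 => /=; rewrite mul1r => k2.
have s1 : small0 (e / K) (d k) by apply: small0W k1; rewrite ge_min lexx.
have s2 : small0 (1 / 2) (d k) by apply: small0W k1; rewrite ge_min lexx orbT.
have [dp dc dq] := H2 k; have Lk1 : (1 <= Lk k)%N by exact: leq_ltn_trans (H1 k).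
apply: (H5 k); split=> // s r.
have lip := discrete_lipschitz Lk1 (H2 k) (K := e + e) _ s r.
apply: (le_trans (lip _)) => [i j iL|]; last by rewrite ler_wpM2r.
have B1 := le_trans ((H4 k).1 i j iL) k2.
have B2 := HK (cp (Lk k) i j) _ _ dc dp s1; rewrite mulrC divfK ?gt_eqF// in B2.
rewrite -[X in `|X|](subrK (A (cp (Lk k) i j) (d k))).
exact: norm_le2 B1 B2 (lexx _).
Qed.

Lemma linopZ t a d : continuous (yof d) -> A t (a *: d) = a *: A t d.
Proof.
move=> dc; have zc : continuous (yof (0 : triple)) by move=> s; exact: cvg_cst.
have E := linop_linear tau_gt0 DX lmax_ge1 ys_smooth t a dc zc.
have := linopB tau_gt0 DX lmax_ge1 ys_smooth t zc zc; rewrite !subrr => Z.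
by move: E; rewrite addr0 /A => ->; rewrite Z addr0.
Qed.

(** If the norm [nu] exceeded [e^-1 * c], then [nu^-1 *: d] would have residual at most [e], hence
    norm at most 1/2, although its norm is 1. *)
Lemma stability : exists2 K : R, 0 < K & exists L0, forall L, (L0 < L)%N ->
  forall d c, discrete m L (mesh L) d -> residual_le L d c -> small01 (K * c) d.
Proof.
have [e e0 [L0 H]] := small_residual_half.
exists e^-1; first by rewrite invr_gt0.
exists L0 => L L0L d c dd [dr1 dr2].
have L1 : (1 <= L)%N by exact: leq_ltn_trans L0L.
have ds := discrete_small01 L1 dd; have dC := discrete_tri_C dd.
have [dp dc dq] := dd.
pose nu := tri_norm01 d.
have dnu : small01 nu d by exact: small01_tri_norm01.
have [nuc|nuc] := leP nu (e^-1 * c); first exact: small01W nuc dnu.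
have c0 : 0 <= c by exact: le_trans dr2.
have nu0 : 0 < nu by apply: le_lt_trans nuc; rewrite mulr_ge0// invr_ge0 ltW.
have inu0 : 0 <= nu^-1 by rewrite invr_ge0 ltW.
have /H : (L0 < L)%N by []. move=> /(_ (nu^-1 *: d) (discreteZ nu^-1 dd)) Hd.
have n1 : small01 1 (nu^-1 *: d).
  by have := small01Z inu0 dnu; rewrite mulVf ?gt_eqF.
have cnu : nu^-1 * c <= e.
  by rewrite ler_pdivrMl// mulrC -ler_pdivrMl// ltW.
have rr : residual_le L (nu^-1 *: d) e.
  split=> [i j iL|]; last first.
    rewrite linear_partZ// normrZ ger0_norm//; apply: le_trans cnu.
    by rewrite ler_wpM2l.
  have cD := colloc_hasD m_gt0 tc_inj tc_in (mesh_ok L1).1 j dq iL.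
  have := hasD_derivable (hasDZ nu^-1 cD); rewrite -/(cp L i j) => -[_ E].
  have -> : derive1 (yof (nu^-1 *: d)) (cp L i j) = nu^-1 *: derive1 (yof d) (cp L i j).
    by rewrite -E.
  rewrite linopZ// -scalerBr normrZ ger0_norm//; apply: le_trans cnu.
  by apply: ler_wpM2l => //; exact: dr1.
have /(small01Z (ltW nu0)) := Hd n1 rr.
rewrite scalerA divff ?gt_eqF// scale1r => /tri_norm01_le; rewrite -/nu => B.
have : nu * (1 / 2) < nu by rewrite gtr_pMr// ltr_pdivrMr// mul1r ltr1n.
by rewrite ltNge B.
Qed.

End Stability.

(** * Nodal basis *)

Section Glue.
Context (R : realType) (n L : nat) (t : nat -> R).
Hypothesis mesh : is_mesh L t.
Hypothesis L_gt0 : (0 < L)%N.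

Lemma mesh_mono i j : (i <= j)%N -> (j <= L)%N -> t i <= t j.
Proof.
have [_ _ tS] := mesh; move=> /subnK <-; elim: (j - i)%N => [//|k IH] kL.
by rewrite addSn; apply: le_trans (IH (ltnW kL)) (ltW (tS _ kL)).
Qed.

Lemma mesh_locate_unique i j (s : R) : (i < L)%N -> (j < L)%N ->
  t i <= s < t i.+1 -> t j <= s < t j.+1 -> i = j.
Proof.
move=> iL jL /andP[i1 i2] /andP[j1 j2].
have aux k l : (k < l)%N -> (l < L)%N -> t l <= s -> s < t k.+1 -> False.
  move=> kl lL ls sk; have B : t k.+1 <= t l by apply: mesh_mono => //; exact: ltnW.
  by have := lt_le_trans sk (le_trans B ls); rewrite ltxx.
apply/eqP; rewrite eqn_leq; apply/andP; split; rewrite leqNgt; apply/negP => ij.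
- exact: aux ij iL i1 j2.
- exact: aux ij jL j1 i2.
Qed.

Lemma mesh_locate_left (s : R) : 0 < s <= 1 -> exists2 i : nat, (i < L)%N & t i < s <= t i.+1.
Proof.
move=> /andP[s0 s1]; have [t0 tL _] := mesh.
have : exists i, (s <= t i) by exists L; rewrite tL.
move=> /ex_minnP[[|i] si mini]; first by move: si; rewrite t0 leNgt s0.
exists i; last by rewrite si andbT ltNge; apply/negP => /mini; rewrite ltnn.
by apply: mini; rewrite tL.
Qed.

(** The interval index and the representative in [0, 1) are selected independently of [f], so the
    glued function depends linearly on its pieces. *)
Lemma glue_exists : exists (idx : R -> nat) (red : R -> R),
  forall f : nat -> R -> 'rV[R]_n, (forall i, (i < L)%N -> continuous (f i)) ->
  (forall i, (i.+1 < L)%N -> f i (t i.+1) = f i.+1 (t i.+1)) -> f L.-1 1 = f 0%N 0 ->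
  let y s := f (idx s) (red s) in
  [/\ one_periodic y, continuous y &
    forall i s, (i < L)%N -> t i <= s <= t i.+1 -> y s = f i s].
Proof.
have [t0 tL tS] := mesh.
have /choice[idx0 Hidx] : forall r, exists i, 0 <= r < 1 -> (i < L)%N /\ t i <= r < t i.+1.
  move=> r; have [/(mesh_locate mesh)[i iL iI]|nr] := boolP (0 <= r < 1).
    by exists i.
  by exists 0%N.
pose red (s : R) := s - (Num.floor s)%:~R.
have redI s : 0 <= red s < 1.
  have /andP[f1 f2] := floor_itv s; rewrite intrD in f2.
  by apply/andP; split; rewrite /red; lra.
have red1 s : red (s + 1) = red s.
  rewrite /red (_ : Num.floor (s + 1) = Num.floor s + 1); last first.
    by rewrite (floorDrz _ (rpred1 _)) floor1.
  by rewrite intrD; ring.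
have red_id s : 0 <= s < 1 -> red s = s.
  by move=> sI; rewrite /red (_ : Num.floor s = 0) ?subr0//; apply/eqP; rewrite floor_eq.
exists (idx0 \o red), red => f fc fm f1 y.
have yp : one_periodic y by move=> s; rewrite /y /= red1.
have yE i s : (i < L)%N -> t i <= s <= t i.+1 -> y s = f i s.
  move=> iL /andP[s1 s2]; have iI := mesh_in01 mesh (ltnW iL).
  have iI1 := mesh_in01 mesh iL.
  have s0 : 0 <= s by case/andP: iI => h _; exact: le_trans s1.
  have [s3|s3] := ltP s 1.
    have sI : 0 <= s < 1 by rewrite s0.
    have [jL jI] := Hidx s sI; rewrite /y /= red_id//.
    have [s4|s4] := ltP s (t i.+1).
      by rewrite (mesh_locate_unique jL iL jI)// s1.
    have E : s = t i.+1 by apply/eqP; rewrite eq_le s2.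
    have iL1 : (i.+1 < L)%N.
      rewrite ltn_neqAle iL andbT; apply/eqP => iLE; move: s3.
      by rewrite E iLE tL ltxx.
    have -> : idx0 s = i.+1.
      by apply: (mesh_locate_unique jL iL1 jI); rewrite E lexx tS.
    by rewrite E fm.
  have iL1 : i.+1 = L.
    apply/eqP; rewrite eqn_leq iL leqNgt; apply/negP => iL1.
    have := le_lt_trans (le_trans s3 s2) (lt_le_trans (tS _ iL1) (mesh_mono iL1 (leqnn L))).
    by rewrite tL ltxx.
  have -> : s = 1 by apply/eqP; rewrite eq_le s3 andbT; apply: (le_trans s2); rewrite iL1 tL.
  have -> : f i 1 = f 0%N 0 by rewrite -f1 -iL1.
  have z0 : 0 <= (0 : R) < 1 by apply/andP; split; [exact: lexx|exact: ltr01].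
  have [jL jI] := Hidx 0 z0.
  rewrite /y /= -[1]add0r red1 red_id//.
  by rewrite (mesh_locate_unique jL L_gt0 jI)// t0 lexx -t0 tS.
split=> //; apply/continuousP_eps => s e e0.
have [x /andP[x0 x1] xred] := periodic_reduce s.
have shift r : y r = y (r - s + x).
  rewrite -(xred _ (fun u => y (r - s + u))); first by rewrite subrK.
  by move=> u; rewrite addrA yp.
have xI : 0 <= x < 1 by rewrite x0.
have [i iL /andP[i1 i2]] := mesh_locate mesh xI.
have [d1 d10 H1] := (continuousP_eps (f i)).1 (fc i iL) x e e0.
(* Continuity from the left uses the interval that is closed on the right. For [x = 0] this is the
   last one, entered through [x' = 1]. *)
have [j [x' [jL /andP[j1 j2] x'red]]] : exists j x', [/\ (j < L)%N, t j < x' <= t j.+1 &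
    forall r, y (r + x) = y (r + x')].
  have [x00|xn0] := eqVneq x 0; last first.
    have xI' : 0 < x <= 1 by rewrite lt0r xn0 x0 ltW.
    by have [j jL jI] := mesh_locate_left xI'; exists j, x.
  have I01 : 0 < (1 : R) <= 1 by apply/andP; split; [exact: ltr01|exact: lexx].
  have [j jL jI] := mesh_locate_left I01.
  by exists j, 1; split=> // r; rewrite x00 addr0 yp.
have [d2 d20 H2] := (continuousP_eps (f j)).1 (fc j jL) x' e e0.
exists (Num.min (Num.min d1 (t i.+1 - x)) (Num.min d2 (x' - t j))).
  by rewrite !lt_min d10 d20 !subr_gt0 i2 j1.
move=> r; rewrite !lt_min => /andP[/andP[r1 r2] /andP[r3 r4]].
rewrite shift (shift s) subrr; have [sr|rs] := leP s r.
  rewrite ger0_norm ?subr_ge0// in r1 r2.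
  have -> : y (0 + x) = f i x by rewrite add0r; apply: yE => //; rewrite i1 ltW.
  rewrite (yE i _ iL); last by apply/andP; split; lra.
  by apply: H1; rewrite addrK ger0_norm ?subr_ge0.
rewrite !x'red; rewrite ltr0_norm ?subr_lt0// in r3 r4.
have -> : y (0 + x') = f j x' by rewrite add0r; apply: yE => //; rewrite j2 ltW.
rewrite (yE j _ jL); last by apply/andP; split; lra.
by apply: H2; rewrite addrK ltr0_norm ?subr_lt0.
Qed.

End Glue.

Section NodalBasis.
Context (R : realType) (n m L : nat) (t : nat -> R).
Hypothesis m_gt0 : (0 < m)%N.
Hypothesis mesh : is_mesh L t.
Hypothesis L_gt0 : (0 < L)%N.

(** Equidistant nodes including both end points: continuity across a mesh point becomes equality of
    two nodal values. *)
Definition node (k : 'I_m.+1) : R := k%:R / m%:R.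

Let m0 : m%:R != 0 :> R. Proof. by rewrite pnatr_eq0 -lt0n. Qed.

Lemma node_inj : injective node.
Proof.
move=> k l /(congr1 (fun x => x * m%:R)); rewrite /node !divfK// => /eqP.
by rewrite eqr_nat => /eqP/val_inj.
Qed.

Lemma node_in01 k : 0 <= node k <= 1.
Proof.
rewrite /node; apply/andP; split; first by rewrite divr_ge0 ?ler0n.
by rewrite ler_pdivrMr ?ltr0n// mul1r ler_nat -ltnS.
Qed.

Definition nodal (W : nat -> 'I_m.+1 -> 'rV[R]_n) i (s : R) : 'rV[R]_n :=
  \sum_k (lagrange_poly node k).[(s - t i) / (t i.+1 - t i)] *: W i k.

Lemma nodal_poly W i c : exists2 q : {poly R}, (size q <= m.+1)%N &
  forall s, nodal W i s ord0 c = q.[s].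
Proof.
pose h := (t i.+1 - t i)^-1.
pose p := \sum_k W i k ord0 c *: lagrange_poly node k.
pose l : {poly R} := h *: 'X + (- t i * h)%:P.
exists (p \Po l).
  have [->|p0] := eqVneq p 0; first by rewrite comp_poly0 size_poly0.
  apply: (leq_trans (size_comp_poly_leq _ _)).
  have sp : (size p <= m.+1)%N.
    apply: (leq_trans (size_sum _ _ _)); apply/bigmax_leqP => k _.
    by apply: (leq_trans (size_scale_leq _ _)); exact: size_lagrange_poly.
  have sl : ((size l).-1 <= 1)%N.
    rewrite /l -mul_polyC -subn1 leq_subLR.
    by rewrite size_MXaddC; case: ifP => // _; rewrite ltnS size_polyC leq_b1.
  have sp1 : (0 < size p)%N by rewrite size_poly_gt0.
  rewrite -(prednK sp1) in sp; apply: leq_trans sp; rewrite ltnS.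
  by rewrite -[leqRHS]muln1 leq_mul.
move=> s; rewrite horner_comp /p horner_sum /nodal summxE.
apply: eq_bigr => k _; rewrite mxE hornerZ mulrC; congr (_ * _.[_]).
by rewrite /l hornerD hornerZ hornerX hornerC /h; ring.
Qed.

Lemma nodal_continuous W i : continuous (nodal W i).
Proof.
apply: hasD_continuous => s.
have /choice[q Hq] : forall c, exists q : {poly R}, forall s, nodal W i s ord0 c = q.[s].
  by move=> c; have [q _ H] := nodal_poly W i c; exists q.
exists (\row_c (q c)^`().[s]); apply: hasD_rV => c; rewrite mxE.
by apply: hasD_ext (hasD_horner (q c) s) => r; rewrite Hq.
Qed.

Lemma nodal_node W i k : (i < L)%N -> nodal W i (t i + (t i.+1 - t i) * node k) = W i k.
Proof.
move=> iL; have h0 := step_gt0 mesh iL.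
rewrite /nodal (addrC (t i)) addrK mulrAC divff ?gt_eqF// mul1r.
rewrite (bigD1 k)//= lagrange_poly_node; last exact: node_inj.
rewrite eqxx scale1r big1 ?addr0// => l lk.
by rewrite lagrange_poly_node ?(negPf lk) ?scale0r//; exact: node_inj.
Qed.

Lemma nodal_left W i : (i < L)%N -> nodal W i (t i) = W i ord0.
Proof. by move=> iL; rewrite -(nodal_node W ord0 iL) /node mul0r mulr0 addr0. Qed.

Lemma nodal_right W i : (i < L)%N -> nodal W i (t i.+1) = W i ord_max.
Proof.
by move=> iL; rewrite -(nodal_node W ord_max iL) /node divff// mulr1 addrC subrK.
Qed.

Lemma nodal_glue : exists (idx : R -> nat) (red : R -> R),
  forall W : nat -> 'I_m.+1 -> 'rV[R]_n,
  (forall i, (i.+1 < L)%N -> W i ord_max = W i.+1 ord0) -> W L.-1 ord_max = W 0%N ord0 ->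
  let y s := nodal W (idx s) (red s) in
  [/\ one_periodic y, continuous y, piecewise_poly m L t y &
    forall i s, (i < L)%N -> t i <= s <= t i.+1 -> y s = nodal W i s].
Proof.
have [idx [red H]] := @glue_exists R n L t mesh L_gt0.
have [t0 tL _] := mesh; have LL : (L.-1 < L)%N by rewrite prednK.
exists idx, red => W Wi WL y.
have [|||yp yc yE] := H (nodal W).
- by move=> i _; exact: nodal_continuous.
- by move=> i iL; rewrite nodal_right ?nodal_left ?Wi// ltnW.
- have := nodal_right W LL; rewrite prednK// tL => ->.
  by have := nodal_left W L_gt0; rewrite t0 => ->.
split=> // i iL c; have [q q1 q2] := nodal_poly W i c.
by exists q => // s; rewrite in_itv /= => sI; rewrite -q2 -(yE i s iL sI).
Qed.

End NodalBasis.

Lemma linear_injective_surjective (F : fieldType) (N : nat) (S : 'rV[F]_N -> 'rV[F]_N) :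
  (forall a x y, S (a *: x + y) = a *: S x + S y) -> (forall x, S x = 0 -> x = 0) ->
  forall b, exists x, S x = b.
Proof.
move=> lin ker b.
pose Sl : {linear 'rV[F]_N -> 'rV[F]_N} := HB.pack S (GRing.isLinear.Build _ _ _ _ S lin).
have free : row_free (lin1_mx Sl).
  rewrite -kermx_eq0; apply/eqP/row_matrixP => i; rewrite row0; apply: ker.
  have := mul_rV_lin1 Sl (row i (kermx (lin1_mx Sl))); rewrite /= => <-.
  by rewrite -row_mul mulmx_ker row0.
exists (b *m invmx (lin1_mx Sl)).
have := mul_rV_lin1 Sl (b *m invmx (lin1_mx Sl)); rewrite /= => <-.
by rewrite mulmxKV// -row_free_unit.
Qed.

(* The residuals at the collocation points, together with the affine boundary
   residual, have as many components as the nodal values together with the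
   period and the parameters, so the same coordinates serve for both. *)
Lemma residual_coordinates (R : realType) (n q m L : nat) : (0 < L)%N ->
  exists (N : nat) (pack : (nat -> 'I_m -> 'rV[R]_n) -> 'rV[R]_q -> 'rV[R]_N)
    (p1 : 'rV[R]_N -> nat -> 'I_m -> 'rV[R]_n) (p2 : 'rV[R]_N -> 'rV[R]_q),
  [/\ forall h1 h2 i j, (i < L)%N -> p1 (pack h1 h2) i j = h1 i j,
      forall h1 h2, p2 (pack h1 h2) = h2,
      forall a x z i j, p1 (a *: x + z) i j = a *: p1 x i j + p1 z i j,
      forall a x z, p2 (a *: x + z) = a *: p2 x + p2 z
    & forall x c, 0 <= c -> (`|x| <= c <->
        (forall i j, (i < L)%N -> `|p1 x i j| <= c) /\ `|p2 x| <= c)].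
Proof.
move=> L_gt0; pose I : finType := (('I_L * 'I_m * 'I_n) + 'I_q)%type.
(* Reduction modulo [L] makes the coordinates total in [i]; it is the identity below [L]. *)
pose oL i : 'I_L := Ordinal (ltn_pmod i L_gt0).
have oLE (i : 'I_L) : oL i = i by apply: val_inj; rewrite /= modn_small.
pose u (h1 : nat -> 'I_m -> 'rV[R]_n) (h2 : 'rV[R]_q) (k : I) : R :=
  match k with inl (i, j, c) => h1 i j ord0 c | inr c => h2 ord0 c end.
pose co (x : 'rV[R]_#|I|) (k : I) : R := x ord0 (enum_rank k).
have coD a x z k : co (a *: x + z) k = a * co x k + co z k by rewrite /co !mxE.
exists #|I|, (fun h1 h2 => \row_k u h1 h2 (enum_val k)),
  (fun x i j => \row_c co x (inl (oL i, j, c))), (fun x => \row_c co x (inr c)).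
split.
- move=> h1 h2 i j iL; apply/rowP => c.
  by rewrite /co !mxE enum_rankK /u (oLE (Ordinal iL)).
- by move=> h1 h2; apply/rowP => c; rewrite /co !mxE enum_rankK.
- by move=> a x z i j; apply/rowP => c; rewrite !mxE coD.
- by move=> a x z; apply/rowP => c; rewrite !mxE coD.
move=> x c c0; split=> [xc|[H1 H2]].
  by split=> [i j _|]; apply: rV_norm_le => // l; rewrite mxE; apply: le_trans xc; exact:
    rV_norm_ge.
apply: rV_norm_le => // k; rewrite -[k]enum_valK -/(co x (enum_val k)).
case: (enum_val k) => [[[i j] l]|l].
  by have := le_trans (rV_norm_ge _ l) (H1 i j (ltn_ord i)); rewrite mxE oLE.
by have := le_trans (rV_norm_ge _ l) H2; rewrite mxE.
Qed.

Section Surjectivity.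
Context (R : realType) (n np m L : nat) (t : nat -> R).
Hypothesis m_gt0 : (0 < m)%N.
Hypothesis mesh : is_mesh L t.
Hypothesis L_gt0 : (0 < L)%N.
Local Notation triple := (triple R n np).

(** [E] embeds the coordinate space linearly into the discrete functions, and the residuals have the
    same number of coordinates, so injectivity gives surjectivity. *)
Lemma collocation_surjective (S1 : triple -> nat -> 'I_m -> 'rV[R]_n) (S2 :
  triple -> 'rV[R]_np.+1) :
  (forall a x z, discrete m L t x -> discrete m L t z ->
     (forall i j, (i < L)%N -> S1 (a *: x + z) i j = a *: S1 x i j + S1 z i j) /\
     S2 (a *: x + z) = a *: S2 x + S2 z) ->
  (forall x, discrete m L t x -> (forall i j, (i < L)%N -> S1 x i j = 0) -> S2 x = 0 -> x = 0) ->
  forall g1 g2, exists x, [/\ discrete m L t x, forall i j, (i < L)%N -> S1 x i j = g1 i j & S2 x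
    = g2].
Proof.
move=> lin ker g1 g2.
have [idx [red glue]] := @nodal_glue R n m L t m_gt0 mesh L_gt0.
have [N [pack [p1 [p2 [pk1 pk2 p1D p2D normP]]]]] := @residual_coordinates R n np.+1 m L L_gt0.
have ext x z : (forall i j, (i < L)%N -> p1 x i j = p1 z i j) -> p2 x = p2 z -> x = z.
  move=> H1 H2; apply/eqP; rewrite -subr_eq0 -normr_le0 addrC -scaleN1r; apply/normP => //.
  split=> [i j iL|]; first by rewrite p1D H1// scaleN1r addNr normr0.
  by rewrite p2D H2 scaleN1r addNr normr0.
pose k0 : 'I_m := Ordinal m_gt0.
(* Each interval owns its first [m] nodes; the last one borrows the first value of the next interval
   modulo [L], which builds in continuity and periodicity. *)
pose W z (i : nat) (k : 'I_m.+1) : 'rV[R]_n :=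
  if insub (k : nat) is Some k' then p1 z i k' else p1 z (i.+1 %% L)%N k0.
pose E z : triple := tri (fun s => nodal t (W z) (idx s) (red s)) (p2 z ord0 ord0)
  (\row_c p2 z ord0 (lift ord0 c)).
have WD a x z i k : W (a *: x + z) i k = a *: W x i k + W z i k.
  by rewrite /W; case: insub => [k'|]; rewrite p1D.
have ED a x z : E (a *: x + z) = a *: E x + E z.
  rewrite /E /tri; congr (_, _, _).
  - apply/funext => s; rewrite /nodal [RHS](_ : _ = a *: nodal t (W x) (idx s) (red s) +
      nodal t (W z) (idx s) (red s))//.
    rewrite /nodal scaler_sumr -big_split; apply: eq_bigr => k _ /=.
    by rewrite WD scalerDr !scalerA mulrC.
  - by rewrite p2D !mxE.
  - by apply/rowP => c; rewrite !mxE p2D !mxE.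
have WM z i : W z i ord_max = p1 z (i.+1 %% L)%N k0 by rewrite /W insubF//= ltnn.
have WI z i (k : 'I_m.+1) (km : (k < m)%N) : W z i k = p1 z i (Ordinal km).
  by rewrite /W insubT.
have W0 z i : W z i ord0 = p1 z i k0 by rewrite (WI z i ord0 m_gt0).
have W1 z i : (i.+1 < L)%N -> W z i ord_max = W z i.+1 ord0.
  by move=> iL; rewrite WM W0 modn_small.
have W2 z : W z L.-1 ord_max = W z 0%N ord0 by rewrite WM W0 prednK// modnn.
have Ed z : discrete m L t (E z) by have [? ? ? _] := glue (W z) (W1 z) (W2 z).
have Einj z : E z = 0 -> z = 0.
  move=> Ez; have z0 i j : p1 0 i j = 0.
    by have := p1D (-1) 0 0 i j; rewrite scaler0 addr0 scaleN1r addNr.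
  have z2 : p2 0 = 0 by have := p2D (-1) 0 0; rewrite scaler0 addr0 scaleN1r addNr.
  apply: ext => [i j iL|].
    have jm : (j < m.+1)%N by exact: leq_trans (ltn_ord j) (leqnSn m).
    have [_ _ _ yE] := glue (W z) (W1 z) (W2 z).
    pose s : R := t i + (t i.+1 - t i) * node R (Ordinal jm).
    have sI : t i <= s <= t i.+1.
      have h0 := step_gt0 mesh iL; have /andP[n0 n1] := node_in01 R m_gt0 (Ordinal jm).
      apply/andP; split; first by rewrite lerDl mulr_ge0// ltW.
      by rewrite -lerBrDl ger_pMr.
    have Es : nodal t (W z) i s = p1 z i j.
      rewrite /s (nodal_node m_gt0 mesh (W z) (Ordinal jm) iL) (WI z i (Ordinal jm) (ltn_ord j)).
      by congr (p1 _ _ _); apply: val_inj.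
    have := yE i s iL sI; rewrite Es.
    have -> : nodal t (W z) (idx s) (red s) = yof (E z) s by [].
    by rewrite Ez z0 => <-.
  rewrite z2; apply/rowP => c; case: (unliftP ord0 c) => [c'|] ->.
    by have /(congr1 (fun x => pof x ord0 c')) := Ez; rewrite /pof /= !mxE.
  by have := congr1 (@Tof _ _ _) Ez; rewrite mxE.
pose S z := pack (S1 (E z)) (S2 (E z)).
have SD a x z : S (a *: x + z) = a *: S x + S z.
  have [l1 l2] := lin a _ _ (Ed x) (Ed z).
  by apply: ext => [i j iL|]; rewrite ?p1D ?p2D ?pk1 ?pk2 ?ED ?l1 ?l2.
have Sker z : S z = 0 -> z = 0.
  move=> Sz; have [] := (normP (S z) 0 (lexx 0)).1; first by rewrite Sz normr0.
  move=> H1 H2; apply: Einj; apply: ker (Ed z) _ _ => [i j iL|].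
    by apply/eqP; rewrite -normr_le0 -(pk1 _ (S2 (E z)) i j iL); exact: H1.
  by apply/eqP; rewrite -normr_le0 -(pk2 (S1 (E z)) (S2 (E z))).
have [z Sz] := linear_injective_surjective SD Sker (pack g1 g2).
exists (E z); split=> // [i j iL|].
  by have := congr1 (fun x => p1 x i j) Sz; rewrite !pk1.
by have := congr1 p2 Sz; rewrite !pk2.
Qed.

End Surjectivity.

(** A limit of the iterates along a free ultrafilter exists by boundedness; as successive iterates
    approach each other geometrically, it is a fixed point. *)
Lemma finite_contraction (R : realType) (N : nat) (c : R) (f : 'rV[R]_N -> 'rV[R]_N) :
  0 <= c -> (forall x, `|x| <= c -> `|f x| <= c) ->
  (forall x y, `|x| <= c -> `|y| <= c -> `|f x - f y| <= 1 / 2 * `|x - y|) ->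
  exists2 x, `|x| <= c & f x = x.
Proof.
move=> c0 fc fL; pose x k := iter k f 0.
have xc k : `|x k| <= c by elim: k => [|k IH]; [rewrite normr0|exact: fc].
have step k : `|x k.+1 - x k| <= (1 / 2) ^+ k * c.
  elim: k => [|k IH]; first by rewrite expr0 mul1r subr0.
  apply: (le_trans (fL _ _ (xc k.+1) (xc k))).
  have -> : (1 / 2) ^+ k.+1 * c = 1 / 2 * ((1 / 2) ^+ k * c) by rewrite exprS mulrA.
  by rewrite ler_wpM2l// divr_ge0.
have [U [UU U_oo]] := ultraFilterLemma eventually_filter.
have [l Hl] := ultra_limit UU xc.
have lc : `|l| <= c.
  apply/ler_addgt0Pr => e e0; have [k /= kl] := @filter_ex _ U _ _ (Hl e e0).
  rewrite (_ : l = x k + - (x k - l)); last by rewrite opprB addrC subrK.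
  by apply: (norm_le2 (xc k) _ (lexx _)); rewrite normrN.
exists l => //; apply/eqP; rewrite -subr_eq0 -normr_le0; apply/ler_addgt0Pr => e e0.
rewrite add0r; have e4 : 0 < e / 4 by rewrite divr_gt0.
have small : U [set k | (1 / 2) ^+ k * c <= e / 4].
  apply: U_oo; have h : `|1 / 2 : R| < 1 by rewrite ger0_norm ?divr_ge0// ltr_pdivrMr// mul1r ltr1n.
  have /cvgrPdist_lt/(_ (e / 4 / (c + 1))) := cvg_expr h.
  have c1 : 0 < c + 1 by rewrite ltr_wpDl.
  move=> /(_ (divr_gt0 e4 c1)); apply: (filterS (F := \oo)) => k /=.
  rewrite sub0r normrN normrX ger0_norm ?divr_ge0// => B.
  apply: (@le_trans _ _ (e / 4 / (c + 1) * c)); first by rewrite ler_wpM2r// ltW.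
  by rewrite -mulrA ger_pMr// mulrC ler_pdivrMr// mul1r lerDl.
have [k [/= k1 k2]] := @filter_ex _ U _ _ (filterI (Hl _ e4) small).
have B1 := fL _ _ lc (xc k); have B2 := le_trans (step k) k2.
rewrite (distrC l) in B1.
rewrite (_ : f l - l = (f l - f (x k)) + (x k.+1 - x k) + (x k - l)); last first.
  by rewrite /x /= !addrA !subrK.
by apply: (norm_le3 B1 B2 k1); lra.
Qed.

(** * Interpolation error *)

Lemma poly_primitive (R : realType) (p : {poly R}) (a : R) :
  exists2 q : {poly R}, q^`() = p & (size q <= (size p).+1)%N /\ q.[0] = a.
Proof.
exists (\poly_(i < (size p).+1) (if i is j.+1 then p`_j / j.+1%:R else a)); last first.
  by split; [exact: size_poly|rewrite horner_coef0 coef_poly].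
apply/polyP => i; rewrite coef_deriv coef_poly ltnS; case: ltnP => ip.
  by rewrite -[LHS]mulr_natr divfK// pnatr_eq0.
by rewrite mul0rn nth_default.
Qed.

(** Induction integrates the polynomial found for [derive1 u], starting from the value of [u] at 0.
    On an interval of length 1 integration does not enlarge the bound, so [B] serves for function
    and derivative. *)
Lemma taylor (R : realType) (n k : nat) (u : R -> 'rV[R]_n) (B : R) : smooth k.+1 u ->
  (forall s, 0 <= s <= 1 -> `|derive1n k.+1 u s| <= B) ->
  exists P : 'I_n -> {poly R}, (forall c, (size (P c) <= k.+1)%N) /\
   forall s, 0 <= s <= 1 -> `|u s - \row_c (P c).[s]| <= B /\
     `|derive1 u s - \row_c (P c)^`().[s]| <= B.
Proof.
have B0 (v : R -> 'rV[R]_n) : (forall s, 0 <= s <= 1 -> `|v s| <= B) -> 0 <= B.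
  by move=> /(_ 0) H; apply: le_trans (H _); rewrite ?normr_ge0// lexx ler01.
have mvt (v v' : R -> 'rV[R]_n) s : (forall r, hasD v r (v' r)) ->
    (forall r, 0 <= r <= 1 -> `|v' r| <= B) -> 0 <= s <= 1 -> v 0 = 0 -> `|v s| <= B.
  move=> vD vB /andP[s0 s1] v0; have := @hasD_increment_bound R _ v v' 0 s B s0.
  have vc : continuous v by apply: hasD_continuous => r; exists (v' r).
  rewrite v0 !subr0 => /(_ vc) H; apply: (@le_trans _ _ (B * s)).
    apply: H => r /andP[r0 rs]; split=> //; apply: vB; rewrite r0 ltW//.
    exact: lt_le_trans s1.
  by rewrite ler_piMr// (B0 v').
elim: k u => [|k IH] u us uB.
  exists (fun c => (u 0 ord0 c)%:P); split=> [c|s sI].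
    exact: leq_trans (size_polyC_leq1 _) _.
  have E : \row_c (u 0 ord0 c)%:P.[s] = u 0 by apply/rowP => c; rewrite mxE hornerC.
  have E' : \row_c ((u 0 ord0 c)%:P)^`().[s] = 0 :> 'rV[R]_n.
    by apply/rowP => c; rewrite !mxE derivC horner0.
  rewrite E E' subr0; split; last exact: uB.
  apply: (mvt (fun s => u s - u 0) (derive1 u)) => //; last by rewrite subrr.
  move=> r; have D := @smooth_hasD _ _ 1 u 0 r us isT.
  by apply: hasD_val (hasDB D (hasD_cst (u 0) r)); rewrite subr0.
have us1 : smooth k.+1 (derive1 u) by exact: smooth_derive1.
have [|Q [Qs QB]] := IH _ us1.
  by move=> s sI; have := uB s sI; rewrite derive1Sn.
have /choice[P HP] : forall c, exists P : {poly R}, P^`() = Q c /\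
    (size P <= (size (Q c)).+1)%N /\ P.[0] = u 0 ord0 c.
  by move=> c; have [P P1 P2] := poly_primitive (Q c) (u 0 ord0 c); exists P.
exists P; split=> [c|s sI].
  by have [_ [Ps _]] := HP c; apply: (leq_trans Ps); rewrite ltnS.
have E' r : \row_c (P c)^`().[r] = \row_c (Q c).[r] :> 'rV[R]_n.
  by apply/rowP => c; rewrite !mxE (HP c).1.
rewrite E'; split; last by have [] := QB s sI.
apply: (mvt (fun s => u s - \row_c (P c).[s]) (fun s => derive1 u s - \row_c (Q c).[s])) => //.
- move=> r; apply: hasDB; first exact: (@smooth_hasD _ _ _ u 0 r us isT).
  apply: hasD_rV => c; rewrite -E' mxE.
  by apply: hasD_ext (hasD_horner (P c) r) => v; rewrite mxE.
- by move=> r rI; have [] := QB r rI.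
- by apply/rowP => c; rewrite !mxE (HP c).2.2 subrr.
Qed.

Section Interpolation.
Context (R : realType) (n m L : nat) (t : nat -> R).
Hypothesis m_gt0 : (0 < m)%N.
Hypothesis mesh : is_mesh L t.
Hypothesis L_gt0 : (0 < L)%N.
Implicit Type W : nat -> 'I_m.+1 -> 'rV[R]_n.

Local Notation lag := (lagrange_poly (@node R m)).

Lemma nodal_hasD W i s : hasD (nodal t W i) s
  ((t i.+1 - t i)^-1 *: \sum_k (lag k)^`().[(s - t i) / (t i.+1 - t i)] *: W i k).
Proof.
pose h := (t i.+1 - t i)^-1; rewrite -/h.
apply: hasD_rV => c; pose p := \sum_k W i k ord0 c *: lag k.
pose l : {poly R} := h *: 'X + (- t i * h)%:P.
have lE r : l.[r] = (r - t i) * h by rewrite /l hornerD hornerZ hornerX hornerC; ring.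
have ld : l^`() = h%:P.
  by rewrite /l derivD derivZ derivX derivC addr0 -mul_polyC mulr1.
apply: hasD_ext (hasD_val _ (hasD_horner (p \Po l) s)).
  move=> r; rewrite horner_comp lE /p horner_sum /nodal summxE.
  by apply: eq_bigr => k _; rewrite mxE hornerZ mulrC.
rewrite deriv_comp hornerM horner_comp lE ld hornerC mulrC mxE summxE; congr (_ * _).
rewrite /p raddf_sum horner_sum; apply: eq_bigr => k _.
by rewrite /= derivZ hornerZ mulrC mxE.
Qed.

(** The summand 1 accounts for the derivative of the Taylor remainder, the sum for the derivative of
    its interpolant. *)
Definition interpolation_constant : R := 1 + \sum_(k < m.+1) poly_height (lag k)^`().

Lemma interpolation_constant_ge0 : 0 <= interpolation_constant.
Proof. by rewrite addr_ge0// sumr_ge0// => k _; exact: poly_height_ge0. Qed.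

(** Interpolation reproduces the Taylor polynomial, so only the remainder contributes. On the
    reference interval it is of size [M * h ^+ k.+1], and scaling back the derivative loses one
    power of [h]. *)
Lemma nodal_derivative_error k y M W i s : smooth k.+1 y -> (k <= m)%N ->
  (forall s, `|derive1n k.+1 y s| <= M) -> (i < L)%N -> t i <= s <= t i.+1 ->
  (forall l, W i l = y (t i + (t i.+1 - t i) * node R l)) ->
  exists2 v, hasD (nodal t W i) s v &
    `|v - derive1 y s| <= interpolation_constant * M * (t i.+1 - t i) ^+ k.
Proof.
move=> ys km yM iL /andP[s1 s2] WE; eexists; first exact: nodal_hasD.
set h := t i.+1 - t i; set sg := (s - t i) / h.
have h0 : 0 < h := step_gt0 mesh iL.
have sgI : 0 <= sg <= 1.
  apply/andP; split; first by apply: divr_ge0; [rewrite subr_ge0|exact: ltW].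
  by rewrite ler_pdivrMr// mul1r lerD2r.
have [us uD] := smooth_affine (t i) h ys.
pose B := M * h ^+ k.+1.
have M0 : 0 <= M by apply: le_trans (yM 0).
have [|P [Ps PB]] := taylor (B := B) us.
  move=> r _; rewrite uD// normrZ (ger0_norm (exprn_ge0 _ (ltW h0))) mulrC.
  by apply: ler_wpM2r (yM _); exact: exprn_ge0 (ltW h0).
have B0 : 0 <= B by rewrite mulr_ge0// exprn_ge0// ltW.
have [_ PB1] := PB sg sgI.
have E1 : derive1 (fun r => y (t i + h * r)) sg = h *: derive1 y s.
  have := uD 1%N isT; rewrite /= => ->; rewrite expr1; congr (_ *: derive1 y _).
  by rewrite /sg mulrC divfK ?gt_eqF// addrC subrK.
rewrite E1 in PB1.
pose pr (l : 'I_m.+1) : 'rV[R]_n := \row_c (P c).[node R l].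
have E2 : \row_c (P c)^`().[sg] = \sum_l (lag l)^`().[sg] *: pr l.
  apply/rowP => c; rewrite summxE mxE.
  rewrite {1}(lagrange_interpolation (node_inj m_gt0) (leq_trans (Ps c) (_ : (k.+1 <= m.+1)%N)))//.
  rewrite raddf_sum horner_sum; apply: eq_bigr => l _.
  by rewrite /= derivZ hornerZ !mxE mulrC.
have nd l : `|W i l - pr l| <= B.
  by rewrite WE; have [] := PB (node R l) (node_in01 R m_gt0 l).
have S : `|\sum_l (lag l)^`().[sg] *: W i l - h *: derive1 y s| <= interpolation_constant * B.
  rewrite (_ : _ - _ = - (h *: derive1 y s - \row_c (P c)^`().[sg]) +
      \sum_l (lag l)^`().[sg] *: (W i l - pr l)); last first.
    under [X in _ = _ + X]eq_bigr do rewrite scalerBr.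
    by rewrite sumrB -E2 opprB [RHS]addrC addrA subrK.
  rewrite /interpolation_constant mulrDl mul1r; apply: norm_le2 (lexx _).
    by rewrite normrN.
  apply: (le_trans (ler_norm_sum _ _ _)); rewrite mulr_suml; apply: ler_sum => l _.
  by rewrite normrZ; apply: ler_pM => //; exact: horner_bound.
have -> : h^-1 *: (\sum_l (lag l)^`().[sg] *: W i l) - derive1 y s =
    h^-1 *: (\sum_l (lag l)^`().[sg] *: W i l - h *: derive1 y s).
  by rewrite scalerBr scalerA mulVf ?gt_eqF// scale1r.
rewrite normrZ ger0_norm ?invr_ge0 ?(ltW h0)// ler_pdivrMl//.
apply: (le_trans S); rewrite /B exprS.
by apply/eqP/eqP => //; rewrite le_eqVlt; apply/orP; left; apply/eqP; ring.
Qed.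

(** The derivative error on each interval bounds the Lipschitz constant of [z - y]; the sup bound
    follows because [z - y] vanishes at mesh points. *)
Lemma interpolant_exists k y M (h : R) : smooth k.+1 y -> one_periodic y -> (k <= m)%N ->
  (forall s, `|derive1n k.+1 y s| <= M) -> (forall i, (i < L)%N -> t i.+1 - t i <= h) ->
  exists2 z : R -> 'rV[R]_n, [/\ one_periodic z, continuous z & piecewise_poly m L t z] &
    (forall s, `|z s - y s| <= interpolation_constant * M * h ^+ k) /\
    forall s r, `|(z s - y s) - (z r - y r)| <= interpolation_constant * M * h ^+ k * `|s - r|.
Proof.
move=> ys yp km yM th; set K := interpolation_constant * M * h ^+ k.
have [idx [red glue]] := @nodal_glue R n m L t m_gt0 mesh L_gt0.
pose W i (l : 'I_m.+1) := y (t i + (t i.+1 - t i) * node R l).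
have [t0 tL tS] := mesh.
have m0 : m%:R != 0 :> R by rewrite pnatr_eq0 -lt0n.
have W0 i : W i ord0 = y (t i) by rewrite /W /node mul0r mulr0 addr0.
have Wm i : W i ord_max = y (t i.+1) by rewrite /W /node divff// mulr1 addrC subrK.
have [||zp zc zq zE] := glue W.
- by move=> i _; rewrite W0 Wm.
- by rewrite W0 Wm prednK// tL t0 -[1]add0r yp.
set z := (fun s => nodal t W (idx s) (red s)) in zp zc zq zE.
exists z; first by split.
have M0 : 0 <= M by apply: le_trans (yM 0).
have yc : continuous y by exact: smooth_continuous ys (leq0n _).
have dp : one_periodic (fun s => z s - y s) by move=> s; rewrite zp yp.
have dc : continuous (fun s : R => z s - y s).
  by move=> s; apply: cvgB; [exact: zc|exact: yc].
have lip : forall s r, `|(z s - y s) - (z r - y r)| <= K * `|s - r|.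
  apply: (right_derivative_lipschitz dc) => x.
  have [x' x'I xred] := periodic_reduce x.
  have [i iL /andP[i1 i2]] := mesh_locate mesh x'I.
  have x'I' : t i <= x' <= t i.+1 by rewrite i1 ltW.
  have [v vD vB] := nodal_derivative_error ys km yM iL x'I' (fun l => erefl (W i l)).
  exists (v - derive1 y x'); last first.
    apply: (le_trans vB); rewrite /K ler_wpM2l//.
      by rewrite mulr_ge0// interpolation_constant_ge0.
    have h0 : 0 <= t i.+1 - t i by exact: ltW (step_gt0 mesh iL).
    by apply: lerXn2r (th i iL); rewrite nnegrE // (le_trans h0 (th i iL)).
  apply: (right_derivative_reduce dp xred).
  have yD := @smooth_hasD _ _ _ y 0 x' ys isT.
  move=> e e0; have [d d0 H] := hasDB vD yD e0.
  exists (Num.min d (t i.+1 - x')); first by rewrite lt_min d0 subr_gt0.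
  move=> s /andP[xs sx].
  have : s - x' < Num.min d (t i.+1 - x') by rewrite ltrBlDl.
  rewrite lt_min => /andP[sd sx1].
  have := H s; rewrite ger0_norm ?subr_ge0// => /(_ sd).
  have zs : z s = nodal t W i s by apply: zE => //; apply/andP; split; lra.
  by rewrite -zs -(zE i x' iL).
split=> // s; have [s' s'I sred] := periodic_reduce s.
rewrite (sred _ (fun s => `|z s - y s|)); last by move=> r; rewrite zp yp.
have [i iL /andP[i1 i2]] := mesh_locate mesh s'I.
have ti : t i <= t i <= t i.+1 by rewrite lexx ltW// tS.
(* The error vanishes at the left mesh point, at distance at most 1 from [s']. *)
have zt : z (t i) - y (t i) = 0.
  by have := zE i _ iL ti; rewrite -/(z (t i)) (nodal_left m_gt0 mesh W iL) W0 => ->; rewrite subrr.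
have := lip s' (t i); rewrite zt subr0 => H; apply: (le_trans H).
have K0 : 0 <= K by have := lip 1 0; rewrite subr0 normr1 mulr1; exact: le_trans.
rewrite ler_piMr// ger0_norm ?subr_ge0//.
have /andP[_ s'1] := s'I; have /andP[ti0 _] := mesh_in01 mesh (ltnW iL).
by move: s'1 ti0; lra.
Qed.

End Interpolation.

(** * Solution of the discrete problem *)

Section RowIdentities.
Context (R : realType) (n : nat).
Implicit Types a b d e u v w : 'rV[R]_n.

Lemma sub_defect a b u v w : a - b - w = (a - u - (b - v)) + (u - v - w).
Proof. by apply/rowP => j; rewrite !mxE; ring. Qed.

Lemma sub_newton a b d e u v w x : a - b = x - w -> d - e = x ->
  a - (d - u) - (b - (e - v)) = u - v - w.
Proof.
move=> /rowP H1 /rowP H2; apply/rowP => j; move: (H1 j) (H2 j); rewrite !mxE => E1 E2.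
by apply/eqP; rewrite -subr_eq0; apply/eqP; move: E1 E2; lra.
Qed.

Lemma sub_newton0 a b d e x : a - b = x -> d - e = x -> a - d - (b - e) = 0.
Proof.
move=> H1 H2; rewrite opprD opprK addrACA H1 (_ : - d + e = - x) ?subrr//.
by rewrite -H2 opprB addrC.
Qed.

Lemma sub_defect_linear d u v w : d - u = (d - v) - (u - v - w) - w.
Proof. by apply/rowP => j; rewrite !mxE; ring. Qed.

End RowIdentities.

Section NewtonStep.
Context (R : realType) (tau : R) (n np lmax m : nat).
Hypothesis tau_gt0 : 0 < tau.
Hypothesis lmax_ge1 : (1 <= lmax)%N.
Hypothesis m_gt0 : (0 < m)%N.
Local Notation hist := (hist R n np).
Local Notation triple := (triple R n np).
Variable G : hist -> 'rV[R]_n.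
Variables (D : nat -> hist -> seq hist -> 'rV[R]_n) (X : nat -> hist * hist -> 'rV[R]_n).
Hypothesis DX : mild_family tau lmax G D X.
Variables (Raff : triple -> 'rV[R]_np.+1) (xs : triple).
Hypothesis Raff_affine : continuous_affine (@tri_C R n np 0) (@tri_norm R n np 0) Raff.
Hypothesis ys_smooth : smooth 1 (yof xs).
Variables (Cmsh : R) (mesh : nat -> nat -> R) (tc : 'I_m -> R).
Hypothesis tc_inj : injective tc.
Hypothesis tc_in : forall j, 0 < tc j < 1.
Hypothesis mesh_ok : forall L, (1 <= L)%N -> is_mesh L (mesh L) /\
  forall i, (i < L)%N -> mesh L i.+1 - mesh L i <= Cmsh / L%:R.
Variables (L : nat) (K r : R).
Hypothesis L_gt0 : (0 < L)%N.
Hypothesis K_gt0 : 0 < K.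
Implicit Types x d : triple.
Hypothesis stable : forall d c, discrete m L (mesh L) d ->
  residual_le G X Raff xs mesh tc L d c -> small01 (K * c) d.
Hypothesis estimate : forall (t : R) x1 x2 c,
  continuous (yof x1) -> continuous (yof x2) -> one_periodic (yof x1) -> one_periodic (yof x2) ->
  small01 r (x1 - xs) -> small01 r (x2 - xs) -> small01 c (x1 - x2) ->
  `|rhs G t x1 - rhs G t x2 - linop G X xs t (x1 - x2)| <= (2 * K)^-1 * c.

Let cp i (j : 'I_m) := colloc_point (mesh L) tc i j.
Let discr x := discrete m L (mesh L) x.

Definition defect x i (j : 'I_m) : 'rV[R]_n := derive1 (yof x) (cp i j) - rhs G (cp i j) x.

Lemma colloc_derive_linear a x z i j : discr x -> discr z -> (i < L)%N ->
  derive1 (yof (a *: x + z)) (cp i j) = a *: derive1 (yof x) (cp i j) + derive1 (yof z) (cp i j).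
Proof.
move=> [_ _ xq] [_ _ zq] iL; have msh := (mesh_ok L_gt0).1.
have xD := colloc_hasD m_gt0 tc_inj tc_in msh j xq iL.
have zD := colloc_hasD m_gt0 tc_inj tc_in msh j zq iL.
exact: (hasD_derivable (hasDD (hasDZ a xD) zD)).2.
Qed.

Lemma colloc_deriveB x z i j : discr x -> discr z -> (i < L)%N ->
  derive1 (yof (x - z)) (cp i j) = derive1 (yof x) (cp i j) - derive1 (yof z) (cp i j).
Proof.
move=> xd zd iL; have := colloc_derive_linear (-1) j zd xd iL.
by rewrite !scaleN1r (addrC (- z)) => ->; rewrite addrC.
Qed.

Lemma boundary_difference x z : tri_C 0 x -> tri_C 0 z -> linear_part Raff (x - z) = Raff x - Raff
  z.
Proof.
move=> xC zC; have := linear_partB Raff_affine xC zC => ->.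
by rewrite /linear_part opprB addrA subrK.
Qed.

Lemma small01_eq0 x : small01 0 x -> x = 0.
Proof.
case: x => [[y T] p] [[H1 H2 H3] _].
have -> : T = 0 by apply/eqP; rewrite -normr_le0.
have -> : p = 0 by apply/eqP; rewrite -normr_le0.
have -> : y = 0 by apply/funext => s; apply/eqP; rewrite -normr_le0; exact: H1.
by [].
Qed.

(** Stability bounds the norm [c] of [x1 - x2] by [K * (e + (2 * K)^-1 * c)], and half of [c] is
    absorbed. With [e = 0] this is local uniqueness; with the interpolant as [x2] it is the error
    bound. *)
Lemma newton_estimate x1 x2 (e : R) : discr x1 -> discr x2 ->
  small01 r (x1 - xs) -> small01 r (x2 - xs) ->
  (forall i j, (i < L)%N -> `|defect x1 i j - defect x2 i j| <= e) ->
  `|Raff x1 - Raff x2| <= e -> small01 (2 * K * e) (x1 - x2).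
Proof.
move=> d1 d2 n1 n2 He Re; have dd : discr (x1 - x2) by exact: discreteB.
have ds := discrete_small01 m_gt0 tc_inj tc_in mesh_ok L_gt0 dd.
have sm : small01 (tri_norm01 (x1 - x2)) (x1 - x2).
  by apply: small01_tri_norm01 => //; exact: discrete_tri_C dd.
set c := tri_norm01 (x1 - x2) in sm.
have [p1 c1 _] := d1; have [p2 c2 _] := d2.
have c0 : 0 <= c by exact: tri_norm01_ge0.
have e0 : 0 <= e by exact: le_trans Re.
have K2 : 0 < 2 * K by rewrite mulr_gt0.
have q0 : 0 <= (2 * K)^-1 * c by rewrite mulr_ge0// invr_ge0 ltW.
have /tri_norm01_le : small01 (K * (e + (2 * K)^-1 * c)) (x1 - x2).
  apply: (stable dd); split=> [i j iL|]; last first.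
    rewrite boundary_difference; [|exact: discrete_tri_C d1|exact: discrete_tri_C d2].
    by apply: (le_trans Re); rewrite lerDl.
  have B1 := He i j iL; have B2 := estimate (cp i j) c1 c2 p1 p2 n1 n2 sm.
  rewrite -/(cp i j) colloc_deriveB//; set A := linop _ _ _ _ _ in B2 *.
  rewrite (_ : _ - A = (defect x1 i j - defect x2 i j) +
    (rhs G (cp i j) x1 - rhs G (cp i j) x2 - A)); first exact: (norm_le2 B1 B2 (lexx _)).
  exact: sub_defect.
rewrite -/c mulrDr mulrA invfM mulrCA mulfV ?gt_eqF// mulr1 => cE.
apply: small01W sm; move: cE c0; rewrite (mulrC 2) -mulrA (mulrCA K); set z := K * e.
by lra.
Qed.

(** A simplified Newton iteration with fixed linearization, in the coordinates of the linearized
    residual. As [|f 0| <= b] and the contraction factor is 1/2, the ball of radius [2 * b] is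
    invariant; it moves the triple by at most [2 * K * b], whence the condition on [r]. *)
Lemma collocation_solution_exists (x0 : triple) (a b : R) : discr x0 -> 0 <= b ->
  small01 a (x0 - xs) -> a + 2 * K * b <= r ->
  (forall i j, (i < L)%N -> `|defect x0 i j| <= b) -> `|Raff x0| <= b ->
  exists x, [/\ discr x, small01 r (x - xs),
    forall i j, (i < L)%N -> defect x i j = 0 & Raff x = 0].
Proof.
move=> d0 b0 n0 ab r1 r2.
have [N [pack [p1 [p2 [pk1 pk2 p1D p2D normP]]]]] := @residual_coordinates R n np.+1 m L L_gt0.
pose S1 d i j := derive1 (yof d) (cp i j) - linop G X xs (cp i j) d.
pose S2 d := linear_part Raff d.
have linc d z a' i j : discr d -> discr z -> (i < L)%N ->
    S1 (a' *: d + z) i j = a' *: S1 d i j + S1 z i j.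
  move=> dd zd iL; have [_ dc _] := dd; have [_ zc _] := zd.
  rewrite /S1 colloc_derive_linear// (linop_linear tau_gt0 DX lmax_ge1 ys_smooth _ a' dc zc).
  by rewrite scalerBr opprD addrACA.
have surj := @collocation_surjective R n np m L (mesh L) m_gt0 (mesh_ok L_gt0).1 L_gt0 S1 S2.
(* [sol] inverts the discrete linearization. Injectivity is stability with residual 0, and stability
   also bounds [sol] by [K]. *)
have /choice[sol Hsol] : forall z : 'rV[R]_N, exists d, [/\ discr d,
    forall i j, (i < L)%N -> S1 d i j = p1 z i j & S2 d = p2 z].
  move=> z; apply: surj => [a' d d' dd dd'|d dd H1 H2].
    split=> [i j iL|]; first exact: (linc d d' a' i j dd dd' iL).
    exact: (Raff_affine.1 a' d d' (discrete_tri_C dd) (discrete_tri_C dd')).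
  apply: small01_eq0; rewrite -[0](mulr0 K); apply: (stable dd); split=> [i j iL|].
    by rewrite [X in `|X|](H1 i j iL) normr0.
  by rewrite [X in `|X|]H2 normr0.
have dsol z : discr (sol z) by case: (Hsol z).
have S1B d z i j : discr d -> discr z -> (i < L)%N -> S1 (d - z) i j = S1 d i j - S1 z i j.
  move=> dd zd iL; have := linc z d (-1) i j zd dd iL.
  by rewrite !scaleN1r (addrC (- z)) => ->; rewrite addrC.
have p1B z w i j : p1 (z - w) i j = p1 z i j - p1 w i j.
  by have := p1D (-1) w z i j; rewrite !scaleN1r (addrC (- w)) => ->; rewrite addrC.
have p2B z w : p2 (z - w) = p2 z - p2 w.
  by have := p2D (-1) w z; rewrite !scaleN1r (addrC (- w)) => ->; rewrite addrC.
have solB z w : small01 (K * `|z - w|) (sol z - sol w).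
  have [_ z1 z2] := Hsol z; have [_ w1 w2] := Hsol w.
  have [H1 H2] := (normP (z - w) `|z - w| (normr_ge0 _)).1 (lexx _).
  apply: stable; first exact: discreteB (dsol z) (dsol w).
  split=> [i j iL|].
    rewrite -/(cp i j) -/(S1 (sol z - sol w) i j) S1B// z1// w1// -p1B; exact: H1.
  have := linear_partB Raff_affine (discrete_tri_C (dsol z)) (discrete_tri_C (dsol w)) => ->.
  by rewrite -/(S2 (sol z)) -/(S2 (sol w)) z2 w2 -p2B.
have p10 i j : p1 0 i j = 0 by have := p1B 0 0 i j; rewrite !subrr.
have p20 : p2 0 = 0 by have := p2B 0 0; rewrite !subrr.
have sol0 : sol 0 = 0.
  have [_ H1 H2] := Hsol 0; apply: small01_eq0; rewrite -[0](mulr0 K); apply: (stable (dsol 0)).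
  split=> [i j iL|]; first by rewrite [X in `|X|](H1 i j iL) p10 normr0.
  by rewrite [X in `|X|]H2 p20 normr0.
pose x z := x0 + sol z.
have xd z : discr (x z) by rewrite /x -[x0]scale1r; exact: (discrete_linear 1 d0 (dsol z)).
have xB z w : x z - x w = sol z - sol w by rewrite /x opprD addrACA subrr add0r.
have xn z : `|z| <= 2 * b -> small01 r (x z - xs).
  move=> zb; rewrite (_ : x z - xs = (x0 - xs) + (sol z - sol 0)); last first.
    by rewrite sol0 subr0 /x addrAC.
  apply: small01W (small01D n0 (solB z 0)); apply: le_trans ab.
  by rewrite lerD2l subr0 (mulrC 2) -mulrA ler_wpM2l// ltW.
(* At a fixed point defect and boundary residual vanish. As [sol z] has linearized residual [z],
   only the linearization error survives in [f z - f w], and the affine boundary part cancels. *)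
pose f z := pack (fun i j => p1 z i j - defect (x z) i j) (p2 z - Raff (x z)).
have fL z w : `|z| <= 2 * b -> `|w| <= 2 * b -> `|f z - f w| <= 1 / 2 * `|z - w|.
  move=> zb wb; have n1 := xn z zb; have n2 := xn w wb.
  have d1 := xd z; have d2 := xd w; have [q1 c1 _] := d1; have [q2 c2 _] := d2.
  have [_ z1 z2] := Hsol z; have [_ w1 w2] := Hsol w.
  apply/normP; first by rewrite mulr_ge0// divr_ge0.
  split=> [i j iL|]; last first.
    rewrite p2B !pk2 -z2 -w2 /S2.
    rewrite (_ : _ - _ = 0) ?normr0; first by rewrite mulr_ge0// divr_ge0.
    have C1 := discrete_tri_C (dsol z); have C2 := discrete_tri_C (dsol w).
    have E1 := linear_partB Raff_affine C1 C2.
    have E2 := boundary_difference (discrete_tri_C d1) (discrete_tri_C d2).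
    by apply: (sub_newton0 (esym E1)); rewrite -E2 xB.
  rewrite p1B !pk1//.
  have sm : small01 (K * `|z - w|) (x z - x w) by rewrite xB; exact: solB.
  have B := estimate (cp i j) c1 c2 q1 q2 n1 n2 sm.
  rewrite (_ : _ - _ = rhs G (cp i j) (x z) - rhs G (cp i j) (x w) -
    linop G X xs (cp i j) (x z - x w)); last first.
    have E1 := S1B _ _ i j (dsol z) (dsol w) iL.
    rewrite -z1// -w1//.
    have E2 := colloc_deriveB j d1 d2 iL.
    rewrite xB in E2 *.
    exact: sub_newton (esym E1) (esym E2).
  apply: (le_trans B); rewrite (_ : (2 * K)^-1 * _ = 1 / 2 * `|z - w|)//.
  by field; rewrite gt_eqF.
have fc z : `|z| <= 2 * b -> `|f z| <= 2 * b.
  move=> zb; have z0 : `|0 : 'rV[R]_N| <= 2 * b by rewrite normr0 mulr_ge0.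
  have f0 : `|f 0| <= b.
    apply/normP => //; rewrite pk2 p20 sub0r normrN /x sol0 addr0; split=> // i j iL.
    by rewrite pk1// p10 sub0r normrN /x sol0 addr0; exact: r1.
  have B := fL z 0 zb z0; rewrite subr0 in B.
  rewrite -[f z](subrK (f 0)); apply: (norm_le2 B f0).
  by move: zb; set q := `|z|; lra.
have [z zb fz] := finite_contraction (mulr_ge0 (ler0n R 2) b0) fc fL.
exists (x z); split=> //; first exact: xn.
  move=> i j iL; have := congr1 (fun w => p1 w i j) fz; rewrite pk1// => E.
  by rewrite -[LHS](subKr (p1 z i j)) E subrr.
have := congr1 p2 fz; rewrite pk2 => E.
by rewrite -[LHS](subKr (p2 z)) E subrr.
Qed.

End NewtonStep.

Lemma periodic_bounded (R : realType) (n : nat) (f : R -> 'rV[R]_n) :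
  continuous f -> one_periodic f ->
  exists2 M : R, 0 <= M & forall s, `|f s| <= M.
Proof.
move=> fc fp; have [M M0 HM] := @continuous_bounded R _ f 0 1 fc.
exists M; first exact: ltW.
move=> s; have [s' /andP[s0 s1] red] := periodic_reduce s.
by rewrite (red _ f fp); apply: HM; rewrite s0 ltW.
Qed.

Theorem theorem2p3 (R : realType) (ny np lmax m : nat) (tau : R)
    (GFDE : hist R ny np -> 'rV[R]_ny)
    (Raff : triple R ny np -> 'rV[R]_np.+1)
    (xs : triple R ny np)
    (Cmsh : R) (mesh : nat -> nat -> R) (tc : 'I_m -> R)
    (tau_gt0 : 0 < tau) (lmax_ge1 : (1 <= lmax)%N) (m_ge1 : (1 <= m)%N)
    (GFDE_mild : mildly_differentiable tau lmax GFDE)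
    (Raff_affine : continuous_affine (@tri_C R ny np 0) (@tri_norm R ny np 0) Raff)
    (xs_solution : bvp_solution GFDE Raff xs)
    (xs_nondegenerate : forall d, linearized_solution GFDE Raff xs d -> d = 0)
    (tc_nodes : collocation_nodes tc)
    (mesh_ok : forall L, (1 <= L)%N -> is_mesh L (mesh L) /\
       forall i, (i < L)%N -> mesh L i.+1 - mesh L i <= Cmsh / L%:R) :
  exists r : R, 0 < r /\ exists xL : nat -> triple R ny np,
    (\forall L \near \oo,
       [/\ discrete_solution GFDE Raff L (mesh L) tc (xL L),
           tri_norm01 (xL L - xs) <= r
         & forall x, discrete_solution GFDE Raff L (mesh L) tc x ->
             tri_norm01 (x - xs) <= r -> x = xL L]) /\
    ((fun L => tri_norm01 (xL L - xs) : R^o)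
       =O_\oo (fun L => L%:R ^- minn lmax m : R^o)).
Proof.
have [D [X [DX _]]] := mild_family_exists tau_gt0 GFDE_mild.
have [ys_periodic Ts_gt0 ys_eq Rs] := xs_solution.
have ysl := solution_smooth tau_gt0 GFDE_mild xs_solution.
have ys1 : smooth 1 (yof xs) by exact: smoothW ysl.
have ysD t : hasD (yof xs) t (rhs GFDE t xs).
  by have [d e] := ys_eq t; apply: hasD_val (derivable_hasD d); rewrite e.
have ysc : continuous (yof xs) by exact: smooth_continuous ys1 (leq0n 1).
have lin_trivial := linearized_trivial tau_gt0 lmax_ge1 DX GFDE_mild xs_solution xs_nondegenerate.
have [tc_in tc_inj _] := tc_nodes.
have [K K0 [L0 HK]] := stability tau_gt0 lmax_ge1 m_ge1 DX Raff_affine Ts_gt0 ys1 ys_periodic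
  lin_trivial tc_inj tc_in mesh_ok.
have K2 : 0 < (2 * K)^-1 by rewrite invr_gt0 mulr_gt0.
have [r1 r10 est1] := rhs_estimate tau_gt0 DX lmax_ge1 Ts_gt0 ys1 ys_periodic K2.
have [Kl [Kl0 HKl]] := linop_bounded tau_gt0 DX lmax_ge1 Ts_gt0 ys1 ys_periodic.
have [Ka [Ka0 HKa]] := affine_bounded Raff_affine.
(* The bound [Tof xs / 2] keeps all periods in the ball positive. *)
pose r := Num.min r1 (Tof xs / 2).
have r0 : 0 < r by rewrite lt_min r10 divr_gt0.
have rr1 : r <= r1 by rewrite ge_min lexx.
have rT : r <= Tof xs / 2 by rewrite ge_min lexx orbT.
have est t x1 x2 c : continuous (yof x1) -> continuous (yof x2) ->
    one_periodic (yof x1) -> one_periodic (yof x2) ->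
    small01 r (x1 - xs) -> small01 r (x2 - xs) -> small01 c (x1 - x2) ->
    `|rhs GFDE t x1 - rhs GFDE t x2 - linop GFDE X xs t (x1 - x2)| <= (2 * K)^-1 * c.
  move=> c1 c2 p1 p2 n1 n2 n.
  exact: (est1 t x1 x2 c c1 c2 p1 p2 (small01W rr1 n1) (small01W rr1 n2) n).
(* [ys] has [lmax + 1] continuous derivatives and the polynomials have degree [m]; both suffice for
   an interpolation error of order [k]. *)
pose k := minn lmax m.
have kl : (k <= lmax)%N by rewrite geq_minl.
have km : (k <= m)%N by rewrite geq_minr.
have k1 : (0 < k)%N by rewrite leq_min lmax_ge1.
have ysk : smooth k.+1 (yof xs) by exact: smoothW ysl.
have [M M0 HM] := periodic_bounded (smooth_continuous ysk (leqnn _))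
  (fun s => derive1n_periodic s ysk ys_periodic (leqnn _)).
(* The only mesh interval for [L = 1] is [0, 1]. *)
have Cm1 : 1 <= Cmsh.
  have [[t0 t1 _] /(_ 0%N isT)] := mesh_ok 1 isT.
  by rewrite t0 t1 subr0 divr1.
pose Ci := interpolation_constant R m.
have Ci0 : 0 <= Ci by exact: interpolation_constant_ge0.
pose a (L : nat) : R := Ci * M * (Cmsh / L%:R) ^+ k.
(* In units of [a L]: the derivative error of the interpolant, the linearization error, the linear
   operator and the boundary operator. *)
pose Cb : R := 1 + (2 * K)^-1 + Kl + Ka.
have Cb0 : 0 <= Cb by rewrite /Cb; lra.
pose b L := Cb * a L.
have a0 L : 0 <= a L.
  by rewrite /a !mulr_ge0// exprn_ge0// divr_ge0// (le_trans ler01).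
have b0 L : 0 <= b L by rewrite mulr_ge0.
pose C1 : R := (1 + 2 * K * Cb) * (Ci * M * Cmsh ^+ k).
have C10 : 0 <= C1.
  apply: mulr_ge0; last by rewrite !mulr_ge0// exprn_ge0// (le_trans ler01).
  by apply: addr_ge0 => //; rewrite !mulr_ge0// ltW.
have abE L : a L + 2 * K * b L = C1 * L%:R ^- k.
  by rewrite /b /a /C1 expr_div_n; ring.
pose good L := (L0 < L)%N /\ a L + 2 * K * b L <= r.
have solves L x : discrete_solution GFDE Raff L (mesh L) tc x ->
    [/\ discrete m L (mesh L) x, forall i j, (i < L)%N -> defect GFDE mesh tc L x i j = 0
      & Raff x = 0].
  move=> [xd _ H1 H2]; split; [exact: xd| |exact/esym].
  by move=> i j iL; exact/esym/H1.
have L1 L : good L -> (0 < L)%N by case=> h _; exact: leq_ltn_trans h.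
have exist L : good L -> exists x, [/\ discrete_solution GFDE Raff L (mesh L) tc x,
    small01 r (x - xs) & small01 (a L + 2 * K * b L) (x - xs)].
  move=> gL; have LL := L1 L gL; have [LL0 abr] := gL.
  have [msh step] := mesh_ok L LL.
  have [z [zp zc zq] [z1 z2]] := interpolant_exists m_ge1 msh LL ysk ys_periodic km HM step.
  (* The starting triple keeps the exact period and parameters; only the function is
     interpolated. *)
  pose x0 : triple R ny np := tri z (Tof xs) (pof xs).
  have d0 : discrete m L (mesh L) x0 by split.
  have T0 : Tof (x0 - xs) = 0 by exact: subrr.
  have p0 : pof (x0 - xs) = 0 by exact: subrr.
  have n0 : small01 (a L) (x0 - xs).
    split; last exact: z2.
    split; first exact: z1.
      by rewrite T0 normr0; exact: a0.
    by rewrite p0 normr0; exact: a0.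
  have ar : a L <= r.
    apply: le_trans abr; rewrite lerDl; apply: mulr_ge0 (b0 L).
    by apply: mulr_ge0 => //; exact: ltW.
  have nr : small01 r (x0 - xs) by exact: small01W ar n0.
  have nz : small01 r (xs - xs) by rewrite subrr; apply: small01_0; exact: ltW.
  have dc : continuous (yof (x0 - xs)).
    by move=> s; apply: cvgB; [exact: zc|exact: ysc].
  have dp : one_periodic (yof (x0 - xs)).
    by move=> s; congr (_ - _); [exact: zp|exact: ys_periodic].
  have def0 i j : (i < L)%N -> `|defect GFDE mesh tc L x0 i j| <= b L.
    move=> iL; set c := colloc_point (mesh L) tc i j.
    have zD := colloc_hasD m_ge1 tc_inj tc_in msh j zq iL.
    have B1 : `|derive1 z c - rhs GFDE c xs| <= a L := lipschitz_hasD z2 (hasDB zD (ysD c)).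
    have B2 := est c x0 xs (a L) zc ysc zp ys_periodic nr nz n0.
    have B3 := HKl c _ _ dc dp n0.1.
    rewrite -/c in B1; set A := linop _ _ _ _ _ in B2 B3.
    rewrite /defect -/c (_ : _ - _ = (derive1 z c - rhs GFDE c xs) -
      (rhs GFDE c x0 - rhs GFDE c xs - A) - A); last first.
      exact: sub_defect_linear.
    apply: (norm_le3 B1 (_ : _ <= (2 * K)^-1 * a L) (_ : _ <= Kl * a L)).
    - by rewrite normrN.
    - by rewrite normrN.
    - have := mulr_ge0 (ltW Ka0) (a0 L); rewrite /b /Cb.
      by set q := a L; set kap := (2 * K)^-1; lra.
  have R0 : `|Raff x0| <= b L.
    have C0 := discrete_tri_C d0.
    have Cs : tri_C 0 xs by apply/CpiP; split; [exact: ys_periodic|exact: smooth0].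
    have Cd : tri_C 0 (x0 - xs) by apply/CpiP; split; [exact: dp|exact: smooth0].
    have := boundary_difference Raff_affine C0 Cs; rewrite Rs subr0 => <-.
    apply: (le_trans (HKa _ _ Cd n0.1)).
    rewrite /b /Cb ler_wpM2r//; have := ltW K2; have := ltW Kl0; lra.
  have [x [xd xn x1 x2]] := collocation_solution_exists tau_gt0 lmax_ge1 m_ge1 DX Raff_affine ys1
    tc_inj tc_in mesh_ok LL K0 (HK L LL0) est d0 (b0 L) n0 abr def0 R0.
  exists x; split=> //; last first.
    rewrite addrC (_ : x - xs = (x - x0) + (x0 - xs)); last by rewrite addrA subrK.
    apply: small01D n0; apply: (newton_estimate m_ge1 Raff_affine tc_inj tc_in mesh_ok LL K0 
      (HK L LL0) est xd d0 xn nr) => [i j iL|].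
      by rewrite x1// sub0r normrN; exact: def0.
    by rewrite x2 sub0r normrN.
  split=> //.
  - have [[_ xT _] _] := xn; move: xT; rewrite (_ : Tof (x - xs) = Tof x - Tof xs)// ler_norml.
    by move=> /andP[+ _]; move: rT Ts_gt0; lra.
  - by move=> i j iL; exact/esym/x1.
have /choice[xL HxL] : forall L, exists x, good L -> [/\ discrete_solution GFDE Raff L (mesh L) tc
  x,
    small01 r (x - xs) & small01 (a L + 2 * K * b L) (x - xs)].
  move=> L; have [/exist[x Hx]|nL] := pselect (good L); first by exists x.
  (* Default value for the finitely many small [L]. *)
  by exists xs.
have goodL : \forall L \near \oo, good L.
  near=> L; split; first by near: L; exact: nbhs_infty_gt.
  have LC : C1 / r <= L%:R by near: L; exact: nbhs_infty_ger.
  have LL : (0 < L)%N by near: L; exact: nbhs_infty_gt.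
  have L0' : 0 < L%:R :> R by rewrite ltr0n.
  rewrite abE; rewrite ler_pdivrMr// in LC.
  rewrite ler_pdivrMr ?exprn_gt0//; apply: (le_trans LC); rewrite mulrC ler_pM2l//.
  by rewrite -[leLHS]expr1 ler_weXn2l// ler1n.
exists r; split=> //; exists xL; split.
  near=> L; have gL : good L by near: L.
  have [xs1 xn xr] := HxL L gL; split=> // [|x xd xr'].
    exact: tri_norm01_le.
  have LL := L1 L gL; have [LL0 _] := gL.
  have [x1 x2 x3] := solves L x xd.
  have [x1' x2' x3'] := solves L (xL L) xs1.
  have xsC : tri_C 1 xs by apply/CpiP; split.
  have mC : tri_C 1 (- xs).
    by have := tri_C_linear (-1) xsC (tri_C0 R ny np 1); rewrite scaleN1r addr0.
  have [K' K'x] := discrete_small01 m_ge1 tc_inj tc_in mesh_ok LL x1.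
  have [xp xc _] := x1.
  (* A competing solution is Lipschitz because it is piecewise polynomial, so its norm bound can be
     unfolded. *)
  have xn' : small01 r (x - xs).
    apply: small01_tri_norm01 => //; last first.
      by eexists; exact: small01D K'x (tri_norm1_small mC).
    apply/CpiP; split; first by move=> s; congr (_ - _); [exact: xp|exact: ys_periodic].
    by apply: smooth0 => s; apply: cvgB; [exact: xc|exact: ysc].
  apply/eqP; rewrite -subr_eq0; apply/eqP; apply: small01_eq0.
  (* Both solutions have zero defect, so the estimate applies with [e = 0]. *)
  rewrite -(mulr0 (2 * K)); apply: (newton_estimate m_ge1 Raff_affine tc_inj tc_in mesh_ok LL K0 
      (HK L LL0) est x1 x1' xn' xn) => [i j iL|].
    by rewrite x2// x2'// subrr normr0.
  by rewrite x3 x3' subrr normr0.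
apply/eqO_exP; exists (C1 + 1); first by rewrite ltr_wpDl.
near=> L; have gL : good L by near: L.
have [_ _ /tri_norm01_le] := HxL L gL; rewrite abE => B.
rewrite ger0_norm; last exact: tri_norm01_ge0.
have p0 : 0 <= L%:R ^- k :> R by rewrite invr_ge0 exprn_ge0.
rewrite [leRHS](_ : _ = (C1 + 1) * L%:R ^- k); last by congr (_ * _); rewrite ger0_norm.
by apply: (le_trans B); rewrite ler_wpM2r// lerDl.
Unshelve. all: by end_near. Qed.
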